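(* Let $\mathcal{H}(T,A,\mu)$ be a Cauchy--de Branges space with $T=\{t_n\}_{n\in\mathbb{N}}$ power separated, $|t_n|\ge 2$ for all $n$, and $A$ of finite order, and suppose that $\mathcal{H}(T,A,\mu)$ has the localization property. Then for any two attraction sets $S_1,S_2\subset T$ either $S_1\subset S_2$ or $S_2\subset S_1$ up to finite sets (that is, at least one of $S_1\setminus S_2$ and $S_2\setminus S_1$ is finite).
   Context: Cauchy--de Branges space: let $T=\{t_n\}_{n\in\mathbb{N}}$ be a sequence of distinct complex numbers with $|t_n|\to\infty$, let $\mu=\sum_n\mu_n\delta_{t_n}$ with $\mu_n>0$ and $\sum_n\frac{\mu_n}{|t_n|^2+1}<\infty$, and let $A$ be an entire function with only simple zeros whose zero set is exactly $T$. Then $$\mathcal{H}(T,A,\mu)=\Big\{F:\ F(z)=A(z)\sum_n\frac{a_n\mu_n^{1/2}}{z-t_n},\ \{a_n\}\in\ell^2\Big\},\qquad \|F\|=\|\{a_n\}\|_{\ell^2},$$ which is a Hilbert space of entire functions. $T$ is power separated if there exist $C>0$ and $N>0$ such that $\mathrm{dist}(t_n,\{t_m\}_{m\ne n})\ge C|t_n|^{-N}$ for all $n$. For an entire function $f$, $\mathcal{Z}_f$ denotes the set of all zeros of $f$; $D(z,r)$ is the open disc with center $z$ and radius $r$. Localization property: $\mathcal{H}(T,A,\mu)$ (with $T$ power separated) has the localization property if there exists a sequence of pairwise disjoint discs $\{D(t_n,r_n)\}_n$ with $r_n\to0$ such that for every nonzero $f\in\mathcal{H}(T,A,\mu)$ the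 set $\mathcal{Z}_f\setminus\bigcup_nD(t_n,r_n)$ is finite and each disc $D(t_n,r_n)$, except possibly finitely many $n$ (depending on $f$), contains at most one point of $\mathcal{Z}_f$. The set $T_f$: assume $\mathcal{H}(T,A,\mu)$ has the localization property and let $f\in\mathcal{H}(T,A,\mu)$ be nonzero. Fix $M>0$ so large that the discs $D(t_n,|t_n|^{-M})$ are pairwise disjoint. Then all but finitely many zeros of $f$ lie in $\bigcup_nD(t_n,|t_n|^{-M})$, and all but finitely many of these discs contain at most one zero of $f$; $T_f\subset T$ is the set of those $t_n$ for which $D(t_n,|t_n|^{-M})$ contains a zero of $f$. Up to a finite set, $T_f$ does not depend on the choice of $M$. Attraction set: $S\subset T$ is an attraction set if there exists a nonzero $f\in\mathcal{H}(T,A,\mu)$ such that $S$ and $T_f$ differ by a finite set. *)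

(* Defs.v *)
From Stdlib Require Import Reals List.
From Coquelicot Require Import Coquelicot.
Open Scope R_scope.

Definition finite_set {X : Type} (E : X -> Prop) : Prop :=
  exists l : list X, forall x, E x -> List.In x l.

Definition setminus {X : Type} (E F : X -> Prop) : X -> Prop :=
  fun x => E x /\ ~ F x.

Definition subset {X : Type} (E F : X -> Prop) : Prop :=
  forall x, E x -> F x.

Definition at_most_one {X : Type} (E : X -> Prop) : Prop :=
  forall x y, E x -> E y -> x = y.

Definition finitely_different {X : Type} (E F : X -> Prop) : Prop :=
  finite_set (setminus E F) /\ finite_set (setminus F E).

Definition pairwise_disjoint {X : Type} (D : nat -> X -> Prop) : Prop :=
  forall n m, n <> m -> forall x, ~ (D n x /\ D m x).

Definition range {X : Type} (u : nat -> X) : X -> Prop :=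
  fun x => exists n, x = u n.

Definition disc (c : C) (r : R) : C -> Prop := fun z => Cmod (z - c) < r.

Definition distance (z : C) (E : C -> Prop) : Rbar :=
  Glb_Rbar (fun d => exists w, E w /\ d = Cmod (z - w)).

Definition entire (f : C -> C) : Prop := forall z : C, ex_derive f z.

Definition zeros (f : C -> C) : C -> Prop := fun z => f z = 0%C.

Definition nonzero (f : C -> C) : Prop := exists z, f z <> 0%C.

Definition only_simple_zeros (f : C -> C) : Prop :=
  forall z, zeros f z -> C_derive f z <> 0%C.

Definition finite_order (f : C -> C) : Prop :=
  exists rho R0 : R, 0 < R0 /\
    forall z, R0 <= Cmod z -> Cmod (f z) <= exp (Rpower (Cmod z) rho).

Record CdB_data (t : nat -> C) (A : C -> C) (mu : nat -> R) : Prop := {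
  CdB_inj : forall n m, t n = t m -> n = m;
  CdB_infty : is_lim_seq (fun n => Cmod (t n)) p_infty;
  CdB_mu_pos : forall n, 0 < mu n;
  CdB_mu_sum : ex_series (fun n => mu n / (Cmod (t n) ^ 2 + 1));
  CdB_entire : entire A;
  CdB_simple : only_simple_zeros A;
  CdB_zeros : forall z, zeros A z <-> range t z
}.

Definition ell2 (a : nat -> C) : Prop := ex_series (fun n => Cmod (a n) ^ 2).

(* Underlying set of functions of H(T,A,mu).  The Cauchy-type series is
   meaningless on T, so the product formula is required off T only; there
   A z <> 0, and the values of f on T are then forced by f being entire. *)
Definition CdB_space (t : nat -> C) (A : C -> C) (mu : nat -> R)
    (f : C -> C) : Prop :=
  entire f /\
  exists a : nat -> C, ell2 a /\
    forall z, ~ range t z ->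
      exists s : C,
        is_series (fun n => (a n * RtoC (sqrt (mu n)) / (z - t n))%C) s /\
        f z = (A z * s)%C.

(* Rpower x y is the real power only for 0 < x: the powers of |t n| below are
   meant for sequences avoiding 0. *)
Definition power_separated (t : nat -> C) : Prop :=
  exists c N : R, 0 < c /\ 0 < N /\
    forall n,
      Rbar_le (Rbar.Finite (c * Rpower (Cmod (t n)) (- N)))
              (distance (t n) (fun w => exists m, m <> n /\ w = t m)).

Definition localization_property (t : nat -> C) (A : C -> C) (mu : nat -> R)
    : Prop :=
  exists r : nat -> R,
    (forall n, 0 < r n) /\
    is_lim_seq r 0 /\
    pairwise_disjoint (fun n => disc (t n) (r n)) /\
    forall f, CdB_space t A mu f -> nonzero f ->
      finite_set (setminus (zeros f) (fun z => exists n, disc (t n) (r n) z)) /\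
      finite_set (fun n =>
        ~ at_most_one (fun z => zeros f z /\ disc (t n) (r n) z)).

Definition power_disc (t : nat -> C) (M : R) (n : nat) : C -> Prop :=
  disc (t n) (Rpower (Cmod (t n)) (- M)).

(* The set T_f, for the choice M of the exponent. *)
Definition attracted (t : nat -> C) (M : R) (f : C -> C) : C -> Prop :=
  fun s => exists n, s = t n /\ exists z, zeros f z /\ power_disc t M n z.

Definition attraction_set (t : nat -> C) (A : C -> C) (mu : nat -> R) (M : R)
    (S : C -> Prop) : Prop :=
  subset S (range t) /\
  exists f, CdB_space t A mu f /\ nonzero f /\
    finitely_different S (attracted t M f).

(* Main.v *)
(* Write f = A * sum_n c_n / (z - t_n).  Then f vanishes at w if and only if
   c_n = (t_n - w) d_n with sum_n d_n = 0, and moving this zero from w to x is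
   the algebraic operation c_n |-> c_n + (w - x) d_n.  Performing such moves at
   zeros far out, one at a time and with summable changes, shows that infinitely
   many zeros which can be moved at polynomial cost contradict localization.
   Consequently all but finitely many zeros are simple and closer to T than any
   power of 1/|t_n|, and if |g| <= C |f| off small discs around T, then T_g is
   contained in T_f up to a finite set.

   Given f and g, a Baire category argument yields a such that the ratio f/g
   stays away from a off small discs, so that g/(f - a g) is bounded there.  Its
   poles have tiny residues; subtracting the principal parts leaves a bounded
   entire function, so g/(f - a g) has a limit at infinity.  Hence one of f, g
   dominates the other.

   The only analytic input is a bound at the centre of a disc for continuously
   differentiable holomorphic functions, proved by averaging over polygons; no
   contour integration is needed because Cauchy transforms are explicit. *)

Require Import Defs.
From Stdlib Require Import Arith ZArith Reals Lra Lia List Classical ClassicalEpsilon FinFun.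
From Coquelicot Require Import Coquelicot.
Open Scope R_scope.

(** Localization speaks of one element at a time, so a contradiction needs a single element with
    infinitely many misplaced zeros. Moving [w] changes [c_n] by a multiple of
    [d_n = c_n / (t_n - w)], which may be large at nodes near [w]. Away from the nearest node the
    loss is a fixed power of [|t_n|]; it is paid for in advance by dividing out finitely many zeros,
    each of which gains a factor [|t_n|]. At the nearest node [c] gives no control, and a bound on
    [d_n] has to come from elsewhere: from the distance of [w] to [T], from a second zero close by,
    or, when [|g| <= C |f|], from the quotient of [g / (z - w)] by an [f] without zeros there. The
    value [a] is needed because neither [f/g] nor [g/f] has to be bounded. As [f = (f - a g) + a g],
    the limit of [g/(f - a g)] decides: if it is 0, [f] dominates [g], otherwise [g] dominates [f].
    The finitely many irregular zeros of [f - a g] are divided out first, together with equally many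
    zeros of [g], so that the ratio keeps its size at infinity. All this is done on coefficient
    sequences, where zeros on and off [T] obey the same algebra and [A] does not occur. *)

(** * The modulus of complex numbers *)

Lemma Cmod_sub_triangle (a b c : C) : Cmod (a - c) <= Cmod (a - b) + Cmod (b - c).
Proof.
  replace (a - c)%C with ((a - b) + (b - c))%C by ring. apply Cmod_triangle.
Qed.

Lemma Cmod_sub_sym (a b : C) : Cmod (a - b) = Cmod (b - a).
Proof. rewrite <- Cmod_opp. f_equal. ring. Qed.

Lemma Cmod_sub_ge (a b : C) : Cmod a - Cmod b <= Cmod (a - b).
Proof.
  pose proof (Cmod_triangle (a - b) b) as H.
  replace (a - b + b)%C with a in H by ring. lra.
Qed.

Lemma Cmod_sub_le (a b : C) : Cmod (a - b) <= Cmod a + Cmod b.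
Proof.
  pose proof (Cmod_triangle a (- b)) as H. rewrite Cmod_opp in H. exact H.
Qed.

Lemma Cmod_pos (a : C) : a <> 0%C -> 0 < Cmod a.
Proof. apply Cmod_gt_0. Qed.

Lemma Cmod_pos_neq (a : C) : 0 < Cmod a -> a <> 0%C.
Proof. intros H ->. rewrite Cmod_0 in H. lra. Qed.

Lemma Csub_neq (a b : C) : a <> b -> (a - b)%C <> 0%C.
Proof.
  intros H E. apply H. replace a with (a - b + b)%C by ring. rewrite E. ring.
Qed.

Lemma Cmod_sub_pos (a b : C) : a <> b -> 0 < Cmod (a - b).
Proof. intros H. apply Cmod_pos, Csub_neq, H. Qed.

Lemma Cmod_sub_eq_0 (a b : C) : Cmod (a - b) = 0 -> a = b.
Proof.
  intros H. apply Cmod_eq_0 in H. replace a with (a - b + b)%C by ring.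
  rewrite H. ring.
Qed.

Lemma Cmult_neq_0 (a b : C) : a <> 0%C -> b <> 0%C -> (a * b)%C <> 0%C.
Proof.
  intros Ha Hb. apply Cmod_pos_neq. rewrite Cmod_mult.
  apply Rmult_lt_0_compat; now apply Cmod_pos.
Qed.

Lemma Cmult_integral (a b : C) : (a * b)%C = 0%C -> a = 0%C \/ b = 0%C.
Proof.
  intros H. destruct (classic (a = 0%C)) as [|Ha]; [now left|].
  destruct (classic (b = 0%C)) as [|Hb]; [now right|].
  exfalso. now apply (Cmult_neq_0 a b).
Qed.

Lemma im_le_Cmod (c : C) : Rabs (Im c) <= Cmod c.
Proof.
  eapply Rle_trans; [|apply Rmax_Cmod]. apply Rmax_r.
Qed.

Lemma Cmod_le_Re_Im (c : C) : Cmod c <= Rabs (Re c) + Rabs (Im c).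
Proof.
  replace c with (RtoC (Re c) + Ci * RtoC (Im c))%C at 1.
  - eapply Rle_trans; [apply Cmod_triangle|].
    rewrite Cmod_mult, Cmod_Ci, !Cmod_R. lra.
  - destruct c as [x y]. unfold RtoC, Ci, Cplus, Cmult; simpl. f_equal; ring.
Qed.

(** * Absolutely convergent complex series *)

(** [Series] is total, so this is defined for every sequence; under [asum] it is the sum of the
    complex series, by [is_series_csum]. *)
Definition csum (a : nat -> C) : C :=
  (Series (fun n => Re (a n)), Series (fun n => Im (a n))).

Definition asum (a : nat -> C) : Prop := ex_series (fun n => Cmod (a n)).

Lemma ex_series_bound (a b : nat -> R) :
  (forall n, 0 <= a n <= b n) -> ex_series b -> ex_series a.
Proof.
  intros H Hb. apply (ex_series_le (K := R_AbsRing) (V := R_CompleteNormedModule) a b); [|exact Hb].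
  intros n. change (norm (a n)) with (Rabs (a n)).
  rewrite Rabs_right; [apply H|apply Rle_ge, H].
Qed.

Lemma asum_bound (a : nat -> C) (b : nat -> R) :
  (forall n, Cmod (a n) <= b n) -> ex_series b -> asum a.
Proof.
  intros H Hb. apply (ex_series_bound _ b); [|exact Hb].
  intros n; split; [apply Cmod_ge_0|apply H].
Qed.

Lemma ex_series_Rplus (a b : nat -> R) :
  ex_series a -> ex_series b -> ex_series (fun n => a n + b n).
Proof. apply (ex_series_plus (K := R_AbsRing) (V := R_NormedModule)). Qed.

Lemma ex_series_Rscal (k : R) (a : nat -> R) :
  ex_series a -> ex_series (fun n => k * a n).
Proof. apply (ex_series_scal_l (K := R_AbsRing) (V := R_NormedModule)). Qed.

Lemma asum_Re (a : nat -> C) : asum a -> ex_series (fun n => Re (a n)).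
Proof.
  intros H. apply ex_series_Rabs. apply (ex_series_bound _ (fun n => Cmod (a n))); [|exact H].
  intros n; split; [apply Rabs_pos|apply re_le_Cmod].
Qed.

Lemma asum_Im (a : nat -> C) : asum a -> ex_series (fun n => Im (a n)).
Proof.
  intros H. apply ex_series_Rabs. apply (ex_series_bound _ (fun n => Cmod (a n))); [|exact H].
  intros n; split; [apply Rabs_pos|apply im_le_Cmod].
Qed.

Lemma asum_plus (a b : nat -> C) :
  asum a -> asum b -> asum (fun n => (a n + b n)%C).
Proof.
  intros Ha Hb. apply (asum_bound _ (fun n => Cmod (a n) + Cmod (b n))).
  - intros n. apply Cmod_triangle.
  - now apply ex_series_Rplus.
Qed.

Lemma asum_scal (k : C) (a : nat -> C) :
  asum a -> asum (fun n => (k * a n)%C).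
Proof.
  intros Ha. apply (asum_bound _ (fun n => Cmod k * Cmod (a n))).
  - intros n. rewrite Cmod_mult. lra.
  - now apply ex_series_Rscal.
Qed.

Lemma asum_ext (a b : nat -> C) : (forall n, a n = b n) -> asum a -> asum b.
Proof.
  intros H. apply ex_series_ext. intros n. now rewrite H.
Qed.

Lemma csum_ext (a b : nat -> C) : (forall n, a n = b n) -> csum a = csum b.
Proof.
  intros H. unfold csum. f_equal; apply Series_ext; intros n; now rewrite H.
Qed.

Lemma csum_plus (a b : nat -> C) :
  asum a -> asum b -> csum (fun n => (a n + b n)%C) = (csum a + csum b)%C.
Proof.
  intros Ha Hb. unfold csum, Cplus; simpl. f_equal.
  - rewrite <- Series_plus; try now apply asum_Re. reflexivity.
  - rewrite <- Series_plus; try now apply asum_Im. reflexivity.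
Qed.

Lemma csum_scal (k : C) (a : nat -> C) :
  asum a -> csum (fun n => (k * a n)%C) = (k * csum a)%C.
Proof.
  intros Ha. pose proof (asum_Re _ Ha) as H1. pose proof (asum_Im _ Ha) as H2.
  unfold csum, Cmult; simpl. f_equal.
  - rewrite <- !Series_scal_l, <- Series_minus.
    + reflexivity.
    + now apply ex_series_Rscal.
    + now apply ex_series_Rscal.
  - rewrite <- !Series_scal_l, <- Series_plus.
    + reflexivity.
    + now apply ex_series_Rscal.
    + now apply ex_series_Rscal.
Qed.

Lemma csum_minus (a b : nat -> C) :
  asum a -> asum b -> csum (fun n => (a n - b n)%C) = (csum a - csum b)%C.
Proof.
  intros Ha Hb.
  rewrite (csum_ext (fun n => (a n - b n)%C) (fun n => (a n + (-(1)) * b n)%C)) by (intros; ring).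
  rewrite csum_plus, csum_scal; [ring| assumption | assumption | now apply asum_scal].
Qed.

Lemma asum_minus (a b : nat -> C) :
  asum a -> asum b -> asum (fun n => (a n - b n)%C).
Proof.
  intros Ha Hb. apply (asum_ext (fun n => (a n + (-(1)) * b n)%C)); [intros; ring|].
  apply asum_plus; [assumption|now apply asum_scal].
Qed.

Lemma is_series_R0 (a : nat -> R) : (forall n, a n = 0) -> is_series a 0.
Proof.
  intros H.
  assert (G : is_series (fun n => 0 * (1/2)^n) (0 * / (1 - 1/2))).
  { apply (is_series_scal_l (K := R_AbsRing) (V := R_NormedModule)).
    apply is_series_geom. rewrite Rabs_right; lra. }
  rewrite Rmult_0_l in G. revert G. apply is_series_ext.
  intros n. rewrite H. apply Rmult_0_l.
Qed.

Lemma Series_ge_0 (a : nat -> R) : (forall n, 0 <= a n) -> ex_series a -> 0 <= Series a.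
Proof.
  intros Ha Hs. rewrite <- (is_series_unique _ _ (is_series_R0 (fun _ => 0) (fun _ => eq_refl))).
  apply Series_le; [|exact Hs]. intros n; split; [lra|apply Ha].
Qed.

Lemma csum_zero (a : nat -> C) : (forall n, a n = 0%C) -> csum a = 0%C.
Proof.
  intros H. unfold csum, RtoC.
  f_equal; apply is_series_unique, is_series_R0; intros n; now rewrite H.
Qed.

(* Rotating the sum onto the positive axis reduces this to its real part. *)
Lemma csum_le (a : nat -> C) : asum a -> Cmod (csum a) <= Series (fun n => Cmod (a n)).
Proof.
  intros Ha. set (S := csum a).
  destruct (classic (S = 0%C)) as [E|E].
  - rewrite E, Cmod_0. apply Series_ge_0; [intros; apply Cmod_ge_0|exact Ha].
  - pose proof (Cmod_pos _ E) as Hp.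
    set (u := (Cconj S / RtoC (Cmod S))%C).
    assert (Hu : Cmod u = 1).
    { unfold u. rewrite Cmod_div, Cmod_conj, Cmod_R, Rabs_right; try lra.
      - field; lra.
      - intros H; apply RtoC_inj in H; lra. }
    assert (HS : (u * S)%C = RtoC (Cmod S)).
    { unfold u. replace (Cconj S / RtoC (Cmod S) * S)%C with ((S * Cconj S) / RtoC (Cmod S))%C.
      - rewrite <- Cmod2_conj. rewrite RtoC_pow. field. intros H; apply RtoC_inj in H; lra.
      - field. intros H; apply RtoC_inj in H; lra. }
    assert (HR : Cmod S = Re (csum (fun n => (u * a n)%C))).
    { rewrite csum_scal by assumption. fold S. rewrite HS. reflexivity. }
    rewrite HR. unfold csum; simpl.
    eapply Rle_trans; [apply Rle_abs|].
    assert (Hx : ex_series (fun n => Rabs (Re (u * a n)%C))).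
    { apply (ex_series_bound _ (fun n => Cmod (a n))); [|exact Ha].
      intros n; split; [apply Rabs_pos|].
      eapply Rle_trans; [apply re_le_Cmod|]. rewrite Cmod_mult, Hu. lra. }
    eapply Rle_trans; [apply (Series_Rabs _ Hx)|].
    apply Series_le; [|exact Ha]. intros n; split; [apply Rabs_pos|].
    eapply Rle_trans; [apply re_le_Cmod|]. rewrite Cmod_mult, Hu. lra.
Qed.

Lemma csum_bound (a : nat -> C) (b : nat -> R) :
  (forall n, Cmod (a n) <= b n) -> ex_series b -> Cmod (csum a) <= Series b.
Proof.
  intros H Hb. eapply Rle_trans; [apply csum_le; now apply (asum_bound _ b)|].
  apply Series_le; [|exact Hb]. intros n; split; [apply Cmod_ge_0|apply H].
Qed.

Lemma Series_term_le (a : nat -> R) (m : nat) :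
  (forall n, 0 <= a n) -> ex_series a -> a m <= Series a.
Proof.
  revert a. induction m as [|m IH]; intros a Ha Hs.
  - rewrite Series_incr_1 by assumption.
    assert (0 <= Series (fun k => a (S k))); [|lra].
    apply Series_ge_0; [intros; apply Ha|now apply ex_series_incr_1 in Hs].
  - rewrite Series_incr_1 by assumption.
    specialize (IH (fun k => a (S k)) (fun k => Ha (S k))). simpl in IH.
    specialize (Ha 0%nat). apply ex_series_incr_1 in Hs. specialize (IH Hs). lra.
Qed.

Definition zero_at (m : nat) (a : nat -> C) (n : nat) : C :=
  if Nat.eq_dec n m then 0%C else a n.

Lemma zero_at_eq (m : nat) (a : nat -> C) : zero_at m a m = 0%C.
Proof. unfold zero_at. destruct (Nat.eq_dec m m); congruence. Qed.

Lemma zero_at_neq (m n : nat) (a : nat -> C) : n <> m -> zero_at m a n = a n.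
Proof. unfold zero_at. destruct (Nat.eq_dec n m); congruence. Qed.

Lemma Cmod_zero_at_le (m n : nat) (a : nat -> C) : Cmod (zero_at m a n) <= Cmod (a n).
Proof.
  unfold zero_at. destruct (Nat.eq_dec n m); [rewrite Cmod_0; apply Cmod_ge_0|lra].
Qed.

Lemma is_series_single (a : nat -> R) (m : nat) :
  (forall n, n <> m -> a n = 0) -> is_series a (a m).
Proof.
  revert a. induction m as [|m IH]; intros a H.
  - assert (G : is_series (fun k => a (S k)) 0) by (apply is_series_R0; intros n; apply H; lia).
    apply (is_series_decr_1 (K := R_AbsRing) (V := R_NormedModule)).
    replace (plus _ _) with 0; [exact G|]. symmetry. apply Rplus_opp_r.
  - assert (G : is_series (fun k => a (S k)) (a (S m)))
      by (apply (IH (fun k => a (S k))); intros n Hn; apply H; lia).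
    apply (is_series_decr_1 (K := R_AbsRing) (V := R_NormedModule)).
    rewrite (H 0%nat) by lia.
    replace (plus _ _) with (a (S m)); [exact G|].
    unfold plus, opp; simpl. now rewrite Ropp_0, Rplus_0_r.
Qed.

Lemma asum_single (a : nat -> C) (m : nat) : (forall n, n <> m -> a n = 0%C) -> asum a.
Proof.
  intros H. exists (Cmod (a m)). apply (is_series_single (fun n => Cmod (a n))).
  intros n Hn. now rewrite (H n Hn), Cmod_0.
Qed.

Lemma csum_single (a : nat -> C) (m : nat) :
  (forall n, n <> m -> a n = 0%C) -> csum a = a m.
Proof.
  intros H. rewrite (surjective_pairing (a m)). unfold csum.
  f_equal; apply is_series_unique; apply (is_series_single (fun n => _ (a n)));
    intros n Hn; now rewrite (H n Hn).
Qed.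

Lemma asum_zero_at (m : nat) (a : nat -> C) : asum a -> asum (zero_at m a).
Proof. intros H. apply (asum_bound _ _ (fun n => Cmod_zero_at_le m n a) H). Qed.

Lemma csum_split (m : nat) (a : nat -> C) :
  asum a -> csum a = (a m + csum (zero_at m a))%C.
Proof.
  intros Ha.
  assert (Hs : csum (fun n => (a n - zero_at m a n)%C) = a m).
  { rewrite (csum_single _ m), zero_at_eq; [ring|].
    intros n Hn. rewrite zero_at_neq by assumption. ring. }
  rewrite csum_minus in Hs by auto using asum_zero_at.
  rewrite <- Hs. ring.
Qed.

Lemma asum_change (m : nat) (a : nat -> C) : asum (zero_at m a) -> asum a.
Proof.
  intros H. apply (asum_ext (fun n => (zero_at m a n + (a n - zero_at m a n))%C)); [intros; ring|].
  apply asum_plus; [exact H|]. apply (asum_single _ m).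
  intros n Hn. rewrite zero_at_neq by assumption. ring.
Qed.

Lemma sum_n_C (a : nat -> C) (n : nat) :
  sum_n a n = (sum_n (fun k => Re (a k)) n, sum_n (fun k => Im (a k)) n) :> C.
Proof.
  induction n as [|n IH].
  - rewrite !sum_O. apply surjective_pairing.
  - rewrite !sum_Sn, IH. reflexivity.
Qed.

Lemma is_series_csum (a : nat -> C) :
  asum a -> is_series (K := C_AbsRing) (V := C_NormedModule) a (csum a).
Proof.
  intros Ha.
  pose proof (Series_correct _ (asum_Re _ Ha)) as H1.
  pose proof (Series_correct _ (asum_Im _ Ha)) as H2.
  intros P [eps HP].
  assert (E1 := H1 _ (locally_ball _ eps)). assert (E2 := H2 _ (locally_ball _ eps)).
  unfold filtermap in *.
  generalize (filter_and _ _ E1 E2). apply filter_imp. intros n [B1 B2].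
  apply HP. rewrite sum_n_C. split; assumption.
Qed.

Lemma is_series_C_unique (a : nat -> C) (l : C) :
  is_series (K := C_AbsRing) (V := C_NormedModule) a l -> csum a = l.
Proof.
  intros H. rewrite (surjective_pairing l). unfold csum.
  f_equal; apply is_series_unique; intros P [eps HP];
    assert (E := H _ (locally_ball (T := C_UniformSpace) l eps)); unfold filtermap in *;
    revert E; apply filter_imp; intros n B; apply HP; rewrite sum_n_C in B; apply B.
Qed.

(** * Strictly differentiable functions and the bound at the centre of a disc *)

(** Both points vary, so at all points of a set this amounts to continuous differentiability. It
    holds for everything built from Cauchy transforms and yields, on compact sets, the uniform
    linear approximation that averaging over polygons requires; pointwise derivatives alone would
    not give that uniformity. *)
Definition strict_deriv (F : C -> C) (z l : C) : Prop :=
  forall eps, 0 < eps -> exists delta, 0 < delta /\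
    forall a b, Cmod (a - z) < delta -> Cmod (b - z) < delta ->
      Cmod (F b - F a - l * (b - a)) <= eps * Cmod (b - a).

Definition sdiff (F : C -> C) (z : C) : Prop := exists l, strict_deriv F z l.

Definition ccont (F : C -> C) (z : C) : Prop :=
  forall eps, 0 < eps -> exists delta, 0 < delta /\
    forall a, Cmod (a - z) < delta -> Cmod (F a - F z) < eps.

Definition near (z : C) (P : C -> Prop) : Prop :=
  exists delta, 0 < delta /\ forall a, Cmod (a - z) < delta -> P a.

Lemma Cmod_self (z : C) : Cmod (z - z) = 0.
Proof. replace (z - z)%C with (RtoC 0) by ring. apply Cmod_0. Qed.

Lemma near_here (z : C) (P : C -> Prop) : near z P -> P z.
Proof. intros [d [Hd H]]. apply H. now rewrite Cmod_self. Qed.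

Lemma near_and (z : C) (P Q : C -> Prop) :
  near z P -> near z Q -> near z (fun a => P a /\ Q a).
Proof.
  intros [d [Hd H]] [e [He G]]. exists (Rmin d e).
  split; [now apply Rmin_glb_lt|]. intros a Ha.
  pose proof (Rmin_l d e). pose proof (Rmin_r d e).
  split; [apply H|apply G]; lra.
Qed.

Lemma near_imp (z : C) (P Q : C -> Prop) :
  (forall a, P a -> Q a) -> near z P -> near z Q.
Proof. intros HPQ [d [Hd H]]. exists d; split; auto. Qed.

Lemma near_ball (z : C) (r : R) : 0 < r -> near z (fun a => Cmod (a - z) < r).
Proof. intros H; exists r; auto. Qed.

Lemma strict_lip (F : C -> C) (z l : C) : strict_deriv F z l ->
  exists delta, 0 < delta /\
    forall a b, Cmod (a - z) < delta -> Cmod (b - z) < delta ->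
      Cmod (F b - F a) <= (Cmod l + 1) * Cmod (b - a).
Proof.
  intros H. destruct (H 1 Rlt_0_1) as [d [Hd HF]]. exists d; split; [exact Hd|].
  intros a b Ha Hb. specialize (HF a b Ha Hb).
  replace (F b - F a)%C with ((F b - F a - l * (b - a)) + l * (b - a))%C by ring.
  eapply Rle_trans; [apply Cmod_triangle|]. rewrite Cmod_mult. lra.
Qed.

Lemma sdiff_cont (F : C -> C) (z : C) : sdiff F z -> ccont F z.
Proof.
  intros [l H]. destruct (strict_lip F z l H) as [d [Hd HF]]. intros eps He.
  pose proof (Cmod_ge_0 l) as Hl.
  exists (Rmin d (eps / (Cmod l + 2))). split.
  - apply Rmin_glb_lt; [exact Hd|]. apply Rdiv_lt_0_compat; lra.
  - intros a Ha. pose proof (Rmin_l d (eps / (Cmod l + 2))).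
    pose proof (Rmin_r d (eps / (Cmod l + 2))) as Hr.
    eapply Rle_lt_trans; [apply (HF z a); [rewrite Cmod_self; exact Hd|lra]|].
    apply Rle_lt_trans with ((Cmod l + 1) * (eps / (Cmod l + 2))).
    + apply Rmult_le_compat_l; lra.
    + assert (E : eps = (Cmod l + 2) * (eps / (Cmod l + 2))) by (field; lra).
      rewrite E at 2. apply Rmult_lt_compat_r; [apply Rdiv_lt_0_compat; lra|lra].
Qed.

Lemma ccont_near (F : C -> C) (z : C) (eps : R) :
  ccont F z -> 0 < eps -> near z (fun a => Cmod (F a - F z) < eps).
Proof. intros H He. destruct (H eps He) as [d Hd]. exists d; exact Hd. Qed.

Lemma ccont_neq0 (F : C -> C) (z : C) :
  ccont F z -> F z <> 0%C -> near z (fun a => Cmod (F z) / 2 < Cmod (F a)).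
Proof.
  intros H Hz. pose proof (Cmod_pos _ Hz) as Hp.
  assert (Hp2 : 0 < Cmod (F z) / 2) by lra.
  apply (near_imp z (fun a => Cmod (F a - F z) < Cmod (F z) / 2)).
  - intros a Ha. pose proof (Cmod_sub_ge (F z) (F a)) as H1.
    rewrite (Cmod_sub_sym (F z)) in H1. lra.
  - now apply ccont_near.
Qed.

Lemma strict_deriv_ext (F G : C -> C) (z l : C) :
  near z (fun a => F a = G a) -> strict_deriv F z l -> strict_deriv G z l.
Proof.
  intros [d [Hd E]] H eps He. destruct (H eps He) as [e [He' HF]].
  exists (Rmin d e). split; [now apply Rmin_glb_lt|]. intros a b Ha Hb.
  pose proof (Rmin_l d e). pose proof (Rmin_r d e).
  rewrite <- !E by lra. apply HF; lra.
Qed.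

Lemma sdiff_ext (F G : C -> C) (z : C) :
  near z (fun a => F a = G a) -> sdiff F z -> sdiff G z.
Proof. intros E [l H]. exists l. now apply (strict_deriv_ext F). Qed.

Lemma sdiff_const (c z : C) : sdiff (fun _ => c) z.
Proof.
  exists 0%C. intros eps He. exists 1. split; [lra|]. intros a b _ _.
  replace (c - c - 0 * (b - a))%C with (RtoC 0) by ring. rewrite Cmod_0.
  apply Rmult_le_pos; [lra|apply Cmod_ge_0].
Qed.

Lemma sdiff_id (z : C) : sdiff (fun a => a) z.
Proof.
  exists 1%C. intros eps He. exists 1. split; [lra|]. intros a b _ _.
  replace (b - a - 1 * (b - a))%C with (RtoC 0) by ring. rewrite Cmod_0.
  apply Rmult_le_pos; [lra|apply Cmod_ge_0].
Qed.

Lemma sdiff_plus (F G : C -> C) (z : C) :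
  sdiff F z -> sdiff G z -> sdiff (fun a => F a + G a)%C z.
Proof.
  intros [l H] [m K]. exists (l + m)%C. intros eps He.
  assert (He2 : 0 < eps / 2) by lra.
  destruct (H _ He2) as [d [Hd HF]]. destruct (K _ He2) as [e [Hde HG]].
  exists (Rmin d e). split; [now apply Rmin_glb_lt|]. intros a b Ha Hb.
  pose proof (Rmin_l d e). pose proof (Rmin_r d e).
  replace (F b + G b - (F a + G a) - (l + m) * (b - a))%C
    with ((F b - F a - l * (b - a)) + (G b - G a - m * (b - a)))%C by ring.
  eapply Rle_trans; [apply Cmod_triangle|].
  assert (U1 : Cmod (F b - F a - l * (b - a)) <= eps / 2 * Cmod (b - a)) by (apply HF; lra).
  assert (U2 : Cmod (G b - G a - m * (b - a)) <= eps / 2 * Cmod (b - a)) by (apply HG; lra).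
  lra.
Qed.

Lemma sdiff_comp (F G : C -> C) (z : C) :
  sdiff G z -> sdiff F (G z) -> sdiff (fun a => F (G a)) z.
Proof.
  intros SG [l H]. pose proof (sdiff_cont _ _ SG) as CG. destruct SG as [m K].
  exists (l * m)%C. intros eps He.
  pose proof (Cmod_ge_0 l) as Hl. pose proof (Cmod_ge_0 m) as Hm.
  set (e1 := eps / (2 * (Cmod m + 1))). set (e2 := eps / (2 * (Cmod l + 1))).
  assert (He1 : 0 < e1) by (apply Rdiv_lt_0_compat; lra).
  assert (He2 : 0 < e2) by (apply Rdiv_lt_0_compat; lra).
  destruct (H e1 He1) as [d1 [Hd1 HF]]. destruct (K e2 He2) as [d2 [Hd2 HG]].
  destruct (strict_lip _ _ _ K) as [d3 [Hd3 HL]]. destruct (CG d1 Hd1) as [d4 [Hd4 HC]].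
  exists (Rmin (Rmin d2 d3) d4). split; [repeat apply Rmin_glb_lt; assumption|]. intros a b Ha Hb.
  pose proof (Rmin_l (Rmin d2 d3) d4). pose proof (Rmin_r (Rmin d2 d3) d4).
  pose proof (Rmin_l d2 d3). pose proof (Rmin_r d2 d3).
  specialize (HF (G a) (G b) (HC a ltac:(lra)) (HC b ltac:(lra))).
  specialize (HG a b ltac:(lra) ltac:(lra)). specialize (HL a b ltac:(lra) ltac:(lra)).
  set (x := Cmod (b - a)) in *.
  replace (F (G b) - F (G a) - l * m * (b - a))%C
    with ((F (G b) - F (G a) - l * (G b - G a)) + l * (G b - G a - m * (b - a)))%C by ring.
  eapply Rle_trans; [apply Cmod_triangle|]. rewrite Cmod_mult.
  assert (T1 : e1 * Cmod (G b - G a) <= e1 * ((Cmod m + 1) * x)) by (apply Rmult_le_compat_l; lra).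
  assert (T2 : Cmod l * Cmod (G b - G a - m * (b - a)) <= (Cmod l + 1) * (e2 * x))
    by (apply Rmult_le_compat; try apply Cmod_ge_0; lra).
  assert (E1 : e1 * ((Cmod m + 1) * x) = eps / 2 * x) by (unfold e1; field; lra).
  assert (E2 : (Cmod l + 1) * (e2 * x) = eps / 2 * x) by (unfold e2; field; lra).
  lra.
Qed.

Lemma sdiff_square (z : C) : sdiff (fun a => a * a)%C z.
Proof.
  exists (z + z)%C. intros eps He. exists (eps / 2). split; [lra|]. intros a b Ha Hb.
  replace (b * b - a * a - (z + z) * (b - a))%C with (((a - z) + (b - z)) * (b - a))%C by ring.
  rewrite Cmod_mult. apply Rmult_le_compat_r; [apply Cmod_ge_0|].
  eapply Rle_trans; [apply Cmod_triangle|]. lra.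
Qed.

Lemma sdiff_Cinv (z : C) : z <> 0%C -> sdiff (fun a => / a)%C z.
Proof.
  intros Hz. pose proof (Cmod_pos _ Hz) as Hp. set (p := Cmod z) in *.
  exists (- / (z * z))%C. intros eps He.
  assert (H3 : 0 < p ^ 3) by (apply pow_lt; exact Hp).
  (* Within [p / 2] of [z] the moduli of [a] and [b] lie between [p / 2] and [3 p / 2], so the error
     factor is at most [(5/2 p d) / (p^4 / 4) = 10 d / p^3]. *)
  set (d := Rmin (p / 2) (eps * p ^ 3 / 10)).
  assert (Hd : 0 < d) by (apply Rmin_glb_lt; [|apply Rdiv_lt_0_compat; [apply Rmult_lt_0_compat|]]; lra).
  assert (Hd1 : d <= p / 2) by apply Rmin_l.
  assert (Hd2 : d <= eps * p ^ 3 / 10) by apply Rmin_r.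
  exists d. split; [exact Hd|]. intros a b Ha Hb.
  pose proof (Cmod_sub_ge z a) as Za. pose proof (Cmod_sub_ge z b) as Zb.
  pose proof (Cmod_sub_ge b z) as Zb'.
  rewrite (Cmod_sub_sym z a) in Za. rewrite (Cmod_sub_sym z b) in Zb. fold p in Za, Zb, Zb'.
  assert (Na : a <> 0%C) by (apply Cmod_pos_neq; lra).
  assert (Nb : b <> 0%C) by (apply Cmod_pos_neq; lra).
  replace (/ b - / a - - / (z * z) * (b - a))%C
    with (((a - z) * b + z * (b - z)) / (z * z * (a * b)) * (b - a))%C by (field; auto).
  rewrite Cmod_mult, Cmod_div by (repeat apply Cmult_neq_0; assumption).
  apply Rmult_le_compat_r; [apply Cmod_ge_0|].
  replace (Cmod (z * z * (a * b))) with (p * p * (Cmod a * Cmod b)) by (rewrite !Cmod_mult; reflexivity).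
  assert (Q1 : Cmod ((a - z) * b + z * (b - z)) <= d * (5 / 2 * p)).
  { eapply Rle_trans; [apply Cmod_triangle|]. rewrite !Cmod_mult. fold p.
    assert (Cmod (a - z) * Cmod b <= d * (3 / 2 * p)) by (apply Rmult_le_compat; try apply Cmod_ge_0; lra).
    assert (p * Cmod (b - z) <= p * d) by (apply Rmult_le_compat_l; lra). lra. }
  assert (Q2 : p / 2 * (p / 2) <= Cmod a * Cmod b) by (apply Rmult_le_compat; lra).
  assert (Q3 : p * p * (p / 2 * (p / 2)) <= p * p * (Cmod a * Cmod b))
    by (apply Rmult_le_compat_l; [nra|exact Q2]).
  assert (Q4 : 0 < p * p * (p / 2 * (p / 2))) by (repeat apply Rmult_lt_0_compat; lra).
  apply Rmult_le_reg_r with (p * p * (Cmod a * Cmod b)); [lra|].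
  unfold Rdiv at 1. rewrite Rmult_assoc, Rinv_l, Rmult_1_r by lra.
  eapply Rle_trans; [exact Q1|].
  apply Rle_trans with (eps * (p * p * (p / 2 * (p / 2)))); [|apply Rmult_le_compat_l; lra].
  apply Rle_trans with (eps * p ^ 3 / 10 * (5 / 2 * p)); [apply Rmult_le_compat_r; lra|].
  right. field.
Qed.

Lemma sdiff_scal (k : C) (F : C -> C) (z : C) : sdiff F z -> sdiff (fun a => k * F a)%C z.
Proof.
  intros [l H]. exists (k * l)%C. intros eps He. pose proof (Cmod_ge_0 k) as Hk.
  destruct (H (eps / (Cmod k + 1))) as [d [Hd K]]; [apply Rdiv_lt_0_compat; lra|].
  exists d. split; [exact Hd|]. intros a b Ha Hb.
  replace (k * F b - k * F a - k * l * (b - a))%C with (k * (F b - F a - l * (b - a)))%C by ring.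
  rewrite Cmod_mult.
  apply Rle_trans with ((Cmod k + 1) * (eps / (Cmod k + 1) * Cmod (b - a))).
  - apply Rmult_le_compat; try apply Cmod_ge_0; [lra|now apply K].
  - right. field. lra.
Qed.

Lemma sdiff_opp (F : C -> C) (z : C) : sdiff F z -> sdiff (fun a => - F a)%C z.
Proof.
  intros H. apply (sdiff_ext (fun a => (-(1)) * F a)%C); [|now apply sdiff_scal].
  exists 1. split; [lra|]. intros a _. ring.
Qed.

Lemma sdiff_minus (F G : C -> C) (z : C) :
  sdiff F z -> sdiff G z -> sdiff (fun a => F a - G a)%C z.
Proof. intros H K. apply sdiff_plus; [exact H|now apply sdiff_opp]. Qed.

Lemma sdiff_mult (F G : C -> C) (z : C) :
  sdiff F z -> sdiff G z -> sdiff (fun a => F a * G a)%C z.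
Proof.
  intros H K.
  (* Polarisation: with [X = (F + G)^2 - F^2 - G^2 = 2 F G] the product is [X - X / 2], so the
     square and the chain rule suffice. *)
  apply (sdiff_ext (fun a => (F a + G a) * (F a + G a) + (-(1)) * (F a * F a + G a * G a)
                             + (-(1/2)) * ((F a + G a) * (F a + G a) + (-(1)) * (F a * F a + G a * G a)))%C).
  - exists 1. split; [lra|]. intros a _. field.
  - repeat first [apply sdiff_plus | apply sdiff_scal];
      try apply (sdiff_comp (fun w => w * w)%C); auto using sdiff_square, sdiff_plus.
Qed.

Lemma sdiff_inv (F : C -> C) (z : C) : sdiff F z -> F z <> 0%C -> sdiff (fun a => / F a)%C z.
Proof. intros H N. apply (sdiff_comp (fun w => / w)%C); [exact H|now apply sdiff_Cinv]. Qed.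

Lemma sdiff_div (F G : C -> C) (z : C) :
  sdiff F z -> sdiff G z -> G z <> 0%C -> sdiff (fun a => F a / G a)%C z.
Proof. intros H K N. apply sdiff_mult; [exact H|now apply sdiff_inv]. Qed.

(** * Points on circles and averages over regular polygons *)

Definition cis (x : R) : C := (cos x, sin x).

Lemma Cmod_cis (x : R) : Cmod (cis x) = 1.
Proof.
  unfold Cmod, cis; simpl. rewrite !Rmult_1_r, <- sqrt_1. f_equal.
  pose proof (sin2_cos2 x) as H. unfold Rsqr in H. lra.
Qed.

Lemma cis_plus (x y : R) : cis (x + y) = (cis x * cis y)%C.
Proof.
  unfold cis, Cmult; simpl. rewrite cos_plus, sin_plus. f_equal; ring.
Qed.

Lemma cis_0 : cis 0 = 1%C.
Proof. unfold cis. rewrite cos_0, sin_0. reflexivity. Qed.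

Lemma cis_2PI : cis (2 * PI) = 1%C.
Proof. unfold cis. rewrite cos_2PI, sin_2PI. reflexivity. Qed.

Lemma Cmod_cis_1 (x : R) : 0 < x -> Cmod (cis x - 1) <= x.
Proof.
  intros Hx.
  assert (E : Cmod (cis x - 1) ^ 2 = 4 * (sin (x / 2)) ^ 2).
  { rewrite Cmod2_alt. unfold cis, RtoC; simpl.
    replace x with (2 * (x / 2)) at 1 2 3 4 by field.
    rewrite cos_2a_sin, sin_2a.
    pose proof (sin2_cos2 (x / 2)) as H. unfold Rsqr in H.
    set (s := sin (x / 2)) in *. set (c := cos (x / 2)) in *.
    assert (Hc : c * c = 1 - s * s) by lra.
    match goal with |- ?X = _ =>
      replace X with (4 * s * s * s * s + 4 * s * s * (c * c)) by ring end.
    rewrite Hc. ring. }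
  pose proof (SIN_bound (x / 2)) as Hb.
  assert (Hs : (sin (x / 2)) ^ 2 <= (x / 2) ^ 2).
  { destruct (Rle_lt_dec x 2) as [H2|H2].
    - apply pow_incr. split.
      + apply sin_ge_0; [lra|]. pose proof PI2_3_2. lra.
      + left. apply sin_lt_x. lra.
    - nra. }
  apply Rsqr_incr_0_var; [|lra]. unfold Rsqr. nra.
Qed.

Fixpoint fsum (f : nat -> C) (n : nat) : C :=
  match n with O => 0%C | S m => (fsum f m + f m)%C end.

Lemma fsum_ext (f g : nat -> C) (n : nat) :
  (forall j, (j < n)%nat -> f j = g j) -> fsum f n = fsum g n.
Proof.
  intros H. induction n as [|n IH]; [reflexivity|]. simpl.
  rewrite IH by (intros; apply H; lia). now rewrite H by lia.
Qed.

Lemma fsum_plus (f g : nat -> C) (n : nat) :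
  fsum (fun j => f j + g j)%C n = (fsum f n + fsum g n)%C.
Proof. induction n as [|n IH]; simpl; [ring|rewrite IH; ring]. Qed.

Lemma fsum_scal (k : C) (f : nat -> C) (n : nat) :
  fsum (fun j => k * f j)%C n = (k * fsum f n)%C.
Proof. induction n as [|n IH]; simpl; [ring|rewrite IH; ring]. Qed.

Lemma fsum_minus_const (f : nat -> C) (c : C) (n : nat) :
  fsum (fun j => f j - c)%C n = (fsum f n - RtoC (INR n) * c)%C.
Proof.
  induction n as [|n IH]; [simpl; ring|]. rewrite S_INR, RtoC_plus. simpl fsum.
  rewrite IH. ring.
Qed.

Lemma fsum_telescope (f : nat -> C) (n : nat) :
  fsum (fun j => f (S j) - f j)%C n = (f n - f 0%nat)%C.
Proof. induction n as [|n IH]; simpl; [ring|rewrite IH; ring]. Qed.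

Lemma fsum_le (f : nat -> C) (B : R) (n : nat) :
  (forall j, (j < n)%nat -> Cmod (f j) <= B) -> Cmod (fsum f n) <= INR n * B.
Proof.
  intros H. induction n as [|n IH].
  - simpl. rewrite Cmod_0. lra.
  - rewrite S_INR. simpl fsum. eapply Rle_trans; [apply Cmod_triangle|].
    assert (Cmod (fsum f n) <= INR n * B) by (apply IH; intros; apply H; lia).
    assert (Cmod (f n) <= B) by (apply H; lia). lra.
Qed.

Lemma Cmod_lt_Rabs (a z : C) (d : R) :
  Rabs (fst a - fst z) < d / 2 -> Rabs (snd a - snd z) < d / 2 -> Cmod (a - z) < d.
Proof.
  intros H1 H2. eapply Rle_lt_trans; [apply Cmod_le_Re_Im|].
  unfold Re, Im, Cminus, Cplus, Copp; simpl. unfold Rminus in *. lra.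
Qed.

Lemma Rabs_le_Cmod (a z : C) :
  Rabs (fst a - fst z) <= Cmod (a - z) /\ Rabs (snd a - snd z) <= Cmod (a - z).
Proof.
  split; [apply (re_le_Cmod (a - z))|apply (im_le_Cmod (a - z))].
Qed.

(** Lebesgue's number lemma on a closed disc: the gauge has a positive lower bound, and monotonicity
    in the radius lets that bound serve all points. *)
Lemma compact_uniform (z0 : C) (R0 : R) (P : C -> R -> Prop) :
  (forall z, Cmod (z - z0) <= R0 ->
     exists delta, 0 < delta /\ forall a, Cmod (a - z) < delta -> P a delta) ->
  (forall a d d', 0 < d' -> d' <= d -> P a d -> P a d') ->
  exists delta, 0 < delta /\ forall a, Cmod (a - z0) <= R0 -> P a delta.
Proof.
  intros H HP.
  assert (H' : forall u v, exists delta : posreal,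
     forall a, Cmod (a - z0) <= R0 -> Rabs (fst a - u) < delta -> Rabs (snd a - v) < delta ->
       P a delta).
  { intros u v. destruct (Rle_lt_dec (Cmod ((u, v) - z0)) R0) as [Hu|Hu].
    - destruct (H (u, v) Hu) as [d [Hd HPd]].
      exists (mkposreal (d / 2) ltac:(lra)). simpl. intros a _ H1 H2.
      apply (HP a d); [lra|lra|]. apply HPd. apply Cmod_lt_Rabs; assumption.
    (* Compactness is applied to a square. At its points outside the disc the gauge is so small that
       no point of the disc comes within it. *)
    - exists (mkposreal ((Cmod ((u, v) - z0) - R0) / 2) ltac:(lra)). simpl. intros a Ha H1 H2.
      exfalso.
      assert (Cmod (a - (u, v)) < Cmod ((u, v) - z0) - R0) by (apply Cmod_lt_Rabs; assumption).
      pose proof (Cmod_sub_triangle (u, v) a z0) as T.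
      rewrite (Cmod_sub_sym (u, v) a) in T. lra. }
  pose (del := fun u v => proj1_sig (constructive_indefinite_description _ (H' u v))).
  destruct (compactness_value_2d (fst z0 - R0) (fst z0 + R0) (snd z0 - R0) (snd z0 + R0) del)
    as [d Hd].
  exists d. split; [apply cond_pos|]. intros a Ha.
  destruct (Rabs_le_Cmod a z0) as [A1 A2].
  assert (B1 := Rle_trans _ _ _ A1 Ha). assert (B2 := Rle_trans _ _ _ A2 Ha).
  apply Rabs_le_between in B1. apply Rabs_le_between in B2.
  apply NNPP. intros HN. apply (Hd (fst a) (snd a)); [lra|lra|].
  intros [u [v [_ [_ [H1 [H2 H3]]]]]]. apply HN.
  apply (HP a (del u v)); [apply cond_pos|exact H3|].
  unfold del in *. destruct (constructive_indefinite_description _ (H' u v)) as [e He]. simpl in *.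
  apply He; assumption.
Qed.

(** The condition is empty inside the radius [r], because [F] may fail to be differentiable at the
    centre. *)
Definition unif_diff_at (F : C -> C) (z0 : C) (r R0 eps : R) (a : C) (delta : R) : Prop :=
  r <= Cmod (a - z0) -> exists l, forall b, r <= Cmod (b - z0) -> Cmod (b - a) < delta ->
    Cmod (F b - F a - l * (b - a)) <= eps * Cmod (b - a).

Lemma unif_diff (F : C -> C) (z0 : C) (r R0 eps : R) : 0 < r -> 0 < eps ->
  (forall z, 0 < Cmod (z - z0) <= R0 -> sdiff F z) ->
  exists delta, 0 < delta /\
    forall a, Cmod (a - z0) <= R0 -> unif_diff_at F z0 r R0 eps a delta.
Proof.
  intros Hr He HF. apply compact_uniform.
  - intros z Hz. destruct (Rlt_le_dec (Cmod (z - z0)) r) as [Hzr|Hzr].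
    + exists (r - Cmod (z - z0)). split; [lra|]. intros a Ha Har.
      exfalso. pose proof (Cmod_sub_triangle a z z0). lra.
    + destruct (HF z ltac:(lra)) as [l Hl]. destruct (Hl eps He) as [d [Hd HH]].
      exists (d / 2). split; [lra|]. intros a Ha _. exists l. intros b _ Hb.
      apply HH; [lra|]. pose proof (Cmod_sub_triangle b a z). lra.
  - intros a d d' Hd' Hdd H Har. destruct (H Har) as [l Hl]. exists l.
    intros b Hb1 Hb2. apply Hl; [exact Hb1|lra].
Qed.

Lemma cis_mult_nat (x : R) (j : nat) : cis (INR (S j) * x) = (cis (INR j * x) * cis x)%C.
Proof. rewrite S_INR, Rmult_plus_distr_r, Rmult_1_l. apply cis_plus. Qed.

Lemma Cmod_scal_cis (r x : R) : 0 <= r -> Cmod (RtoC r * cis x) = r.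
Proof. intros H. rewrite Cmod_mult, Cmod_R, Cmod_cis, Rabs_right; lra. Qed.

(* Averages over the vertices of a regular polygon: telescoping around the
   polygon makes the derivative terms cancel up to the uniform error, so
   shrinking the radius hardly changes the average. *)
Lemma polygon_step (F : C -> C) (z0 : C) (r R0 eps delta : R) (N : nat) (x : R) (s s' : R) :
  0 < r -> 0 < eps -> (0 < N)%nat -> 0 < x -> INR N * x = 2 * PI ->
  (forall a, Cmod (a - z0) <= R0 -> unif_diff_at F z0 r R0 eps a delta) ->
  r <= s <= R0 -> r <= s' <= R0 -> R0 * x < delta -> Rabs (s' - s) < delta -> cis x <> 1%C ->
  Cmod (fsum (fun j => F (z0 + RtoC s' * cis (INR j * x)))%C N
        - fsum (fun j => F (z0 + RtoC s * cis (INR j * x)))%C N) <= INR N * (2 * eps * Rabs (s' - s)).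
Proof.
  intros Hr He HN Hx HNx HU Hs Hs' Hd1 Hd2 Hcx.
  set (P := fun (u : R) (j : nat) => (z0 + RtoC u * cis (INR j * x))%C).
  assert (HP : forall u j, 0 <= u -> Cmod (P u j - z0) = u).
  { intros u j Hu. unfold P. replace (z0 + RtoC u * cis (INR j * x) - z0)%C
      with (RtoC u * cis (INR j * x))%C by ring. now apply Cmod_scal_cis. }
  assert (HL : forall j, exists l, forall b, r <= Cmod (b - z0) -> Cmod (b - P s j) < delta ->
     Cmod (F b - F (P s j) - l * (b - P s j)) <= eps * Cmod (b - P s j)).
  { intros j. apply HU; rewrite HP; lra. }
  destruct (choice _ HL) as [l Hl].
  pose proof (Cmod_cis_1 x Hx) as Hc1.
  pose proof (Cmod_sub_pos _ _ Hcx) as Hc0.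
  set (w := (cis x - 1)%C) in *.
  assert (Eang : forall j, (P s (S j) - P s j)%C = (RtoC s * cis (INR j * x) * w)%C).
  { intros j. unfold P, w. rewrite cis_mult_nat. ring. }
  assert (Erad : forall j, (P s' j - P s j)%C = (RtoC (s' - s) * cis (INR j * x))%C).
  { intros j. unfold P. rewrite RtoC_minus. ring. }
  (* Each chord of the polygon is the constant [s * w] times a radial direction [cis (INR j * x)].
     The sum of the derivative terms along the chords is small because the polygon closes, and this
     bounds the sum of [D], which governs the radial step. *)
  set (D := fun j => (l j * cis (INR j * x))%C).
  assert (Aang : Cmod (fsum D N) <= INR N * eps).
  { assert (E0 : fsum (fun j => F (P s (S j)) - F (P s j))%C N = 0%C).
    { rewrite (fsum_telescope (fun j => F (P s j))). unfold P at 1 2.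
      rewrite HNx, cis_2PI. simpl INR. rewrite Rmult_0_l, cis_0. ring. }
    assert (E1 : fsum (fun j => F (P s (S j)) - F (P s j) - l j * (P s (S j) - P s j))%C N
                 = (- (RtoC s * w) * fsum D N)%C).
    { rewrite <- fsum_scal.
      rewrite (fsum_ext _ (fun j => (F (P s (S j)) - F (P s j)) + (- (RtoC s * w)) * D j)%C).
      - rewrite fsum_plus, E0. ring.
      - intros j _. rewrite Eang. unfold D. ring. }
    assert (E2 : Cmod (- (RtoC s * w) * fsum D N) <= INR N * (eps * (s * Cmod w))).
    { rewrite <- E1. apply fsum_le. intros j _.
      assert (Ew : Cmod (P s (S j) - P s j) = s * Cmod w).
      { rewrite Eang, Cmod_mult, Cmod_scal_cis; lra. }
      rewrite <- Ew. apply Hl; [rewrite HP; lra|]. rewrite Ew.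
      apply Rle_lt_trans with (R0 * x); [|exact Hd1].
      apply Rmult_le_compat; lra. }
    rewrite Cmod_mult, Cmod_opp, Cmod_mult, Cmod_R, Rabs_right in E2 by lra.
    apply Rmult_le_reg_l with (s * Cmod w); [apply Rmult_lt_0_compat; lra|].
    lra. }
  assert (E3 : (fsum (fun j => F (P s' j)) N - fsum (fun j => F (P s j)) N)%C
     = (fsum (fun j => F (P s' j) - F (P s j) - l j * (P s' j - P s j))%C N
        + RtoC (s' - s) * fsum D N)%C).
  { rewrite <- fsum_scal, <- fsum_plus.
    rewrite (fsum_ext (fun j => _ + _)%C (fun j => F (P s' j) + (-(1)) * F (P s j))%C).
    - rewrite fsum_plus, fsum_scal. ring.
    - intros j _. rewrite Erad. unfold D. ring. }
  fold P. change (fun j => F (z0 + RtoC s' * cis (INR j * x))%C) with (fun j => F (P s' j)).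
  change (fun j => F (z0 + RtoC s * cis (INR j * x))%C) with (fun j => F (P s j)).
  rewrite E3. eapply Rle_trans; [apply Cmod_triangle|].
  assert (G1 : Cmod (fsum (fun j => F (P s' j) - F (P s j) - l j * (P s' j - P s j))%C N)
               <= INR N * (eps * Rabs (s' - s))).
  { apply fsum_le. intros j _.
    assert (Ew : Cmod (P s' j - P s j) = Rabs (s' - s)).
    { rewrite Erad, Cmod_mult, Cmod_R, Cmod_cis. ring. }
    rewrite <- Ew. apply Hl; [rewrite HP; lra|]. rewrite Ew. exact Hd2. }
  rewrite Cmod_mult, Cmod_R.
  assert (G2 : Rabs (s' - s) * Cmod (fsum D N) <= Rabs (s' - s) * (INR N * eps)).
  { apply Rmult_le_compat_l; [apply Rabs_pos|exact Aang]. }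
  lra.
Qed.

(** The polygon average changes little between the radius [R0] and a radius [r] at which [F] is
    close to [F z0]. Continuity at the centre is enough, which admits difference quotients completed
    by their limit. *)
Lemma center_bound (F : C -> C) (z0 : C) (R0 M : R) : 0 < R0 ->
  (forall z, 0 < Cmod (z - z0) <= R0 -> sdiff F z) -> ccont F z0 ->
  (forall x, 0 <= x <= 2 * PI -> Cmod (F (z0 + RtoC R0 * cis x)%C) <= M) ->
  Cmod (F z0) <= M.
Proof.
  intros HR HF HC HM. apply Rle_plus_epsilon. intros eta Heta.
  destruct (HC (eta / 2)) as [d0 [Hd0 Hd]]; [lra|].
  set (r := Rmin (d0 / 2) R0).
  assert (Hr : 0 < r) by (apply Rmin_glb_lt; lra).
  assert (Hr1 : r < d0) by (pose proof (Rmin_l (d0 / 2) R0); unfold r; lra).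
  assert (Hr2 : r <= R0) by apply Rmin_r.
  (* The radial steps together change the average by at most [2 * eps * (R0 - r) <= eta / 2]; the
     other half of [eta] goes to continuity at the centre. *)
  set (eps := eta / (4 * R0)).
  assert (He : 0 < eps) by (apply Rdiv_lt_0_compat; lra).
  destruct (unif_diff F z0 r R0 eps Hr He HF) as [delta [Hdelta HU]].
  pose proof PI_RGT_0 as HPI.
  (* [N] makes the sides of the polygon and the radial steps shorter than [delta]; the 8 keeps the
     angle [x] below pi, so that neighbouring vertices differ. *)
  destruct (INR_unbounded (2 * PI * R0 / delta + R0 / delta + 8)) as [N HN].
  assert (H1 : 0 < 2 * PI * R0 / delta)
    by (apply Rdiv_lt_0_compat; [apply Rmult_lt_0_compat; lra|lra]).
  assert (H2 : 0 < R0 / delta) by (apply Rdiv_lt_0_compat; lra).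
  assert (HNp : 0 < INR N) by lra.
  assert (HN0 : (0 < N)%nat) by (apply INR_lt; simpl; lra).
  set (x := 2 * PI / INR N).
  assert (Hx : 0 < x) by (apply Rdiv_lt_0_compat; lra).
  assert (HNx : INR N * x = 2 * PI) by (unfold x; field; lra).
  assert (Hx1 : R0 * x < delta).
  { apply Rmult_lt_reg_l with (INR N); [lra|].
    replace (INR N * (R0 * x)) with (R0 * (INR N * x)) by ring. rewrite HNx.
    replace (R0 * (2 * PI)) with (2 * PI * R0 / delta * delta) by (field; lra).
    apply Rmult_lt_compat_r; lra. }
  assert (Hcx : cis x <> 1%C).
  { intros E. assert (Es : sin x = 0) by (apply (f_equal snd) in E; exact E).
    assert (0 < sin x); [|lra]. apply sin_gt_0; [exact Hx|].
    apply Rmult_lt_reg_l with (INR N); [lra|]. rewrite HNx.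
    assert (8 * PI <= INR N * PI) by (apply Rmult_le_compat_r; lra). lra. }
  set (h := (R0 - r) / INR N).
  assert (Hh0 : 0 <= h) by (apply Rdiv_le_0_compat; lra).
  assert (HNh : INR N * h = R0 - r) by (unfold h; field; lra).
  assert (Hh1 : h < delta).
  { apply Rmult_lt_reg_l with (INR N); [lra|]. rewrite HNh.
    apply Rle_lt_trans with R0; [lra|].
    replace R0 with (R0 / delta * delta) by (field; lra). apply Rmult_lt_compat_r; lra. }
  set (S0 := fun s : R => fsum (fun j => F (z0 + RtoC s * cis (INR j * x)))%C N).
  assert (HS : forall k, (k <= N)%nat ->
     Cmod (S0 (R0 - INR k * h) - S0 R0) <= INR N * (2 * eps * (INR k * h))).
  { induction k as [|k IH]; intros Hk.
    - simpl INR. rewrite Rmult_0_l, Rminus_0_r, Cmod_self, !Rmult_0_r. lra.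
    - eapply Rle_trans; [apply (Cmod_sub_triangle _ (S0 (R0 - INR k * h)))|].
      specialize (IH ltac:(lia)).
      assert (K1 : INR (S k) * h <= R0 - r).
      { rewrite <- HNh. apply Rmult_le_compat_r; [exact Hh0|]. apply le_INR. lia. }
      assert (K2 : 0 <= INR k * h) by (apply Rmult_le_pos; [apply pos_INR|exact Hh0]).
      assert (K3 : INR (S k) * h = INR k * h + h) by (rewrite S_INR; ring).
      assert (E : Rabs (R0 - INR (S k) * h - (R0 - INR k * h)) = h).
      { rewrite K3. replace (R0 - (INR k * h + h) - (R0 - INR k * h)) with (- h) by ring.
        rewrite Rabs_Ropp, Rabs_right; lra. }
      pose proof (polygon_step F z0 r R0 eps delta N x (R0 - INR k * h) (R0 - INR (S k) * h)
        Hr He HN0 Hx HNx HU ltac:(lra) ltac:(lra) Hx1 ltac:(rewrite E; lra) Hcx) as Q.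
      fold (S0 (R0 - INR (S k) * h)) in Q. fold (S0 (R0 - INR k * h)) in Q.
      rewrite E in Q.
      replace (INR N * (2 * eps * (INR (S k) * h))) with
        (INR N * (2 * eps * h) + INR N * (2 * eps * (INR k * h))) by (rewrite K3; ring).
      lra. }
  specialize (HS N (Nat.le_refl N)). rewrite HNh in HS.
  replace (R0 - (R0 - r)) with r in HS by ring.
  assert (B1 : Cmod (S0 R0) <= INR N * M).
  { apply fsum_le. intros j Hj. apply HM. split.
    - apply Rmult_le_pos; [apply pos_INR|lra].
    - rewrite <- HNx. apply Rmult_le_compat_r; [lra|]. apply le_INR. lia. }
  assert (B2 : Cmod (fsum (fun j => F (z0 + RtoC r * cis (INR j * x)) - F z0)%C N) <= INR N * (eta / 2)).
  { apply fsum_le. intros j _. left. apply Hd.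
    replace (z0 + RtoC r * cis (INR j * x) - z0)%C with (RtoC r * cis (INR j * x))%C by ring.
    rewrite Cmod_scal_cis; lra. }
  assert (E4 : fsum (fun j => F (z0 + RtoC r * cis (INR j * x)) - F z0)%C N
               = (S0 r - RtoC (INR N) * F z0)%C).
  { apply (fsum_minus_const (fun j => F (z0 + RtoC r * cis (INR j * x))%C)). }
  rewrite E4 in B2.
  assert (B3 : INR N * (2 * eps * (R0 - r)) <= INR N * (eta / 2)).
  { apply Rmult_le_compat_l; [lra|].
    replace (eta / 2) with (2 * eps * R0) by (unfold eps; field; lra).
    apply Rmult_le_compat_l; lra. }
  assert (B4 : INR N * Cmod (F z0) <= INR N * (M + eta)).
  { replace (INR N * Cmod (F z0)) with (Cmod (RtoC (INR N) * F z0))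
      by (rewrite Cmod_mult, Cmod_R, Rabs_right; lra).
    pose proof (Cmod_sub_ge (RtoC (INR N) * F z0) (S0 r)) as Q1.
    rewrite Cmod_sub_sym in Q1.
    pose proof (Cmod_sub_ge (S0 r) (S0 R0)) as Q2. lra. }
  apply Rmult_le_reg_l with (INR N); assumption.
Qed.

(** * Cauchy transforms *)

Definition to_infinity (u : nat -> C) : Prop :=
  forall X : R, exists N, forall n, (N <= n)%nat -> X <= Cmod (u n).

Definition ct (t c : nat -> C) (z : C) : C := csum (fun n => c n / (z - t n))%C.

(** This is what makes the series of [ct] converge absolutely off its poles, where [|z - t n|] is
    bounded below by a multiple of [|t n|]. *)
Definition adm (t c : nat -> C) : Prop := ex_series (fun n => Cmod (c n) / Cmod (t n)).

Lemma bounded_below_finite (P : nat -> Prop) (f : nat -> R) (N : nat) :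
  (forall n, P n -> 0 < f n) ->
  exists k, 0 < k /\ forall n, (n < N)%nat -> P n -> k <= f n.
Proof.
  intros H. induction N as [|N [k [Hk IH]]].
  - exists 1. split; [lra|]. intros; lia.
  - destruct (classic (P N)) as [HP|HP].
    + exists (Rmin k (f N)). split; [apply Rmin_glb_lt; auto|]. intros n Hn Pn.
      destruct (Nat.eq_dec n N) as [->|Hne]; [apply Rmin_r|].
      eapply Rle_trans; [apply Rmin_l|]. apply IH; [lia|exact Pn].
    + exists k. split; [exact Hk|]. intros n Hn Pn. apply IH; [|exact Pn].
      assert (n <> N) by congruence. lia.
Qed.

(** Nodes with [|t n| >= 2 |z|] satisfy the bound with [1/2]; the finitely many others have a
    positive minimum. Only indices with [c n <> 0] are constrained, so [z] may be a node whose
    coefficient vanishes. *)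
Lemma uniformly_off (t c : nat -> C) (z : C) :
  (forall n, 1 <= Cmod (t n)) -> to_infinity t -> (forall n, c n <> 0%C -> z <> t n) ->
  exists k, 0 < k /\ forall n, c n <> 0%C -> k * Cmod (t n) <= Cmod (z - t n).
Proof.
  intros H1 Ht Hz. destruct (Ht (2 * Cmod z)) as [N HN].
  destruct (bounded_below_finite (fun n => c n <> 0%C)
    (fun n => Cmod (z - t n) / Cmod (t n)) N) as [k [Hk HkN]].
  { intros n Hn. apply Rdiv_lt_0_compat; [now apply Cmod_sub_pos, Hz|]. specialize (H1 n). lra. }
  exists (Rmin k (1/2)). split; [apply Rmin_glb_lt; lra|]. intros n Hn. specialize (H1 n).
  destruct (le_lt_dec N n) as [Hle|Hlt].
  - specialize (HN n Hle).
    assert (Rmin k (1/2) * Cmod (t n) <= 1/2 * Cmod (t n))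
      by (apply Rmult_le_compat_r; [lra|apply Rmin_r]).
    pose proof (Cmod_sub_ge (t n) z) as Q. rewrite Cmod_sub_sym in Q. lra.
  - specialize (HkN n Hlt Hn).
    apply Rle_trans with (k * Cmod (t n)); [apply Rmult_le_compat_r; [lra|apply Rmin_l]|].
    replace (Cmod (z - t n)) with (Cmod (z - t n) / Cmod (t n) * Cmod (t n)) by (field; lra).
    apply Rmult_le_compat_r; lra.
Qed.

Lemma Cdiv_0_l (z : C) : (0 / z)%C = 0%C.
Proof. unfold Cdiv. ring. Qed.

Lemma ct_term_bound (t c : nat -> C) (z : C) (k : R) :
  (forall n, 1 <= Cmod (t n)) -> 0 < k ->
  (forall n, c n <> 0%C -> k * Cmod (t n) <= Cmod (z - t n)) ->
  forall n, Cmod (c n / (z - t n)) <= / k * (Cmod (c n) / Cmod (t n)).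
Proof.
  intros H1 Hk Hz n. specialize (H1 n).
  destruct (classic (c n = 0%C)) as [E|E].
  - rewrite E, Cdiv_0_l, Cmod_0. unfold Rdiv. rewrite Rmult_0_l, Rmult_0_r. lra.
  - specialize (Hz n E).
    assert (Hp : 0 < k * Cmod (t n)) by (apply Rmult_lt_0_compat; lra).
    rewrite Cmod_div by (apply Cmod_pos_neq; lra).
    replace (/ k * (Cmod (c n) / Cmod (t n))) with (Cmod (c n) / (k * Cmod (t n))) by (field; lra).
    apply Rmult_le_compat_l; [apply Cmod_ge_0|]. apply Rinv_le_contravar; assumption.
Qed.

Lemma ct_asum (t c : nat -> C) (z : C) :
  (forall n, 1 <= Cmod (t n)) -> to_infinity t -> adm t c ->
  (forall n, c n <> 0%C -> z <> t n) -> asum (fun n => c n / (z - t n))%C.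
Proof.
  intros H1 Ht Hc Hz. destruct (uniformly_off t c z H1 Ht Hz) as [k [Hk Hkz]].
  apply (asum_bound _ _ (ct_term_bound t c z k H1 Hk Hkz)).
  apply ex_series_Rscal, Hc.
Qed.

Lemma ct_sdiff (t c : nat -> C) (z : C) :
  (forall n, 1 <= Cmod (t n)) -> to_infinity t -> adm t c ->
  (forall n, c n <> 0%C -> z <> t n) -> sdiff (ct t c) z.
Proof.
  intros H1 Ht Hc Hz. destruct (uniformly_off t c z H1 Ht Hz) as [k0 [Hk0 Hkz]].
  (* Since [|t n| >= 1], half of the constant survives throughout the disc of radius [k] around
     [z]. *)
  set (k := k0 / 2). assert (Hk : 0 < k) by (unfold k; lra).
  set (l := fun n => (- c n / ((z - t n) * (z - t n)))%C).
  assert (Hoff : forall a, Cmod (a - z) < k -> forall n, c n <> 0%C -> k * Cmod (t n) <= Cmod (a - t n)).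
  { intros a Ha n Hn. specialize (Hkz n Hn). specialize (H1 n).
    pose proof (Cmod_sub_triangle z a (t n)) as Q. rewrite (Cmod_sub_sym z a) in Q.
    unfold k in *. nra. }
  assert (Hz0 : Cmod (z - z) < k) by (rewrite Cmod_self; exact Hk).
  assert (Hl : forall n, Cmod (l n) <= / (k * k) * (Cmod (c n) / Cmod (t n))).
  { intros n. unfold l. destruct (classic (c n = 0%C)) as [E|E].
    - rewrite E. replace (- 0)%C with (RtoC 0) by ring. rewrite Cdiv_0_l, Cmod_0.
      unfold Rdiv. rewrite Rmult_0_l, Rmult_0_r. lra.
    - pose proof (Hoff z Hz0 n E) as Hzn. specialize (H1 n).
      assert (Hp : 0 < k * Cmod (t n)) by (apply Rmult_lt_0_compat; lra).
      assert (Hne : (z - t n)%C <> 0%C) by (apply Cmod_pos_neq; lra).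
      rewrite Cmod_div by (now apply Cmult_neq_0). rewrite Cmod_opp, Cmod_mult.
      replace (/ (k * k) * (Cmod (c n) / Cmod (t n))) with (Cmod (c n) * / (k * k * Cmod (t n))) by (field; lra).
      apply Rmult_le_compat_l; [apply Cmod_ge_0|].
      apply Rinv_le_contravar; [repeat apply Rmult_lt_0_compat; lra|].
      apply Rle_trans with ((k * Cmod (t n)) * (k * Cmod (t n))).
      + replace (k * Cmod (t n) * (k * Cmod (t n))) with (k * k * Cmod (t n) * Cmod (t n)) by ring.
        rewrite <- (Rmult_1_r (k * k * Cmod (t n))) at 1.
        apply Rmult_le_compat_l; [repeat apply Rmult_le_pos; lra|lra].
      + apply Rmult_le_compat; lra. }
  assert (Al : asum l) by (apply (asum_bound _ _ Hl), ex_series_Rscal, Hc).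
  exists (csum l). intros eps He.
  set (B := Series (fun n => Cmod (c n) / Cmod (t n))).
  assert (HB : 0 <= B).
  { apply Series_ge_0; [|exact Hc]. intros n. apply Rdiv_le_0_compat; [apply Cmod_ge_0|].
    specialize (H1 n). lra. }
  (* The error of the linear approximation of [1 / (z - t n)] splits into two fractions, each with a
     numerator at most [del] and three denominators at least [k * |t n|]. *)
  set (q := 2 / (k * k * k)).
  assert (Hq : 0 < q) by (apply Rdiv_lt_0_compat; [lra|repeat apply Rmult_lt_0_compat; lra]).
  set (del := Rmin k (eps / (q * (B + 1)))).
  assert (HqB : 0 < q * (B + 1)) by (apply Rmult_lt_0_compat; lra).
  assert (Hdel : 0 < del) by (apply Rmin_glb_lt; [lra|now apply Rdiv_lt_0_compat]).
  exists del. split; [exact Hdel|]. intros a b Ha Hb.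
  assert (Ha' : Cmod (a - z) < k) by (pose proof (Rmin_l k (eps / (q * (B + 1)))); unfold del in *; lra).
  assert (Hb' : Cmod (b - z) < k) by (pose proof (Rmin_l k (eps / (q * (B + 1)))); unfold del in *; lra).
  pose proof (Hoff a Ha') as Oa. pose proof (Hoff b Hb') as Ob. pose proof (Hoff z Hz0) as Oz.
  assert (Aa : asum (fun n => c n / (a - t n))%C).
  { apply (asum_bound _ _ (ct_term_bound t c a k H1 Hk Oa)), ex_series_Rscal, Hc. }
  assert (Ab : asum (fun n => c n / (b - t n))%C).
  { apply (asum_bound _ _ (ct_term_bound t c b k H1 Hk Ob)), ex_series_Rscal, Hc. }
  unfold ct. rewrite <- csum_minus by assumption.
  replace (csum l * (b - a))%C with ((b - a) * csum l)%C by ring.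
  rewrite <- csum_scal by assumption.
  rewrite <- csum_minus; [|now apply asum_minus|now apply asum_scal].
  eapply Rle_trans.
  { apply csum_bound with (b := fun n => (del * q * Cmod (b - a)) * (Cmod (c n) / Cmod (t n)));
      [|apply ex_series_Rscal, Hc].
    intros n. unfold l. destruct (classic (c n = 0%C)) as [E|E].
    - rewrite E. replace (0 / (b - t n) - 0 / (a - t n) - (b - a) * (- 0 / ((z - t n) * (z - t n))))%C
        with (RtoC 0) by (unfold Cdiv; ring).
      rewrite Cmod_0. unfold Rdiv. rewrite Rmult_0_l, Rmult_0_r. lra.
    - specialize (Oa n E). specialize (Ob n E). specialize (Oz n E). specialize (H1 n).
      set (s := Cmod (t n)) in *.
      assert (Hp : 0 < k * s) by (apply Rmult_lt_0_compat; lra).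
      set (u := (z - t n)%C) in *. set (x := (a - t n)%C) in *. set (y := (b - t n)%C) in *.
      assert (Nu : u <> 0%C) by (apply Cmod_pos_neq; lra).
      assert (Nx : x <> 0%C) by (apply Cmod_pos_neq; lra).
      assert (Ny : y <> 0%C) by (apply Cmod_pos_neq; lra).
      assert (Eab : (b - a)%C = (y - x)%C) by (unfold x, y; ring).
      rewrite Eab.
      replace (c n / y - c n / x - (y - x) * (- c n / (u * u)))%C
        with ((c n * (y - x)) * ((y - u) / (u * u * y) + (x - u) / (u * x * y)))%C by (field; auto).
      rewrite !Cmod_mult.
      assert (Eu : Cmod (y - u) <= del) by (replace (y - u)%C with (b - z)%C by (unfold y, u; ring); lra).
      assert (Ev : Cmod (x - u) <= del) by (replace (x - u)%C with (a - z)%C by (unfold x, u; ring); lra).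
      assert (G : forall p1 p2 p3 e, k * s <= Cmod p1 -> k * s <= Cmod p2 -> k * s <= Cmod p3 ->
        Cmod e <= del -> Cmod (e / (p1 * p2 * p3)) <= del * / (k * k * k * s)).
      { intros p1 p2 p3 e G1 G2 G3 G4.
        assert (P1 : p1 <> 0%C) by (apply Cmod_pos_neq; lra).
        assert (P2 : p2 <> 0%C) by (apply Cmod_pos_neq; lra).
        assert (P3 : p3 <> 0%C) by (apply Cmod_pos_neq; lra).
        rewrite Cmod_div by (repeat apply Cmult_neq_0; assumption).
        apply Rmult_le_compat; [apply Cmod_ge_0| |exact G4|].
        - left. apply Rinv_0_lt_compat, Cmod_pos. repeat apply Cmult_neq_0; assumption.
        - apply Rinv_le_contravar; [repeat apply Rmult_lt_0_compat; lra|].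
          rewrite !Cmod_mult.
          apply Rle_trans with ((k * s) * (k * s) * (k * s)).
          + replace (k * s * (k * s) * (k * s)) with (k * k * k * s * (s * s)) by ring.
            rewrite <- (Rmult_1_r (k * k * k * s)) at 1.
            apply Rmult_le_compat_l; [repeat apply Rmult_le_pos; lra|nra].
          + apply Rmult_le_compat; [nra|lra| |assumption].
            apply Rmult_le_compat; lra. }
      pose proof (G u u y (y - u)%C Oz Oz Ob Eu) as G1.
      pose proof (G u x y (x - u)%C Oz Oa Ob Ev) as G2.
      assert (G3 : Cmod ((y - u) / (u * u * y) + (x - u) / (u * x * y)) <= del * q * / s).
      { eapply Rle_trans; [apply Cmod_triangle|].
        replace (del * q * / s) with (del * / (k * k * k * s) + del * / (k * k * k * s))
          by (unfold q; field; lra). lra. }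
      replace (del * q * Cmod (y - x) * (Cmod (c n) / s))
        with (Cmod (c n) * Cmod (y - x) * (del * q * / s)) by (unfold Rdiv; ring).
      apply Rmult_le_compat_l; [apply Rmult_le_pos; apply Cmod_ge_0|exact G3]. }
  rewrite Series_scal_l. fold B.
  replace (del * q * Cmod (b - a) * B) with ((del * (q * B)) * Cmod (b - a)) by ring.
  apply Rmult_le_compat_r; [apply Cmod_ge_0|].
  apply Rle_trans with (eps / (q * (B + 1)) * (q * (B + 1))).
  - apply Rmult_le_compat; [lra|apply Rmult_le_pos; lra|apply Rmin_r|apply Rmult_le_compat_l; lra].
  - right. field. split; lra.
Qed.

(** * Division by zeros at the level of coefficients *)

(* [c = (t - w) d] with [sum d = 0] says that the product of the Cauchy
   transform of [c] with a function vanishing simply on [t] vanishes at [w];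
   the case [w = t m] needs no separate treatment. *)
Definition is_div (t : nat -> C) (w : C) (c d : nat -> C) : Prop :=
  (forall n, c n = ((t n - w) * d n)%C) /\ asum d /\ csum d = 0%C.

Definition zr (t c : nat -> C) (w : C) : Prop := exists d, is_div t w c d.

(** Successive division by the points of [ws]; repetitions in the list express multiplicity. *)
Fixpoint chain (t c : nat -> C) (ws : list C) (d : nat -> C) : Prop :=
  match ws with
  | nil => c = d
  | w :: ws' => exists c', is_div t w c c' /\ chain t c' ws' d
  end.

Section Division.

Variable t : nat -> C.
Hypothesis t_inj : forall n m, t n = t m -> n = m.
Hypothesis t_ge_1 : forall n, 1 <= Cmod (t n).
Hypothesis t_inf : to_infinity t.

Definition off (z : C) : Prop := forall n, z <> t n.

(** Only the pole at [t m] is tolerated. Every point is of this kind for a suitable [m], so [rct m]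
    treats nodes and other points alike. *)
Definition off_but (m : nat) (z : C) : Prop := forall n, n <> m -> z <> t n.

Lemma off_or_t (z : C) : off z \/ exists m, z = t m.
Proof.
  destruct (classic (exists m, z = t m)) as [H|H]; [now right|left].
  intros n E. apply H. now exists n.
Qed.

Lemma off_off_but (m : nat) (z : C) : off z -> off_but m z.
Proof. intros H n _. apply H. Qed.

Lemma t_off_but (m : nat) : off_but m (t m).
Proof. intros n Hn E. apply Hn. symmetry. now apply t_inj. Qed.

Lemma asum_adm (c : nat -> C) : asum c -> adm t c.
Proof.
  apply ex_series_bound. intros n. specialize (t_ge_1 n). pose proof (Cmod_ge_0 (c n)).
  split; [apply Rdiv_le_0_compat; lra|].
  rewrite <- (Rmult_1_r (Cmod (c n))) at 2. apply Rmult_le_compat_l; [lra|].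
  rewrite <- Rinv_1. apply Rinv_le_contravar; lra.
Qed.

Lemma adm_plus_scal (k : C) (c d : nat -> C) :
  adm t c -> adm t d -> adm t (fun n => c n + k * d n)%C.
Proof.
  intros Hc Hd.
  apply (ex_series_bound _ (fun n => Cmod (c n) / Cmod (t n) + Cmod k * (Cmod (d n) / Cmod (t n)))).
  - intros n. specialize (t_ge_1 n). split; [apply Rdiv_le_0_compat; [apply Cmod_ge_0|lra]|].
    replace (Cmod (c n) / Cmod (t n) + Cmod k * (Cmod (d n) / Cmod (t n)))
      with ((Cmod (c n) + Cmod k * Cmod (d n)) / Cmod (t n)) by (field; lra).
    apply Rmult_le_compat_r; [left; apply Rinv_0_lt_compat; lra|].
    eapply Rle_trans; [apply Cmod_triangle|]. rewrite Cmod_mult. lra.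
  - apply ex_series_Rplus; [exact Hc|]. apply ex_series_Rscal, Hd.
Qed.

Lemma adm_zero_at (m : nat) (c : nat -> C) : adm t c -> adm t (zero_at m c).
Proof.
  apply ex_series_bound. intros n. specialize (t_ge_1 n).
  split; [apply Rdiv_le_0_compat; [apply Cmod_ge_0|lra]|].
  apply Rmult_le_compat_r; [left; apply Rinv_0_lt_compat; lra|apply Cmod_zero_at_le].
Qed.

Lemma off_asum (c : nat -> C) (z : C) : adm t c -> off z -> asum (fun n => c n / (z - t n))%C.
Proof. intros Hc Hz. apply ct_asum; auto. Qed.

Lemma ct_plus_scal (k : C) (c d : nat -> C) (z : C) : adm t c -> adm t d -> off z ->
  ct t (fun n => c n + k * d n)%C z = (ct t c z + k * ct t d z)%C.
Proof.
  intros Hc Hd Hz. unfold ct.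
  rewrite <- csum_scal, <- csum_plus; try now apply off_asum.
  - apply csum_ext. intros n. field. apply Csub_neq, Hz.
  - apply asum_scal. now apply off_asum.
Qed.

(** [(t n - w) / (z - t n) = (z - w) / (z - t n) - 1], and the terms with [-1] add up to
    [- csum d = 0]. *)
Lemma ct_div (w : C) (c d : nat -> C) (z : C) :
  is_div t w c d -> off z -> ct t c z = ((z - w) * ct t d z)%C.
Proof.
  intros [E [Ad Sd]] Hz.
  assert (A1 : asum (fun n => d n / (z - t n))%C) by (apply off_asum; [now apply asum_adm|exact Hz]).
  unfold ct. rewrite <- csum_scal by assumption.
  rewrite (csum_ext (fun n => c n / (z - t n))%C (fun n => (z - w) * (d n / (z - t n)) - d n)%C).
  - rewrite csum_minus, Sd; [ring|now apply asum_scal|exact Ad].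
  - intros n. rewrite E. field. apply Csub_neq, Hz.
Qed.

Lemma is_div_adm (w : C) (c d : nat -> C) : is_div t w c d -> adm t d.
Proof. intros [_ [Ad _]]. now apply asum_adm. Qed.

Lemma zr_of_ct (c : nat -> C) (z : C) : adm t c -> off z -> ct t c z = 0%C -> zr t c z.
Proof.
  intros Hc Hz E. exists (fun n => - (1) * (c n / (z - t n)))%C.
  pose proof (off_asum c z Hc Hz) as Ha.
  split; [|split].
  - intros n. field. apply Csub_neq, Hz.
  - now apply asum_scal.
  - rewrite csum_scal by exact Ha. unfold ct in E. rewrite E. ring.
Qed.

Lemma zr_of_t (c : nat -> C) (m : nat) : adm t c -> c m = 0%C -> zr t c (t m).
Proof.
  intros Hc E.
  set (e := fun n => (- (1) * (zero_at m c n / (t m - t n)))%C).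
  assert (Ae : asum e).
  { apply asum_scal, ct_asum; auto using adm_zero_at.
    intros n Hn En. destruct (Nat.eq_dec n m) as [->|Hne]; [now rewrite zero_at_eq in Hn|].
    apply Hne. symmetry. now apply t_inj. }
  (* The equation [c n = (t n - t m) * d n] leaves [d m] free; it is chosen so that the sum
     vanishes. *)
  set (d := fun n => if Nat.eq_dec n m then (- csum e)%C else e n).
  assert (Hdm : d m = (- csum e)%C) by (unfold d; destruct (Nat.eq_dec m m); congruence).
  assert (Hdn : forall n, n <> m -> d n = e n)
    by (intros n Hn; unfold d; destruct (Nat.eq_dec n m); congruence).
  assert (Hz : forall n, zero_at m d n = e n).
  { intros n. destruct (Nat.eq_dec n m) as [->|Hn].
    - rewrite zero_at_eq. unfold e. rewrite zero_at_eq, Cdiv_0_l. ring.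
    - rewrite zero_at_neq by assumption. now apply Hdn. }
  assert (Ad : asum d).
  { apply (asum_change m). apply (asum_ext e); [intros; now rewrite Hz|exact Ae]. }
  exists d. split; [|split; [exact Ad|]].
  - intros n. destruct (Nat.eq_dec n m) as [->|Hn]; [rewrite E; ring|].
    rewrite Hdn by assumption. unfold e. rewrite zero_at_neq by assumption. field.
    apply Csub_neq. intros En. apply Hn. symmetry. now apply t_inj.
  - rewrite (csum_split m d Ad), (csum_ext _ _ Hz), Hdm. ring.
Qed.

Lemma zr_ct (c : nat -> C) (z : C) : zr t c z -> off z -> ct t c z = 0%C.
Proof. intros [d Hd] Hz. rewrite (ct_div z c d z Hd Hz). ring. Qed.

Lemma zr_t (c : nat -> C) (m : nat) : zr t c (t m) -> c m = 0%C.
Proof. intros [d [E _]]. rewrite E. ring. Qed.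

(** Partial fractions: [1/((t - w1)(t - w2))] is the difference of [1/(t - w1)] and [1/(t - w2)]
    divided by [w1 - w2]. *)
Lemma div_exchange (w1 w2 : C) (c d1 d2 : nat -> C) : w1 <> w2 ->
  is_div t w1 c d1 -> is_div t w2 c d2 -> is_div t w2 d1 (fun n => / (w1 - w2) * (d1 n - d2 n))%C.
Proof.
  intros Hw [E1 [A1 S1]] [E2 [A2 S2]]. apply Csub_neq in Hw.
  assert (A : asum (fun n => d1 n - d2 n)%C) by now apply asum_minus.
  split; [|split].
  - intros n. specialize (E1 n). specialize (E2 n).
    replace ((t n - w2) * (/ (w1 - w2) * (d1 n - d2 n)))%C
      with (/ (w1 - w2) * ((t n - w2) * d1 n - (t n - w2) * d2 n))%C by ring.
    rewrite <- E2, E1. field. exact Hw.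
  - now apply asum_scal.
  - rewrite csum_scal, csum_minus, S1, S2 by assumption. ring.
Qed.

Lemma zr_div (w1 w2 : C) (c d1 : nat -> C) : w1 <> w2 ->
  is_div t w1 c d1 -> zr t c w2 -> zr t d1 w2.
Proof. intros Hw H1 [d2 H2]. eexists. exact (div_exchange w1 w2 c d1 d2 Hw H1 H2). Qed.

(** Here [w = y] is allowed, so double zeros are covered, unlike in [div_exchange]. Summability and
    zero sum of the intermediate sequence come from [(t - w) e = d + (y - w) e]. *)
Lemma div_swap (w y : C) (c d e : nat -> C) : is_div t w c d -> is_div t y d e ->
  is_div t y c (fun n => (t n - w) * e n)%C /\ is_div t w (fun n => (t n - w) * e n)%C e.
Proof.
  intros [E1 [A1 S1]] [E2 [A2 S2]].
  assert (EE : forall n, ((t n - w) * e n)%C = (d n + (y - w) * e n)%C)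
    by (intros n; rewrite E2; ring).
  split; [|split; [reflexivity|split; assumption]].
  split; [|split].
  - intros n. rewrite E1, E2. ring.
  - apply (asum_ext (fun n => d n + (y - w) * e n)%C); [intros; now rewrite EE|].
    apply asum_plus; [exact A1|now apply asum_scal].
  - rewrite (csum_ext _ _ EE), csum_plus, csum_scal, S1, S2; [ring|exact A2|exact A1|now apply asum_scal].
Qed.

Lemma zr_of_div (w y : C) (c d : nat -> C) : is_div t w c d -> zr t d y -> zr t c y.
Proof. intros H [e He]. eexists. exact (proj1 (div_swap w y c d e H He)). Qed.

Lemma is_div_plus_scal (k w : C) (c1 c2 d1 d2 : nat -> C) :
  is_div t w c1 d1 -> is_div t w c2 d2 ->
  is_div t w (fun n => c1 n + k * c2 n)%C (fun n => d1 n + k * d2 n)%C.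
Proof.
  intros [E1 [A1 S1]] [E2 [A2 S2]]. split; [|split].
  - intros n. rewrite E1, E2. ring.
  - apply asum_plus; [exact A1|now apply asum_scal].
  - rewrite csum_plus, csum_scal, S1, S2; [ring|exact A2|exact A1|now apply asum_scal].
Qed.

Lemma zr_plus_scal (k w : C) (c1 c2 : nat -> C) :
  zr t c1 w -> zr t c2 w -> zr t (fun n => c1 n + k * c2 n)%C w.
Proof. intros [d1 H1] [d2 H2]. eexists. exact (is_div_plus_scal k w c1 c2 d1 d2 H1 H2). Qed.

(* The Cauchy transform multiplied by [z - t m], which removes its pole at [t m]. *)
Definition rct (m : nat) (c : nat -> C) (z : C) : C :=
  (c m + (z - t m) * ct t (zero_at m c) z)%C.

Lemma zero_at_off (m : nat) (c : nat -> C) (z : C) :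
  off_but m z -> forall n, zero_at m c n <> 0%C -> z <> t n.
Proof.
  intros Hz n Hn. apply Hz. intros ->. now rewrite zero_at_eq in Hn.
Qed.

Lemma rct_ct (m : nat) (c : nat -> C) (z : C) :
  adm t c -> off z -> rct m c z = ((z - t m) * ct t c z)%C.
Proof.
  intros Hc Hz. unfold rct, ct.
  rewrite (csum_split m (fun n => c n / (z - t n))%C) by now apply off_asum.
  rewrite (csum_ext (zero_at m (fun n => c n / (z - t n))%C) (fun n => zero_at m c n / (z - t n))%C).
  - field. apply Csub_neq, Hz.
  - intros n. unfold zero_at. destruct (Nat.eq_dec n m); [now rewrite Cdiv_0_l|reflexivity].
Qed.

Lemma rct_t (m : nat) (c : nat -> C) : rct m c (t m) = c m.
Proof. unfold rct. ring. Qed.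

Lemma rct_sdiff (m : nat) (c : nat -> C) (z : C) : adm t c -> off_but m z -> sdiff (rct m c) z.
Proof.
  intros Hc Hz. unfold rct. apply sdiff_plus; [apply sdiff_const|].
  apply sdiff_mult.
  - apply sdiff_minus; [apply sdiff_id|apply sdiff_const].
  - apply ct_sdiff; auto using adm_zero_at. now apply zero_at_off.
Qed.

Lemma off_cases (m : nat) (z : C) : off_but m z -> off z \/ z = t m.
Proof.
  intros H. destruct (classic (z = t m)) as [E|E]; [now right|left].
  intros n. destruct (Nat.eq_dec n m) as [->|Hn]; auto.
Qed.

Lemma rct_zero (m : nat) (c : nat -> C) (z : C) : adm t c -> off_but m z ->
  (zr t c z <-> rct m c z = 0%C).
Proof.
  intros Hc Hz. destruct (off_cases m z Hz) as [Ho| ->].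
  - rewrite rct_ct by assumption. split.
    + intros H. rewrite (zr_ct c z H Ho). ring.
    + intros H. apply zr_of_ct; auto. apply Cmult_integral in H. destruct H as [H|H]; [|exact H].
      exfalso. now apply (Csub_neq _ _ (Ho m)).
  - rewrite rct_t. split; [apply zr_t|now apply zr_of_t].
Qed.

Lemma rct_div (m : nat) (w : C) (c d : nat -> C) (z : C) : adm t c ->
  is_div t w c d -> off_but m z -> rct m c z = ((z - w) * rct m d z)%C.
Proof.
  intros Hc Hd Hz. destruct (off_cases m z Hz) as [Ho| ->].
  - rewrite !rct_ct by eauto using is_div_adm. rewrite (ct_div w c d z Hd Ho). ring.
  - rewrite !rct_t. destruct Hd as [E _]. apply E.
Qed.

Lemma rct_plus_scal (m : nat) (k : C) (c d : nat -> C) (z : C) : adm t c -> adm t d ->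
  off_but m z -> rct m (fun n => c n + k * d n)%C z = (rct m c z + k * rct m d z)%C.
Proof.
  intros Hc Hd Hz. destruct (off_cases m z Hz) as [Ho| ->].
  - rewrite !rct_ct, ct_plus_scal by auto using adm_plus_scal. ring.
  - now rewrite !rct_t.
Qed.

Lemma near_off_but (m : nat) (z : C) : off_but m z -> near z (off_but m).
Proof.
  intros Hz.
  destruct (uniformly_off t (zero_at m (fun _ => 1%C)) z t_ge_1 t_inf) as [k [Hk H]].
  { apply zero_at_off. exact Hz. }
  exists k. split; [exact Hk|]. intros a Ha n Hn ->.
  specialize (H n). rewrite zero_at_neq in H by exact Hn.
  specialize (H ltac:(intros E; apply RtoC_inj in E; lra)). specialize (t_ge_1 n).
  rewrite Cmod_sub_sym in H. nra.
Qed.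

Lemma near_off (z : C) : off z -> near z off.
Proof.
  intros Hz.
  destruct (near_and _ _ _ (near_off_but 0 z (off_off_but 0 z Hz))
    (near_ball z (Cmod (z - t 0)) (Cmod_sub_pos _ _ (Hz 0%nat)))) as [d [Hd H]].
  exists d. split; [exact Hd|]. intros a Ha n. destruct (H a Ha) as [H1 H2].
  destruct (Nat.eq_dec n 0) as [->|Hn]; [|now apply H1].
  intros ->. rewrite Cmod_sub_sym in H2. lra.
Qed.

(** [rct m c] takes the value [c m] at [t m], so by continuity [ct] does not vanish close to this
    pole. *)
Lemma nonzero_ct (c : nat -> C) (m : nat) : adm t c -> c m <> 0%C ->
  exists z, off z /\ ct t c z <> 0%C.
Proof.
  intros Hc Hm.
  pose proof (rct_sdiff m c (t m) Hc (t_off_but m)) as S. apply sdiff_cont in S.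
  rewrite <- (rct_t m c) in Hm.
  destruct (near_and _ _ _ (ccont_neq0 _ _ S Hm) (near_off_but m _ (t_off_but m))) as [d [Hd H]].
  set (z := (t m + RtoC (d / 2))%C).
  assert (E : (z - t m)%C = RtoC (d / 2)) by (unfold z; ring).
  assert (Hz : Cmod (z - t m) = d / 2) by (rewrite E, Cmod_R, Rabs_right; lra).
  destruct (H z) as [H1 H2]; [lra|].
  assert (Ho : off z).
  { destruct (off_cases m z H2) as [|E']; [assumption|]. rewrite E', Cmod_self in Hz. lra. }
  exists z. split; [exact Ho|]. intros E0. rewrite (rct_ct m c z Hc Ho), E0 in H1.
  replace ((z - t m) * 0)%C with (RtoC 0) in H1 by ring. rewrite Cmod_0 in H1.
  pose proof (Cmod_pos _ Hm). lra.
Qed.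

End Division.

(** * Finite sets *)

Lemma finite_sub {X : Type} (E F : X -> Prop) :
  (forall x, E x -> F x) -> finite_set F -> finite_set E.
Proof. intros H [l Hl]. exists l. auto. Qed.

Lemma finite_or {X : Type} (E F : X -> Prop) :
  finite_set E -> finite_set F -> finite_set (fun x => E x \/ F x).
Proof.
  intros [l Hl] [k Hk]. exists (l ++ k). intros x [H|H]; apply in_or_app; auto.
Qed.

Lemma finite_image {X Y : Type} (f : X -> Y) (E : X -> Prop) (F : Y -> Prop) :
  (forall y, F y -> exists x, E x /\ y = f x) -> finite_set E -> finite_set F.
Proof.
  intros H [l Hl]. exists (map f l). intros y Hy. destruct (H y Hy) as [x [Ex ->]].
  apply in_map, Hl, Ex.
Qed.

Lemma finite_inj_rel {X Y : Type} (T : X -> Y -> Prop) (E : X -> Prop) (F : Y -> Prop) :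
  (forall y, F y -> exists x, E x /\ T x y) -> (forall x y y', T x y -> T x y' -> y = y') ->
  finite_set E -> finite_set F.
Proof.
  intros H HT [l Hl].
  assert (G : forall l' : list X, exists k : list Y, forall x y, In x l' -> T x y -> In y k).
  { induction l' as [|x l' [k IH]].
    - exists nil. intros x y [].
    - destruct (classic (exists y, T x y)) as [[y Hy]|N].
      + exists (y :: k). intros x' y' [->|Hin] HT'; [left; eapply HT; eassumption|right; eauto].
      + exists k. intros x' y' [->|Hin] HT'; [exfalso; apply N; now exists y'|eauto]. }
  destruct (G l) as [k Hk]. exists k. intros y Fy. destruct (H y Fy) as [x [Ex Txy]]. eauto.
Qed.

Lemma infinite_list {X : Type} (E : X -> Prop) : ~ finite_set E ->
  forall N, exists l, NoDup l /\ length l = N /\ forall x, In x l -> E x.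
Proof.
  intros H. induction N as [|N [l [H1 [H2 H3]]]].
  - exists nil. repeat split; [constructor|]. intros x [].
  - destruct (classic (exists x, E x /\ ~ In x l)) as [[x [Ex Nx]]|Hn].
    + exists (x :: l). repeat split; [now constructor|simpl; congruence|].
      intros y [<-|Hy]; auto.
    + exfalso. apply H. exists l. intros x Ex. apply NNPP. intros Nx. apply Hn. now exists x.
Qed.

Lemma infinite_nat (E : nat -> Prop) : ~ finite_set E -> forall N, exists n, (N <= n)%nat /\ E n.
Proof.
  intros H N. apply NNPP. intros Hn. apply H. exists (seq 0 N). intros n En.
  apply in_seq. split; [lia|]. apply NNPP. intros Hlt. apply Hn. exists n. split; [lia|exact En].
Qed.

Lemma finite_nat_bound (E : nat -> Prop) : finite_set E -> exists N, forall n, E n -> (n < N)%nat.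
Proof.
  intros [l Hl]. exists (S (list_max l)). intros n En. apply Hl in En.
  pose proof (proj1 (list_max_le l (list_max l)) (Nat.le_refl _)) as H.
  rewrite Forall_forall in H. specialize (H n En). lia.
Qed.

Lemma finite_C_bound (E : C -> Prop) : finite_set E -> exists B, forall z, E z -> Cmod z < B.
Proof.
  intros [l Hl].
  assert (G : forall l' : list C, exists B, forall z, In z l' -> Cmod z < B).
  { induction l' as [|x l' [B IH]]; [exists 0; intros z []|].
    exists (Rmax B (Cmod x + 1)). intros z [<-|Hz].
    - pose proof (Rmax_r B (Cmod x + 1)). lra.
    - pose proof (Rmax_l B (Cmod x + 1)). specialize (IH z Hz). lra. }
  destruct (G l) as [B HB]. exists B. auto.
Qed.

Lemma avoid_list (l : list R) (a b : R) : a < b -> exists x, a < x < b /\ ~ In x l.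
Proof.
  intros Hab.
  assert (G : exists a' b', a <= a' /\ a' < b' /\ b' <= b /\ forall x, In x l -> a' < x < b' -> False).
  { induction l as [|y l [a' [b' [H1 [H2 [H3 H4]]]]]].
    - exists a, b. repeat split; try lra. intros x [].
    - destruct (Rle_lt_dec y ((a' + b') / 2)) as [Hy|Hy].
      + exists ((a' + b') / 2), b'. repeat split; try lra.
        intros x [<-|Hx] Hx2; [lra|]. apply (H4 x Hx). lra.
      + exists a', ((a' + b') / 2). repeat split; try lra.
        intros x [<-|Hx] Hx2; [lra|]. apply (H4 x Hx). lra. }
  destruct G as [a' [b' [H1 [H2 [H3 H4]]]]]. exists ((a' + b') / 2).
  split; [lra|]. intros Hin. apply (H4 _ Hin). lra.
Qed.

(** * Functions on circles, removable singularities *)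

Lemma cis_lip (x y : R) : Cmod (cis x - cis y) <= Rabs (x - y).
Proof.
  assert (G : forall x y, y < x -> Cmod (cis x - cis y) <= Rabs (x - y)).
  { clear. intros x y H. replace x with (y + (x - y)) at 1 by ring. rewrite cis_plus.
    replace (cis y * cis (x - y) - cis y)%C with (cis y * (cis (x - y) - 1))%C by ring.
    rewrite Cmod_mult, Cmod_cis, Rmult_1_l, Rabs_right by lra. apply Cmod_cis_1. lra. }
  destruct (Rtotal_order x y) as [H|[->|H]].
  - rewrite Cmod_sub_sym, Rabs_minus_sym. now apply G.
  - rewrite Cmod_self. apply Rabs_pos.
  - now apply G.
Qed.

Lemma circle_continuity (F : C -> C) (z0 : C) (R0 x : R) : 0 < R0 ->
  ccont F (z0 + RtoC R0 * cis x)%C ->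
  continuity_pt (fun y => Cmod (F (z0 + RtoC R0 * cis y)%C)) x.
Proof.
  intros HR HF eps He. destruct (HF eps He) as [d [Hd H]].
  exists (d / R0). split; [now apply Rdiv_lt_0_compat|]. intros y [_ Hy].
  simpl in *. unfold Rdist in *.
  assert (E : Cmod (F (z0 + RtoC R0 * cis y)%C - F (z0 + RtoC R0 * cis x)%C) < eps).
  { apply H. replace (z0 + RtoC R0 * cis y - (z0 + RtoC R0 * cis x))%C
      with (RtoC R0 * (cis y - cis x))%C by ring.
    rewrite Cmod_mult, Cmod_R, Rabs_right by lra.
    apply Rle_lt_trans with (R0 * Rabs (y - x)); [apply Rmult_le_compat_l; [lra|apply cis_lip]|].
    replace d with (R0 * (d / R0)) by (field; lra). now apply Rmult_lt_compat_l. }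
  apply Rabs_def1.
  - eapply Rle_lt_trans; [apply Cmod_sub_ge|exact E].
  - rewrite Cmod_sub_sym in E. pose proof (Cmod_sub_ge (F (z0 + RtoC R0 * cis x)%C) (F (z0 + RtoC R0 * cis y)%C)).
    lra.
Qed.

Lemma circle_bounded (F : C -> C) (z0 : C) (R0 : R) : 0 < R0 ->
  (forall x, ccont F (z0 + RtoC R0 * cis x)%C) ->
  exists M, 0 < M /\ forall x, 0 <= x <= 2 * PI -> Cmod (F (z0 + RtoC R0 * cis x)%C) <= M.
Proof.
  intros HR HF. pose proof PI_RGT_0.
  destruct (continuity_ab_maj (fun y => Cmod (F (z0 + RtoC R0 * cis y)%C)) 0 (2 * PI)) as [m [Hm _]];
    [lra|intros; now apply circle_continuity|].
  exists (Cmod (F (z0 + RtoC R0 * cis m)%C) + 1).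
  split; [pose proof (Cmod_ge_0 (F (z0 + RtoC R0 * cis m)%C)); lra|].
  intros x Hx. specialize (Hm x Hx). simpl in Hm. lra.
Qed.

Lemma circle_bounded_below (F : C -> C) (z0 : C) (R0 : R) : 0 < R0 ->
  (forall x, ccont F (z0 + RtoC R0 * cis x)%C /\ F (z0 + RtoC R0 * cis x)%C <> 0%C) ->
  exists m, 0 < m /\ forall x, 0 <= x <= 2 * PI -> m <= Cmod (F (z0 + RtoC R0 * cis x)%C).
Proof.
  intros HR HF. pose proof PI_RGT_0.
  destruct (continuity_ab_min (fun y => Cmod (F (z0 + RtoC R0 * cis y)%C)) 0 (2 * PI)) as [m [Hm _]];
    [lra|intros; apply circle_continuity; [lra|apply HF]|].
  exists (Cmod (F (z0 + RtoC R0 * cis m)%C)).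
  split; [apply Cmod_pos, HF|]. intros x Hx. apply (Hm x Hx).
Qed.

Lemma circle_dist (z0 : C) (R0 x : R) : 0 <= R0 -> Cmod (z0 + RtoC R0 * cis x - z0) = R0.
Proof.
  intros H. replace (z0 + RtoC R0 * cis x - z0)%C with (RtoC R0 * cis x)%C by ring.
  now apply Cmod_scal_cis.
Qed.

Lemma punctured_limit_unique (F G : C -> C) (z : C) (d : R) : 0 < d ->
  ccont F z -> ccont G z -> (forall a, 0 < Cmod (a - z) < d -> F a = G a) -> F z = G z.
Proof.
  intros Hd HF HG H. apply NNPP. intros HN.
  pose proof (Cmod_sub_pos _ _ HN) as Hp. set (e := Cmod (F z - G z)) in *.
  destruct (near_and _ _ _ (ccont_near _ _ (e / 2) HF ltac:(lra)) (ccont_near _ _ (e / 2) HG ltac:(lra)))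
    as [d1 [Hd1 K]].
  set (r := Rmin d d1 / 2).
  assert (Hr : 0 < r) by (unfold r; pose proof (Rmin_glb_lt d d1 0 Hd Hd1); lra).
  assert (r < d) by (unfold r in *; pose proof (Rmin_l d d1); lra).
  assert (r < d1) by (unfold r in *; pose proof (Rmin_r d d1); lra).
  set (a := (z + RtoC r)%C).
  assert (Ha : Cmod (a - z) = r).
  { unfold a. replace (z + RtoC r - z)%C with (RtoC r) by ring. rewrite Cmod_R, Rabs_right; lra. }
  destruct (K a ltac:(lra)) as [K1 K2]. rewrite (H a) in K1 by lra.
  pose proof (Cmod_sub_triangle (F z) (G a) (G z)) as T. fold e in T.
  rewrite (Cmod_sub_sym (F z)) in T. lra.
Qed.

(** The local extensions around [z] and around a nearby [a] agree with [E0] in punctured discs,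
    hence with each other at [a] by continuity. So the diagonal [G z z] is locally one of the
    extensions, whatever values [E0] has at the exceptional points. *)
Lemma removable_glue (E0 : C -> C) :
  (forall z, exists G, near z (sdiff G) /\
     exists d, 0 < d /\ forall a, 0 < Cmod (a - z) < d -> E0 a = G a) ->
  exists E, (forall z, sdiff E z) /\ (forall z, ccont E0 z -> E z = E0 z).
Proof.
  intros H. destruct (choice _ H) as [G HG]. exists (fun z => G z z).
  assert (L : forall z, near z (fun a => G z a = G a a)).
  { intros z. destruct (HG z) as [Sz [d [Hd Ez]]].
    destruct (near_and _ _ _ Sz (near_ball z d Hd)) as [e [He K]].
    exists e. split; [exact He|]. intros a Ha.
    destruct (classic (a = z)) as [->|Haz]; [reflexivity|].
    destruct (K a Ha) as [K1 K2]. destruct (HG a) as [Sa [d' [Hd' Ea]]].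
    pose proof (Cmod_sub_pos _ _ Haz) as Hp.
    set (r := Rmin d' (Rmin (Cmod (a - z)) (d - Cmod (a - z)))).
    apply (punctured_limit_unique _ _ a r).
    - unfold r. repeat apply Rmin_glb_lt; lra.
    - now apply sdiff_cont.
    - apply sdiff_cont, near_here, Sa.
    - intros b Hb.
      assert (r <= d') by apply Rmin_l.
      assert (r <= Cmod (a - z)) by (eapply Rle_trans; [apply Rmin_r|apply Rmin_l]).
      assert (r <= d - Cmod (a - z)) by (eapply Rle_trans; [apply Rmin_r|apply Rmin_r]).
      rewrite <- Ea by lra. symmetry. apply Ez.
      pose proof (Cmod_sub_triangle b a z). pose proof (Cmod_sub_triangle a b z) as T.
      rewrite (Cmod_sub_sym a b) in T. lra. }
  split.
  - intros z. apply (sdiff_ext (G z)); [apply L|]. apply near_here, HG.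
  - intros z Cz. destruct (HG z) as [Sz [d [Hd Ez]]].
    apply (punctured_limit_unique _ _ z d Hd); [|exact Cz|].
    + apply sdiff_cont. exact (near_here _ _ Sz).
    + intros a Ha. symmetry. now apply Ez.
Qed.

(** * Packing *)

Definition rsum (f : nat -> R) (l : list nat) : R := fold_right (fun n s => f n + s) 0 l.

Lemma rsum_filter (f : nat -> R) (p : nat -> bool) (l : list nat) :
  rsum f l = rsum f (filter p l) + rsum f (filter (fun n => negb (p n)) l).
Proof.
  induction l as [|n l IH]; [simpl; lra|]. simpl. rewrite IH. destruct (p n); simpl; lra.
Qed.

Lemma rsum_le (f : nat -> R) (B : R) (l : list nat) :
  (forall n, In n l -> f n <= B) -> rsum f l <= INR (length l) * B.
Proof.
  intros H. induction l as [|n l IH]; [simpl; lra|].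
  change (rsum f (n :: l)) with (f n + rsum f l).
  change (length (n :: l)) with (S (length l)). rewrite S_INR.
  assert (rsum f l <= INR (length l) * B) by (apply IH; intros; apply H; now right).
  assert (f n <= B) by (apply H; now left). lra.
Qed.

Lemma sum_n_rsum (f : nat -> R) (n : nat) : sum_n f n = rsum f (seq 0 (S n)).
Proof.
  assert (A : forall l m, rsum f (l ++ m :: nil) = rsum f l + f m).
  { induction l as [|k l IH]; intros m; simpl; [lra|]. unfold rsum in *. simpl. rewrite IH. lra. }
  induction n as [|n IH]; [rewrite sum_O; simpl; lra|].
  rewrite sum_Sn, IH. rewrite (seq_S (S n)), A. reflexivity.
Qed.

Lemma ex_series_bounded (a : nat -> R) (B : R) :
  (forall n, 0 <= a n) -> (forall n, sum_n a n <= B) -> ex_series a.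
Proof.
  intros Ha HB. destruct (ex_finite_lim_seq_incr (sum_n a) B) as [l Hl].
  - intros n. rewrite sum_Sn. unfold plus; simpl. specialize (Ha (S n)). lra.
  - exact HB.
  - exists l. exact Hl.
Qed.

(** Pigeonhole on a grid of mesh [INR X ^ -M]: points in one cell are closer than twice the mesh,
    while each separation radius is at least the mesh. *)
Lemma separated_count (t : nat -> C) (M : nat) (X : nat) (l : list nat) :
  (forall n, 1 <= Cmod (t n)) ->
  (forall n m, n <> m -> / Cmod (t n) ^ M + / Cmod (t m) ^ M <= Cmod (t n - t m)) ->
  NoDup l -> (forall n, In n l -> Cmod (t n) <= INR X) ->
  (length l <= 9 * X ^ (2 * M + 2))%nat.
Proof.
  intros H1 Hsep Hl HX.
  destruct l as [|n0 l0]; [simpl; lia|]. set (l := n0 :: l0) in *.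
  assert (HX1 : 1 <= INR X).
  { eapply Rle_trans; [apply (H1 n0)|apply HX; now left]. }
  set (Y := INR X ^ M). assert (HY : 1 <= Y) by (apply pow_R1_Rle; lra).
  (* The shift makes the cell numbers nonnegative. Each coordinate uses at most [2 B + 1 <= 3 B] of
     them, where [B = X ^ (M + 1)]; hence the constant 9. *)
  set (cell := fun u : R => Z.to_nat (Int_part (u * Y + INR X * Y))).
  set (B := (X ^ (M + 1))%nat).
  assert (EB : INR B = INR X * Y) by (unfold B, Y; rewrite pow_INR, pow_add; ring).
  assert (HB1 : (1 <= B)%nat) by (apply INR_le; rewrite EB; simpl; nra).
  assert (Hrange : forall u, Rabs u <= INR X ->
            0 <= u * Y + INR X * Y <= 2 * INR B).
  { intros u Hu. apply Rabs_le_between in Hu. rewrite EB. nra. }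
  assert (Hint : forall u, Rabs u <= INR X -> (0 <= Int_part (u * Y + INR X * Y))%Z).
  { intros u Hu. destruct (Hrange u Hu) as [K1 K2].
    destruct (base_Int_part (u * Y + INR X * Y)) as [I1 I2].
    assert (-1 < Int_part (u * Y + INR X * Y))%Z; [|lia]. apply lt_IZR. lra. }
  assert (Hcell : forall u, Rabs u <= INR X -> (cell u < 3 * B)%nat).
  { intros u Hu. destruct (Hrange u Hu) as [K1 K2].
    destruct (base_Int_part (u * Y + INR X * Y)) as [I1 I2]. specialize (Hint u Hu).
    unfold cell. assert (Int_part (u * Y + INR X * Y) <= Z.of_nat (2 * B))%Z; [|lia].
    apply le_IZR. rewrite <- INR_IZR_INZ, mult_INR. simpl INR. lra. }
  assert (Hinj : forall u v, Rabs u <= INR X -> Rabs v <= INR X -> cell u = cell v ->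
             Rabs (u - v) < / Y).
  { intros u v Hu Hv E. pose proof (Hint u Hu) as Iu. pose proof (Hint v Hv) as Iv.
    unfold cell in E. apply Z2Nat.inj in E; try assumption.
    destruct (base_Int_part (u * Y + INR X * Y)) as [U1 U2].
    destruct (base_Int_part (v * Y + INR X * Y)) as [V1 V2]. rewrite E in U1, U2.
    apply Rmult_lt_reg_r with Y; [lra|]. rewrite Rinv_l by lra.
    rewrite <- (Rabs_right Y) at 1 by lra. rewrite <- Rabs_mult. apply Rabs_def1; nra. }
  assert (Hcomp : forall n, In n l -> Rabs (fst (t n)) <= INR X /\ Rabs (snd (t n)) <= INR X).
  { intros n Hn. specialize (HX n Hn). split.
    - eapply Rle_trans; [apply (re_le_Cmod (t n))|exact HX].
    - eapply Rle_trans; [apply (im_le_Cmod (t n))|exact HX]. }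
  set (f := fun n => (cell (fst (t n)), cell (snd (t n)))).
  assert (Hnd : NoDup (map f l)).
  { apply Injective_map_NoDup_in; [|exact Hl]. intros n m Hn Hm E.
    destruct (Hcomp n Hn) as [A1 A2]. destruct (Hcomp m Hm) as [B1 B2].
    injection E as E1 E2. apply NNPP. intros Hnm. specialize (Hsep n m Hnm).
    pose proof (Hinj _ _ A1 B1 E1) as D1. pose proof (Hinj _ _ A2 B2 E2) as D2.
    assert (D3 : Cmod (t n - t m) <= Rabs (fst (t n) - fst (t m)) + Rabs (snd (t n) - snd (t m)))
      by apply Cmod_le_Re_Im.
    assert (S1 : forall k, In k l -> / Y <= / Cmod (t k) ^ M).
    { intros k Hk. apply Rinv_le_contravar; [apply pow_lt; specialize (H1 k); lra|].
      apply pow_incr. split; [apply Cmod_ge_0|apply HX, Hk]. }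
    pose proof (S1 n Hn). pose proof (S1 m Hm).
    lra. }
  assert (Hincl : incl (map f l) (list_prod (seq 0 (3 * B)) (seq 0 (3 * B)))).
  { intros p Hp. apply in_map_iff in Hp. destruct Hp as [n [<- Hn]].
    destruct (Hcomp n Hn) as [A1 A2]. apply in_prod; apply in_seq; split; try lia;
      now apply Hcell. }
  pose proof (NoDup_incl_length Hnd Hincl) as Q.
  rewrite length_map, length_prod, !length_seq in Q.
  replace (X ^ (2 * M + 2))%nat with (B * B)%nat; [lia|].
  unfold B. rewrite <- Nat.pow_add_r. f_equal. lia.
Qed.

Lemma separated_summable (t : nat -> C) (M : nat) :
  (forall n, 2 <= Cmod (t n)) ->
  (forall n m, n <> m -> / Cmod (t n) ^ M + / Cmod (t m) ^ M <= Cmod (t n - t m)) ->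
  ex_series (fun n => / Cmod (t n) ^ (2 * M + 4)).
Proof.
  intros H2 Hsep. set (K := (2 * M + 4)%nat).
  assert (H1 : forall n, 1 <= Cmod (t n)) by (intros n; specialize (H2 n); lra).
  set (f := fun n => / Cmod (t n) ^ K).
  (* The ring between two consecutive integer radii, [x] being the larger, has at most
     [9 x ^ (2 M + 2)] nodes, with terms at most [2 ^ K / x ^ K]. For [K = 2 M + 4] this adds up to
     [B / x ^ 2], which is below the telescoping difference [B (1 / (x - 1) - 1 / x)]. *)
  set (B := 9 * 2 ^ K).
  assert (HB : 0 < B) by (unfold B; pose proof (pow_lt 2 K ltac:(lra)); lra).
  assert (G : forall X l, NoDup l -> (forall n, In n l -> Cmod (t n) <= INR (S X)) ->
     rsum f l <= B * (1 - / INR (S X))).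
  { induction X as [|X IH]; intros l Hl HX.
    - destruct l as [|n l]; [simpl; lra|].
      specialize (HX n (or_introl eq_refl)). specialize (H2 n). simpl in HX. lra.
    - set (p := fun n => if Rle_lt_dec (Cmod (t n)) (INR (S X)) then true else false).
      rewrite (rsum_filter f p).
      assert (L1 : rsum f (filter p l) <= B * (1 - / INR (S X))).
      { apply IH; [now apply NoDup_filter|]. intros n Hn. apply filter_In in Hn.
        destruct Hn as [_ Hn]. unfold p in Hn. destruct (Rle_lt_dec (Cmod (t n)) (INR (S X))); [assumption|discriminate]. }
      set (l2 := filter (fun n => negb (p n)) l).
      pose proof (pos_INR X) as HX0. pose proof (S_INR X) as EX. pose proof (S_INR (S X)) as EX2.
      assert (L2 : rsum f l2 <= INR (length l2) * / INR (S X) ^ K).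
      { apply rsum_le. intros n Hn. apply filter_In in Hn. destruct Hn as [_ Hn].
        unfold p in Hn. destruct (Rle_lt_dec (Cmod (t n)) (INR (S X))); [discriminate|].
        apply Rinv_le_contravar; [apply pow_lt; lra|]. apply pow_incr. lra. }
      assert (L3 : INR (length l2) <= 9 * INR (S (S X)) ^ (2 * M + 2)).
      { replace (9 * INR (S (S X)) ^ (2 * M + 2)) with (INR (9 * S (S X) ^ (2 * M + 2))).
        - apply le_INR, (separated_count t M); auto; [now apply NoDup_filter|].
          intros n Hn. apply filter_In in Hn. apply HX, Hn.
        - rewrite mult_INR, pow_INR. f_equal. simpl. ring. }
      set (x := INR (S (S X))) in *.
      assert (L4 : / INR (S X) ^ K <= 2 ^ K * / x ^ K).
      { assert (Q1 : 0 < INR (S X) ^ K) by (apply pow_lt; lra).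
        assert (Q2 : 0 < x ^ K) by (apply pow_lt; lra).
        apply Rmult_le_reg_r with (INR (S X) ^ K * x ^ K); [apply Rmult_lt_0_compat; lra|].
        replace (/ INR (S X) ^ K * (INR (S X) ^ K * x ^ K)) with (x ^ K) by (field; lra).
        replace (2 ^ K * / x ^ K * (INR (S X) ^ K * x ^ K)) with (2 ^ K * INR (S X) ^ K) by (field; lra).
        rewrite <- Rpow_mult_distr. apply pow_incr. lra. }
      assert (P0 : 0 < x ^ K) by (apply pow_lt; lra).
      assert (L5 : INR (length l2) * / INR (S X) ^ K <= B * / (x * x)).
      { apply Rle_trans with ((9 * x ^ (2 * M + 2)) * (2 ^ K * / x ^ K)).
        - apply Rmult_le_compat; [apply pos_INR| |exact L3|exact L4].
          left. apply Rinv_0_lt_compat, pow_lt. lra.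
        - right. assert (E : x ^ K = x ^ (2 * M + 2) * (x * x)).
          { unfold K. replace (2 * M + 4)%nat with ((2 * M + 2) + 2)%nat by lia.
            rewrite pow_add. simpl (x ^ 2). ring. }
          rewrite E. unfold B. field. split; [lra|apply pow_nonzero; lra]. }
      assert (L6 : / (x * x) <= / INR (S X) - / x).
      { replace (/ INR (S X) - / x) with (/ (INR (S X) * x))
          by (rewrite EX2; field; split; lra).
        apply Rinv_le_contravar; [apply Rmult_lt_0_compat; lra|]. apply Rmult_le_compat_r; lra. }
      assert (B * / (x * x) <= B * (/ INR (S X) - / x)) by (apply Rmult_le_compat_l; lra).
      lra. }
  apply (ex_series_bounded _ B).
  - intros n. left. apply Rinv_0_lt_compat, pow_lt. specialize (H2 n). lra.
  - intros n. rewrite sum_n_rsum. fold f.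
    assert (HX : exists X, forall m, In m (seq 0 (S n)) -> Cmod (t m) <= INR (S X)).
    { generalize (seq 0 (S n)). induction l as [|k l [X IH]]; [exists 0%nat; intros m []|].
      destruct (INR_unbounded (Cmod (t k))) as [Y HY].
      exists (Nat.max X Y). intros m [<-|Hm].
      - rewrite S_INR. pose proof (le_INR Y (Nat.max X Y) ltac:(lia)). lra.
      - eapply Rle_trans; [apply IH, Hm|]. apply le_INR. lia. }
    destruct HX as [X HX]. eapply Rle_trans; [apply (G X); [apply seq_NoDup|exact HX]|].
    rewrite <- (Rmult_1_r B) at 2. apply Rmult_le_compat_l; [lra|].
    pose proof (Rinv_0_lt_compat (INR (S X)) ltac:(rewrite S_INR; pose proof (pos_INR X); lra)). lra.
Qed.

(** * Counting zeros *)

Section Counting.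

Variable t : nat -> C.
Hypothesis t_inj : forall n m, t n = t m -> n = m.
Hypothesis t_ge_1 : forall n, 1 <= Cmod (t n).
Hypothesis t_inf : to_infinity t.

Fixpoint node_poly (N : nat) (z : C) : C :=
  match N with O => 1%C | S n => (node_poly n z * (z - t n))%C end.

(** This is [node_poly N z] times the sum of [c n / (z - t n)] over [n < N], written as a polynomial
    so that it makes sense at the nodes. *)
Fixpoint head_poly (c : nat -> C) (N : nat) (z : C) : C :=
  match N with O => 0%C | S n => (head_poly c n z * (z - t n) + c n * node_poly n z)%C end.

Definition tail (N : nat) (c : nat -> C) (n : nat) : C :=
  if lt_dec n N then 0%C else c n.

(* The Cauchy transform times [node_poly N]: its first [N] poles are removed. *)
Definition depoled (c : nat -> C) (N : nat) (z : C) : C :=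
  (head_poly c N z + node_poly N z * ct t (tail N c) z)%C.

Lemma adm_tail (N : nat) (c : nat -> C) : adm t c -> adm t (tail N c).
Proof.
  apply ex_series_bound. intros n. specialize (t_ge_1 n).
  split; [apply Rdiv_le_0_compat; [apply Cmod_ge_0|lra]|].
  apply Rmult_le_compat_r; [left; apply Rinv_0_lt_compat; lra|].
  unfold tail. destruct (lt_dec n N); [rewrite Cmod_0; apply Cmod_ge_0|lra].
Qed.

Lemma depoled_ct (c : nat -> C) (N : nat) (z : C) : adm t c -> off t z ->
  depoled c N z = (node_poly N z * ct t c z)%C.
Proof.
  intros Hc Hz. induction N as [|N IH].
  - unfold depoled. simpl. replace (ct t (tail 0 c) z) with (ct t c z); [ring|].
    apply csum_ext. reflexivity.
  - rewrite <- (Cmult_1_r (ct t c z)).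
    transitivity (depoled c N z * (z - t N))%C; [|rewrite IH; simpl; ring].
    unfold depoled. simpl.
    assert (E : ((z - t N) * ct t (tail N c) z)%C = (c N + (z - t N) * ct t (tail (S N) c) z)%C).
    { rewrite <- (rct_ct t t_ge_1 t_inf N _ z (adm_tail N c Hc) Hz). unfold rct. f_equal.
      - unfold tail. destruct (lt_dec N N); [lia|reflexivity].
      - f_equal. apply csum_ext. intros n. f_equal. unfold zero_at, tail.
        destruct (Nat.eq_dec n N), (lt_dec n N), (lt_dec n (S N)); try lia; reflexivity. }
    replace (node_poly N z * (z - t N) * ct t (tail (S N) c) z)%C
      with (node_poly N z * ((z - t N) * ct t (tail (S N) c) z))%C by ring.
    replace ((z - t N) * ct t (tail (S N) c) z)%C
      with ((z - t N) * ct t (tail N c) z - c N)%C by (rewrite E; ring). ring.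
Qed.

Lemma node_poly_sdiff (N : nat) (z : C) : sdiff (node_poly N) z.
Proof.
  induction N as [|N IH]; [apply sdiff_const|]. apply (sdiff_mult _ (fun z => z - t N)%C); [exact IH|].
  apply sdiff_minus; [apply sdiff_id|apply sdiff_const].
Qed.

Lemma head_poly_sdiff (c : nat -> C) (N : nat) (z : C) : sdiff (head_poly c N) z.
Proof.
  induction N as [|N IH]; [apply sdiff_const|].
  apply (sdiff_plus (fun z => head_poly c N z * (z - t N))%C (fun z => c N * node_poly N z)%C).
  - apply (sdiff_mult _ (fun z => z - t N)%C); [exact IH|].
    apply sdiff_minus; [apply sdiff_id|apply sdiff_const].
  - apply (sdiff_mult (fun _ => c N)); [apply sdiff_const|apply node_poly_sdiff].
Qed.

Lemma depoled_sdiff (c : nat -> C) (N : nat) (z : C) : adm t c ->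
  (forall n, (N <= n)%nat -> z <> t n) -> sdiff (depoled c N) z.
Proof.
  intros Hc Hz. unfold depoled. apply sdiff_plus; [apply head_poly_sdiff|].
  apply sdiff_mult; [apply node_poly_sdiff|].
  apply ct_sdiff; auto using adm_tail. intros n Hn. apply Hz.
  unfold tail in Hn. destruct (lt_dec n N); [congruence|lia].
Qed.

Lemma node_poly_neq0 (N : nat) (z : C) : off t z -> node_poly N z <> 0%C.
Proof.
  intros Hz. induction N as [|N IH]; simpl.
  - intros E. apply RtoC_inj in E. lra.
  - apply Cmult_neq_0; [exact IH|apply Csub_neq, Hz].
Qed.

Fixpoint zero_poly (ws : list C) (z : C) : C :=
  match ws with nil => 1%C | w :: ws' => ((z - w) * zero_poly ws' z)%C end.

Lemma chain_adm (ws : list C) (c d : nat -> C) : adm t c -> chain t c ws d -> adm t d.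
Proof.
  revert c. induction ws as [|w ws IH]; intros c Hc Hd; [simpl in Hd; now subst|].
  destruct Hd as [c' [H1 H2]]. apply (IH c'); [|exact H2]. now apply (is_div_adm t t_ge_1 w c).
Qed.

Lemma chain_ct (ws : list C) (c d : nat -> C) (z : C) : chain t c ws d -> off t z ->
  ct t c z = (zero_poly ws z * ct t d z)%C.
Proof.
  intros H Hz. revert c H. induction ws as [|w ws IH]; intros c H.
  - simpl in *. subst. ring.
  - destruct H as [c' [H1 H2]]. rewrite (ct_div t t_ge_1 t_inf w c c' z H1 Hz), (IH c' H2).
    simpl. ring.
Qed.

Lemma zero_poly_ge (ws : list C) (z : C) (r : R) : 0 <= r ->
  (forall w, In w ws -> r <= Cmod (z - w)) -> r ^ length ws <= Cmod (zero_poly ws z).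
Proof.
  intros Hr H. induction ws as [|w ws IH]; simpl.
  - rewrite Cmod_1. lra.
  - rewrite Cmod_mult. apply Rmult_le_compat; [exact Hr|now apply pow_le|apply H; now left|].
    apply IH. intros; apply H; now right.
Qed.

Lemma zero_poly_le (ws : list C) (z : C) (r : R) :
  (forall w, In w ws -> Cmod (z - w) <= r) -> Cmod (zero_poly ws z) <= r ^ length ws.
Proof.
  intros H. induction ws as [|w ws IH]; simpl.
  - rewrite Cmod_1. lra.
  - rewrite Cmod_mult. apply Rmult_le_compat; try apply Cmod_ge_0; [apply H; now left|].
    apply IH. intros; apply H; now right.
Qed.

Lemma INR_le_pow2 (n : nat) : INR n <= 2 ^ n.
Proof.
  induction n as [|n IH]; [simpl; lra|]. rewrite S_INR. simpl.
  assert (1 <= 2 ^ n) by (apply pow_R1_Rle; lra). lra.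
Qed.

(* Jensen's inequality: each division by a zero in a disc halves the bound at
   the centre obtained from a circle of triple radius. *)
Lemma chain_length_bounded (c : nat -> C) (z0 : C) (X : R) : adm t c -> off t z0 ->
  ct t c z0 <> 0%C -> exists N, forall ws d, chain t c ws d ->
    (forall w, In w ws -> Cmod (z0 - w) <= X) -> (length ws <= N)%nat.
Proof.
  intros Hc Hz0 Hne.
  set (X' := Rmax X 1). assert (HX1 : 1 <= X') by apply Rmax_r.
  assert (HX2 : X <= X') by apply Rmax_l.
  destruct (t_inf (Cmod z0 + (3 * X' + 1) + 1)) as [N HN].
  (* The radius is chosen so that no node lies on the circle: the factorisation [Hfac] below is
     available only off the nodes. *)
  destruct (avoid_list (map (fun n => Cmod (t n - z0)) (seq 0 N)) (3 * X') (3 * X' + 1))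
    as [R0 [HR Hav]]; [lra|].
  assert (Hfar : forall n z, (N <= n)%nat -> Cmod (z - z0) <= R0 -> z <> t n).
  { intros n z Hn Hz ->. specialize (HN n Hn).
    pose proof (Cmod_sub_ge (t n) z0). lra. }
  assert (Hcirc : forall z, Cmod (z - z0) = R0 -> off t z).
  { intros z Hz n. destruct (le_lt_dec N n) as [Hn|Hn]; [apply Hfar; [exact Hn|lra]|].
    intros ->. apply Hav. rewrite <- Hz. apply (in_map (fun n => Cmod (t n - z0))).
    apply in_seq. lia. }
  destruct (circle_bounded (depoled c N) z0 R0) as [M [HM HMb]]; [lra| |].
  { intros x. apply sdiff_cont, depoled_sdiff; [exact Hc|]. intros n Hn. apply Hfar; [exact Hn|].
    rewrite circle_dist; lra. }
  set (g0 := Cmod (depoled c N z0)).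
  assert (Hg0 : 0 < g0).
  { apply Cmod_pos. rewrite depoled_ct by assumption.
    apply Cmult_neq_0; [now apply node_poly_neq0|exact Hne]. }
  destruct (INR_unbounded (M / g0)) as [J HJ]. exists J. intros ws d Hch Hws.
  pose proof (chain_adm ws c d Hc Hch) as Hd.
  assert (Hfac : forall z, off t z -> depoled c N z = (zero_poly ws z * depoled d N z)%C).
  { intros z Hz. rewrite !depoled_ct, (chain_ct ws c d z Hch Hz) by assumption. ring. }
  assert (Hb : Cmod (depoled d N z0) <= M / (2 * X') ^ length ws).
  { apply (center_bound (depoled d N) z0 R0); [lra| | |].
    - intros z Hz. apply depoled_sdiff; [exact Hd|]. intros n Hn. apply Hfar; [exact Hn|lra].
    - apply sdiff_cont, depoled_sdiff; [exact Hd|]. intros n Hn. apply Hfar; [exact Hn|].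
      rewrite Cmod_self. lra.
    - intros x Hx. set (z := (z0 + RtoC R0 * cis x)%C).
      assert (Hz : Cmod (z - z0) = R0) by (apply circle_dist; lra).
      specialize (HMb x Hx). fold z in HMb. rewrite (Hfac z (Hcirc z Hz)), Cmod_mult in HMb.
      assert (Hp : (2 * X') ^ length ws <= Cmod (zero_poly ws z)).
      { apply zero_poly_ge; [lra|]. intros w Hw. specialize (Hws w Hw).
        pose proof (Cmod_sub_triangle z w z0) as T. rewrite (Cmod_sub_sym w z0) in T. lra. }
      assert (Hp2 : 0 < (2 * X') ^ length ws) by (apply pow_lt; lra).
      apply Rmult_le_reg_l with ((2 * X') ^ length ws); [exact Hp2|].
      replace ((2 * X') ^ length ws * (M / (2 * X') ^ length ws)) with M by (field; lra).
      eapply Rle_trans; [|exact HMb]. apply Rmult_le_compat_r; [apply Cmod_ge_0|exact Hp]. }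
  assert (Hz : Cmod (zero_poly ws z0) <= X' ^ length ws).
  { apply zero_poly_le. intros w Hw. specialize (Hws w Hw). lra. }
  assert (HX' : 0 < X' ^ length ws) by (apply pow_lt; lra).
  assert (HQ : g0 <= M / 2 ^ length ws).
  { unfold g0. rewrite (Hfac z0 Hz0), Cmod_mult.
    replace (M / 2 ^ length ws) with (X' ^ length ws * (M / (2 * X') ^ length ws)).
    - apply Rmult_le_compat; try apply Cmod_ge_0; assumption.
    - rewrite Rpow_mult_distr. field. split; apply pow_nonzero; lra. }
  assert (H2 : 0 < 2 ^ length ws) by (apply pow_lt; lra).
  assert (HF : INR (length ws) <= M / g0).
  { eapply Rle_trans; [apply INR_le_pow2|].
    apply Rmult_le_reg_r with g0; [exact Hg0|].
    replace (M / g0 * g0) with M by (field; lra).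
    replace M with (2 ^ length ws * (M / 2 ^ length ws)) by (field; lra).
    apply Rmult_le_compat_l; lra. }
  apply INR_le. lra.
Qed.

Lemma chain_of_zeros (ws : list C) (c : nat -> C) : NoDup ws ->
  (forall w, In w ws -> zr t c w) -> exists d, chain t c ws d.
Proof.
  revert c. induction ws as [|w ws IH]; intros c Hnd H; [now exists c|].
  inversion Hnd as [|? ? Hn Hnd']; subst.
  destruct (H w (or_introl eq_refl)) as [c' Hc'].
  destruct (IH c' Hnd') as [d Hd].
  - intros y Hy. apply (zr_div t w y c c'); [|exact Hc'|apply H; now right].
    intros ->. contradiction.
  - exists d. exists c'. split; assumption.
Qed.

Lemma zeros_locally_finite (c : nat -> C) (m : nat) (X : R) : adm t c -> c m <> 0%C ->
  finite_set (fun w => zr t c w /\ Cmod w <= X).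
Proof.
  intros Hc Hm. destruct (nonzero_ct t t_inj t_ge_1 t_inf c m Hc Hm) as [z0 [Hz0 Hne]].
  destruct (chain_length_bounded c z0 (Cmod z0 + X) Hc Hz0 Hne) as [N HN].
  apply NNPP. intros Hinf. destruct (infinite_list _ Hinf (S N)) as [ws [H1 [H2 H3]]].
  destruct (chain_of_zeros ws c H1) as [d Hd]; [intros w Hw; apply H3, Hw|].
  assert (length ws <= N)%nat; [|lia]. apply (HN ws d Hd). intros w Hw.
  destruct (H3 w Hw) as [_ H4]. pose proof (Cmod_sub_le z0 w). lra.
Qed.

Lemma zeros_unbounded (c : nat -> C) (m : nat) (P : C -> Prop) (X : R) : adm t c -> c m <> 0%C ->
  (forall w, P w -> zr t c w) -> ~ finite_set P -> exists w, P w /\ X < Cmod w.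
Proof.
  intros Hc Hm HP Hinf. apply NNPP. intros HN. apply Hinf.
  apply (finite_sub _ (fun w => zr t c w /\ Cmod w <= X)); [|now apply (zeros_locally_finite c m)].
  intros w Pw. split; [now apply HP|]. apply Rnot_lt_le. intros Hlt. apply HN. now exists w.
Qed.

Lemma chain_zr (ws : list C) (c d : nat -> C) (w : C) : chain t c ws d -> zr t d w -> zr t c w.
Proof.
  revert c. induction ws as [|y ws IH]; intros c H Hw; [simpl in H; now subst|].
  destruct H as [c' [H1 H2]]. apply (zr_of_div t y w c c' H1). now apply IH.
Qed.

Lemma chain_app (ws vs : list C) (c d e : nat -> C) :
  chain t c ws d -> chain t d vs e -> chain t c (ws ++ vs) e.
Proof.
  revert c. induction ws as [|w ws IH]; intros c H1 H2; [simpl in *; now subst|].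
  destruct H1 as [c' [H3 H4]]. exists c'. split; [exact H3|now apply IH].
Qed.

(* A division chain of maximal length exhausts the zeros in a disc. *)
Lemma clear_disc (c : nat -> C) (m : nat) (X : R) : adm t c -> c m <> 0%C ->
  exists ws d, chain t c ws d /\ (forall w, In w ws -> Cmod w <= X) /\
    forall w, zr t d w -> X < Cmod w.
Proof.
  intros Hc Hm. destruct (nonzero_ct t t_inj t_ge_1 t_inf c m Hc Hm) as [z0 [Hz0 Hne]].
  destruct (chain_length_bounded c z0 (Cmod z0 + X) Hc Hz0 Hne) as [N HN].
  apply NNPP. intros Hno.
  assert (G : forall n, exists ws d, chain t c ws d /\ (forall w, In w ws -> Cmod w <= X) /\ length ws = n).
  { induction n as [|n [ws [d [H1 [H2 H3]]]]].
    - exists nil, c. repeat split. intros w [].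
    - destruct (classic (forall w, zr t d w -> X < Cmod w)) as [Hall|Hex].
      + exfalso. apply Hno. now exists ws, d.
      + apply not_all_ex_not in Hex. destruct Hex as [w Hw]. apply imply_to_and in Hw.
        destruct Hw as [[e He] Hw2]. exists (ws ++ w :: nil), e. split; [|split].
        * apply (chain_app _ _ _ d); [exact H1|]. exists e. split; [exact He|reflexivity].
        * intros y Hy. apply in_app_or in Hy. destruct Hy as [Hy|[<-|[]]]; [now apply H2|lra].
        * rewrite length_app. simpl. lia. }
  destruct (G (S N)) as [ws [d [H1 [H2 H3]]]].
  assert (length ws <= N)%nat; [|lia]. apply (HN ws d H1). intros w Hw.
  specialize (H2 w Hw). pose proof (Cmod_sub_le z0 w). lra.
Qed.

End Counting.

(** * Moving infinitely many zeros *)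

Lemma Series_geom2 (k : R) : ex_series (fun j => k * (1/2) ^ j) /\ Series (fun j => k * (1/2) ^ j) = 2 * k.
Proof.
  assert (G : is_series (fun j => (1/2) ^ j) (/ (1 - 1/2))).
  { apply is_series_geom. rewrite Rabs_right; lra. }
  split.
  - apply ex_series_Rscal. eexists; exact G.
  - rewrite Series_scal_l. replace (Series _) with (/ (1 - 1/2)).
    + field.
    + symmetry. apply is_series_unique. exact G.
Qed.

Lemma csum_incr (a : nat -> C) : asum a -> csum a = (a 0%nat + csum (fun k => a (S k)))%C.
Proof.
  intros H. unfold csum, Cplus; simpl. f_equal; apply Series_incr_1; [now apply asum_Re|now apply asum_Im].
Qed.

Lemma telescoping_limit (c : nat -> C) (e : R) :
  (forall i, Cmod (c (S i) - c i) <= e * (1/2) ^ i) ->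
  exists h, forall i, Cmod (h - c i) <= 2 * (e * (1/2) ^ i).
Proof.
  intros H.
  assert (A : forall i, asum (fun j => c (S (i + j)) - c (i + j)%nat)%C).
  { intros i. apply (asum_bound _ (fun j => (e * (1/2) ^ i) * (1/2) ^ j)).
    - intros j. eapply Rle_trans; [apply H|]. rewrite pow_add. lra.
    - apply Series_geom2. }
  exists (c 0%nat + csum (fun j => c (S j) - c j))%C. intros i.
  assert (E : (c 0%nat + csum (fun j => c (S j) - c j))%C
    = (c i + csum (fun j => c (S (i + j)) - c (i + j)%nat))%C).
  { induction i as [|i IH]; [reflexivity|]. rewrite IH, (csum_incr _ (A i)), Nat.add_0_r.
    rewrite (csum_ext (fun k => c (S (i + S k)) - c (i + S k)%nat)%C
      (fun j => c (S (S i + j)) - c (S i + j)%nat)%C).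
    - ring.
    - intros k. now replace (i + S k)%nat with (S i + k)%nat by lia. }
  rewrite E. replace (c i + csum (fun j => c (S (i + j)) - c (i + j)%nat) - c i)%C
    with (csum (fun j => c (S (i + j)) - c (i + j)%nat)%C) by ring.
  destruct (Series_geom2 (e * (1/2) ^ i)) as [G1 G2]. rewrite <- G2.
  apply csum_bound; [|exact G1]. intros j. eapply Rle_trans; [apply H|]. rewrite pow_add. lra.
Qed.

Section Moving.

Variables (t : nat -> C) (s : nat -> R) (regular : nat -> Prop).
Hypothesis t_inj : forall n m, t n = t m -> n = m.
Hypothesis t_ge_1 : forall n, 1 <= Cmod (t n).
Hypothesis t_inf : to_infinity t.
Hypothesis s_pos : forall n, 0 < s n.

Variable J0 : nat.
Hypothesis s_sum : ex_series (fun n => s n / Cmod (t n) ^ (J0 + 1)).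

(** With the weight [s] of the space, [decay 0] is necessary for membership and [decay J0], for a
    suitable [J0], is sufficient given the support condition. *)
Definition decay (J : nat) (c : nat -> C) : Prop :=
  exists K, forall n, Cmod (c n) * Cmod (t n) ^ J <= K * s n.

Definition supported (c : nat -> C) : Prop := forall n, c n <> 0%C -> regular n.

Lemma t_pow_pos (n J : nat) : 0 < Cmod (t n) ^ J.
Proof. apply pow_lt. pose proof (t_ge_1 n). lra. Qed.

Lemma decay_except (J m : nat) (K : R) (c : nat -> C) :
  (forall n, n <> m -> Cmod (c n) * Cmod (t n) ^ J <= K * s n) -> decay J c.
Proof.
  intros H. exists (Rmax K (Cmod (c m) * Cmod (t m) ^ J / s m)). intros n.
  pose proof (s_pos n) as Hs. destruct (Nat.eq_dec n m) as [->|Hn].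
  - replace (Cmod (c m) * Cmod (t m) ^ J) with (Cmod (c m) * Cmod (t m) ^ J / s m * s m) at 1
      by (field; lra).
    apply Rmult_le_compat_r; [lra|apply Rmax_r].
  - eapply Rle_trans; [now apply H|]. apply Rmult_le_compat_r; [lra|apply Rmax_l].
Qed.

Lemma decay_nonneg (J : nat) (c : nat -> C) : decay J c ->
  exists K, 0 < K /\ forall n, Cmod (c n) * Cmod (t n) ^ J <= K * s n.
Proof.
  intros [K H]. exists (Rmax K 1). split; [pose proof (Rmax_r K 1); lra|].
  intros n. eapply Rle_trans; [apply H|]. apply Rmult_le_compat_r; [left; apply s_pos|apply Rmax_l].
Qed.

Lemma decay_adm (c : nat -> C) : decay J0 c -> adm t c.
Proof.
  intros H. destruct (decay_nonneg J0 c H) as [K [HK Hc]].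
  apply (ex_series_bound _ (fun n => K * (s n / Cmod (t n) ^ (J0 + 1)))); [|now apply ex_series_Rscal].
  intros n. pose proof (t_ge_1 n). specialize (Hc n). pose proof (t_pow_pos n J0) as Hp.
  split; [apply Rdiv_le_0_compat; [apply Cmod_ge_0|lra]|].
  rewrite pow_add. simpl (Cmod (t n) ^ 1). rewrite Rmult_1_r.
  apply Rmult_le_reg_r with (Cmod (t n) ^ J0 * Cmod (t n)); [apply Rmult_lt_0_compat; lra|].
  replace (Cmod (c n) / Cmod (t n) * (Cmod (t n) ^ J0 * Cmod (t n)))
    with (Cmod (c n) * Cmod (t n) ^ J0) by (field; lra).
  replace (K * (s n / (Cmod (t n) ^ J0 * Cmod (t n))) * (Cmod (t n) ^ J0 * Cmod (t n)))
    with (K * s n) by (field; lra). exact Hc.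
Qed.

Lemma div_common (w1 w2 : C) (c d1 d2 : nat -> C) : w1 <> w2 ->
  is_div t w1 c d1 -> is_div t w2 c d2 -> exists e, is_div t w2 d1 e /\ is_div t w1 d2 e.
Proof.
  intros Hw H1 H2. pose proof (div_exchange t w1 w2 c d1 d2 Hw H1 H2) as H3.
  eexists. split; [exact H3|]. destruct H3 as [_ [A S]]. split; [|split; assumption].
  intros n. apply Csub_neq in Hw. destruct H1 as [E1 _]. destruct H2 as [E2 _].
  specialize (E1 n). specialize (E2 n).
  replace ((t n - w1) * (/ (w1 - w2) * (d1 n - d2 n)))%C
    with (/ (w1 - w2) * ((t n - w1) * d1 n - (t n - w1) * d2 n))%C by ring.
  rewrite <- E1, E2. field. exact Hw.
Qed.

Variables (w x : nat -> C) (idx : nat -> nat) (Y : nat -> C -> Prop) (B : R) (L : nat).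
Hypothesis w_inf : to_infinity w.
Hypothesis idx_inf : to_infinity (fun k => t (idx k)).
Hypothesis w_x : forall k, Cmod (w k - x k) <= B.
Hypothesis Y_w : forall k y, Y k y -> Cmod (y - w k) <= B.
Hypothesis w_sep : forall k m, m <> idx k -> / Cmod (t m) ^ L <= Cmod (w k - t m).
Hypothesis w_reg : forall k, w k = t (idx k) -> regular (idx k) \/ Y k (t (idx k)).

(** For [n] other than [idx k], [w_sep] bounds [d n] by [c n] up to a power of [|t n|]. At [idx k]
    the difference [t n - w k] may be tiny or zero, so a bound there has to be required; it concerns
    the product with [w k - x k], which is all that a move uses. Only [k >= k0] matter, since each
    operation consumes a zero and may discard finitely many others. *)
Definition movable (J k0 : nat) (c : nat -> C) : Prop :=
  decay J c /\ adm t c /\ supported c /\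
  exists K, forall k, (k0 <= k)%nat -> exists d, is_div t (w k) c d /\
    Cmod (w k - x k) * Cmod (d (idx k)) * Cmod (t (idx k)) ^ J
      <= K * s (idx k) * Cmod (t (idx k)) ^ L /\
    forall y, Y k y -> zr t d y.

Lemma B_nonneg : 0 <= B.
Proof. eapply Rle_trans; [apply (Cmod_ge_0 (w 0%nat - x 0%nat))|apply w_x]. Qed.

Lemma w_neq_t (k m : nat) : m <> idx k -> w k <> t m.
Proof.
  intros Hm E. pose proof (w_sep k m Hm) as Q. rewrite E, Cmod_self in Q.
  pose proof (Rinv_0_lt_compat _ (t_pow_pos m L)). lra.
Qed.

Lemma eventually_far (p : C) (k0 : nat) : exists k1, (k0 <= k1)%nat /\
  forall k, (k1 <= k)%nat -> w k <> p /\ (forall y, Y k y -> y <> p) /\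
    Cmod (t (idx k)) / 2 <= Cmod (t (idx k) - p) /\ 1 <= Cmod (t (idx k) - p).
Proof.
  destruct (w_inf (Cmod p + B + 1)) as [k1 H1].
  destruct (idx_inf (2 * Cmod p + 2)) as [k2 H2].
  exists (k0 + k1 + k2)%nat. split; [lia|]. intros k Hk.
  specialize (H1 k ltac:(lia)). specialize (H2 k ltac:(lia)). pose proof B_nonneg as HB.
  pose proof (Cmod_ge_0 p).
  split; [|split; [|split]].
  - intros E. rewrite E in H1. lra.
  - intros y Hy ->. pose proof (Y_w k p Hy). pose proof (Cmod_sub_ge (w k) p) as Q.
    rewrite Cmod_sub_sym in Q. lra.
  - pose proof (Cmod_sub_ge (t (idx k)) p). lra.
  - pose proof (Cmod_sub_ge (t (idx k)) p). lra.
Qed.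

(** Division can create a new nonzero coefficient only at a node equal to [w k]. There [w_reg] gives
    regularity, or a further zero in [Y k] at that node, which forces the coefficient to vanish. *)
Lemma supported_div (k : nat) (c d : nat -> C) : is_div t (w k) c d ->
  (forall y, Y k y -> zr t d y) -> supported c -> supported d.
Proof.
  intros Hd HY Hc n Hn. destruct (classic (t n = w k)) as [E|E].
  - destruct (Nat.eq_dec n (idx k)) as [->|Hni].
    + destruct (w_reg k (eq_sym E)) as [H|H]; [exact H|].
      exfalso. apply Hn, (zr_t t), HY, H.
    + exfalso. now apply (w_neq_t k n).
  - apply Hc. destruct Hd as [Ed _]. rewrite Ed. apply Cmult_neq_0; [now apply Csub_neq|exact Hn].
Qed.

(** Away from [idx k] the divisor [t n - w k] is at least a multiple of [|t n|], which gains one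
    power; the single index [idx k] goes into the constant. *)
Lemma div_decay (J k : nat) (c d : nat -> C) : is_div t (w k) c d -> decay J c -> decay (J + 1) d.
Proof.
  intros [Ed _] Hc. destruct (decay_nonneg J c Hc) as [K [HK Hc']].
  destruct (uniformly_off t (zero_at (idx k) (fun _ => 1%C)) (w k) t_ge_1 t_inf) as [q [Hq Hoff]].
  { intros n Hn. apply w_neq_t. intros ->. now rewrite zero_at_eq in Hn. }
  apply (decay_except _ (idx k) (/ q * K)). intros n Hn.
  specialize (Hoff n). rewrite zero_at_neq in Hoff by exact Hn.
  specialize (Hoff ltac:(intros E; apply RtoC_inj in E; lra)).
  specialize (Hc' n). rewrite Ed, Cmod_mult, Cmod_sub_sym in Hc'.
  rewrite pow_add. simpl (Cmod (t n) ^ 1). rewrite Rmult_1_r.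
  apply Rmult_le_reg_l with q; [exact Hq|].
  replace (q * (/ q * K * s n)) with (K * s n) by (field; lra).
  eapply Rle_trans; [|exact Hc'].
  replace (q * (Cmod (d n) * (Cmod (t n) ^ J * Cmod (t n))))
    with ((q * Cmod (t n)) * (Cmod (d n) * Cmod (t n) ^ J)) by ring.
  rewrite (Rmult_assoc (Cmod (w k - t n))). apply Rmult_le_compat_r; [|exact Hoff].
  apply Rmult_le_pos; [apply Cmod_ge_0|left; apply t_pow_pos].
Qed.

(** For far [k], division by [t (idx k) - w k0] lowers the quotient at [idx k] by a factor of at
    least [|t (idx k)| / 2], which pays for the additional power in [J + 1]. *)
Lemma divide_step (J k0 m : nat) (c : nat -> C) : movable J k0 c -> c m <> 0%C ->
  exists k1 c', movable (J + 1) k1 c' /\ c' m <> 0%C.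
Proof.
  intros [Dc [Ac [Sc [K HK]]]] Hm.
  destruct (HK k0 (Nat.le_refl _)) as [d [Hd [_ HdY]]].
  destruct (eventually_far (w k0) (S k0)) as [k1 [Hk1 Hfar]].
  exists k1, d. split.
  2:{ intros E. apply Hm. destruct Hd as [Ed _]. rewrite Ed, E. ring. }
  split; [now apply (div_decay J k0 c)|]. split; [now apply (is_div_adm t t_ge_1 (w k0) c)|].
  split; [now apply (supported_div k0 c)|].
  exists (2 * Rmax K 0). intros k Hk. destruct (Hfar k Hk) as [F1 [F2 [F3 F4]]].
  destruct (HK k ltac:(lia)) as [dk [Hdk [Hdb HdkY]]].
  destruct (div_common (w k0) (w k) c d dk) as [e [He1 He2]]; [congruence|exact Hd|exact Hdk|].
  exists e. split; [exact He1|split].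
  - set (n := idx k) in *. destruct He2 as [Ee _]. rewrite Ee, Cmod_mult in Hdb.
    rewrite pow_add. simpl (Cmod (t n) ^ 1). rewrite Rmult_1_r.
    set (a := Cmod (w k - x k)) in *. assert (Ha : 0 <= a) by apply Cmod_ge_0.
    pose proof (Cmod_ge_0 (e n)). pose proof (t_pow_pos n J). pose proof (t_pow_pos n L).
    assert (G : a * (Cmod (t n) / 2 * Cmod (e n)) * Cmod (t n) ^ J
              <= K * s n * Cmod (t n) ^ L).
    { eapply Rle_trans; [|exact Hdb]. apply Rmult_le_compat_r; [lra|].
      apply Rmult_le_compat_l; [exact Ha|]. apply Rmult_le_compat_r; lra. }
    assert (G2 : K * s n * Cmod (t n) ^ L <= Rmax K 0 * s n * Cmod (t n) ^ L).
    { apply Rmult_le_compat_r; [lra|]. apply Rmult_le_compat_r; [left; apply s_pos|apply Rmax_l]. }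
    lra.
  - intros y Hy. apply (zr_div t (w k0) y dk e); [apply not_eq_sym, F2, Hy|exact He2|now apply HdkY].
Qed.

Lemma divide_steps (J k0 m : nat) (c : nat -> C) : movable 0 k0 c -> c m <> 0%C ->
  exists k1 c', movable J k1 c' /\ c' m <> 0%C.
Proof.
  intros Hc Hm. induction J as [|J [k1 [c' [H1 H2]]]]; [now exists k0, c|].
  rewrite <- Nat.add_1_r. exact (divide_step J k1 m c' H1 H2).
Qed.

(** Of the [J0 + L + 1] powers of decay, [L] are lost to nodes close to [w k], one buys the small
    factor [eps], and [J0] remain in the bound on the change. *)
Lemma move_step (k0 : nat) (c : nat -> C) (eps X : R) :
  movable (J0 + L + 1) k0 c -> 0 < eps ->
  exists k k1 c', X < Cmod (w k) /\ movable (J0 + L + 1) k1 c' /\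
    (forall n, Cmod (c' n - c n) * Cmod (t n) ^ J0 <= eps * s n) /\
    zr t c' (x k) /\ (forall y, Y k y -> zr t c' y) /\
    (forall z, zr t c z -> z <> w k -> zr t c' z).
Proof.
  intros [Dc [Ac [Sc [K HK]]]] He. set (J := (J0 + L + 1)%nat) in *.
  destruct (decay_nonneg J c Dc) as [K1 [HK1 Hc]].
  pose proof B_nonneg as HB.
  (* A large [|w k|] makes the change small at the indices other than [idx k]; a large
     [|t (idx k)|], chosen next, makes it small at [idx k]. *)
  destruct (w_inf (Rmax (X + 1) (Rmax 1 (2 * B * K1 / eps)))) as [ka Hka].
  destruct (idx_inf (Rmax K 0 / eps + 1)) as [kb Hkb].
  set (k := (k0 + ka + kb)%nat).
  specialize (Hka k ltac:(lia)). specialize (Hkb k ltac:(lia)). simpl in Hkb.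
  destruct (HK k ltac:(lia)) as [d [Hd [Hdb HdY]]].
  pose proof (Rmax_l (X + 1) (Rmax 1 (2 * B * K1 / eps))).
  pose proof (Rmax_r (X + 1) (Rmax 1 (2 * B * K1 / eps))).
  pose proof (Rmax_l 1 (2 * B * K1 / eps)). pose proof (Rmax_r 1 (2 * B * K1 / eps)).
  assert (Hw1 : 1 <= Cmod (w k)) by lra.
  assert (Hw2 : 2 * B * K1 / eps <= Cmod (w k)) by lra.
  destruct (eventually_far (w k) (S k)) as [k1 [Hk1 Hfar]].
  exists k, k1, (fun n => c n + (w k - x k) * d n)%C.
  destruct Hd as [Ed [Ad Sd]].
  assert (Hd : is_div t (w k) c d) by (split; [exact Ed|split; assumption]).
  assert (Aadm : adm t d) by (now apply (is_div_adm t t_ge_1 (w k) c)).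
  assert (Dd : decay J d).
  { destruct (div_decay J k c d Hd Dc) as [K2 HK2]. exists K2. intros n.
    eapply Rle_trans; [|apply (HK2 n)]. apply Rmult_le_compat_l; [apply Cmod_ge_0|].
    rewrite pow_add. rewrite <- (Rmult_1_r (Cmod (t n) ^ J)) at 1.
    apply Rmult_le_compat_l; [left; apply t_pow_pos|]. simpl. pose proof (t_ge_1 n). lra. }
  split; [lra|split; [|split; [|split; [|split]]]].
  - split; [|split; [|split]].
    + destruct (decay_nonneg J d Dd) as [K2 [HK2 Hd2]]. exists (K1 + B * K2). intros n.
      specialize (Hc n). specialize (Hd2 n). pose proof (t_pow_pos n J) as Hp.
      apply Rle_trans with ((Cmod (c n) + B * Cmod (d n)) * Cmod (t n) ^ J).
      * apply Rmult_le_compat_r; [lra|]. eapply Rle_trans; [apply Cmod_triangle|].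
        rewrite Cmod_mult. apply Rplus_le_compat_l, Rmult_le_compat_r; [apply Cmod_ge_0|apply w_x].
      * assert (B * (Cmod (d n) * Cmod (t n) ^ J) <= B * (K2 * s n)) by (apply Rmult_le_compat_l; assumption).
        lra.
    + now apply adm_plus_scal.
    + intros n Hn. destruct (classic (c n = 0%C)) as [E|E]; [|now apply Sc].
      apply (supported_div k c d Hd HdY Sc). intros E2. apply Hn. rewrite E, E2. ring.
    + exists ((1 + B) * Rmax K 0). intros k' Hk'. destruct (Hfar k' Hk') as [F1 [F2 [F3 F4]]].
      destruct (HK k' ltac:(lia)) as [dk [Hdk [Hdkb HdkY]]].
      destruct (div_common (w k) (w k') c d dk) as [e [He1 He2]]; [congruence|exact Hd|exact Hdk|].
      exists (fun n => dk n + (w k - x k) * e n)%C. split; [now apply is_div_plus_scal|split].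
      * set (n := idx k') in *. destruct He2 as [Ee _].
        assert (Q : Cmod (e n) <= Cmod (dk n)).
        { rewrite Ee, Cmod_mult. rewrite <- (Rmult_1_l (Cmod (e n))) at 1.
          apply Rmult_le_compat_r; [apply Cmod_ge_0|exact F4]. }
        assert (Q2 : Cmod (dk n + (w k - x k) * e n) <= (1 + B) * Cmod (dk n)).
        { eapply Rle_trans; [apply Cmod_triangle|]. rewrite Cmod_mult.
          assert (Cmod (w k - x k) * Cmod (e n) <= B * Cmod (dk n))
            by (apply Rmult_le_compat; try apply Cmod_ge_0; [apply w_x|exact Q]). lra. }
        pose proof (t_pow_pos n J). pose proof (t_pow_pos n L).
        assert (G2 : K * s n * Cmod (t n) ^ L <= Rmax K 0 * s n * Cmod (t n) ^ L).
        { apply Rmult_le_compat_r; [lra|]. apply Rmult_le_compat_r; [left; apply s_pos|apply Rmax_l]. }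
        apply Rle_trans with (Cmod (w k' - x k') * ((1 + B) * Cmod (dk n)) * Cmod (t n) ^ J).
        { apply Rmult_le_compat_r; [lra|]. apply Rmult_le_compat_l; [apply Cmod_ge_0|exact Q2]. }
        replace (Cmod (w k' - x k') * ((1 + B) * Cmod (dk n)) * Cmod (t n) ^ J)
          with ((1 + B) * (Cmod (w k' - x k') * Cmod (dk n) * Cmod (t n) ^ J)) by ring.
        rewrite !(Rmult_assoc (1 + B)). apply Rmult_le_compat_l; lra.
      * intros y Hy. apply zr_plus_scal; [now apply HdkY|].
        apply (zr_div t (w k) y dk e); [apply not_eq_sym, F2, Hy|exact He2|now apply HdkY].
  - intros n. replace (c n + (w k - x k) * d n - c n)%C with ((w k - x k) * d n)%C by ring.
    rewrite Cmod_mult. pose proof (s_pos n) as Hsn. pose proof (t_pow_pos n J0) as Hp0.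
    pose proof (t_ge_1 n) as Ht1.
    destruct (Nat.eq_dec n (idx k)) as [->|Hn].
    (* Here the bound required by [movable] applies: once [J0 + L] powers are spent, a factor
       [|t n|] is left, and it exceeds [K / eps]. *)
    + set (n := idx k) in *. pose proof (t_pow_pos n L) as HpL.
      unfold J in Hdb. rewrite !pow_add in Hdb. simpl (Cmod (t n) ^ 1) in Hdb. rewrite Rmult_1_r in Hdb.
      assert (Q : Cmod (w k - x k) * Cmod (d n) * Cmod (t n) ^ J0 * Cmod (t n) <= K * s n).
      { apply Rmult_le_reg_r with (Cmod (t n) ^ L); [exact HpL|]. lra. }
      assert (Q2 : K * s n <= eps * s n * Cmod (t n)).
      { apply Rle_trans with (Rmax K 0 * s n); [apply Rmult_le_compat_r; [lra|apply Rmax_l]|].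
        replace (Rmax K 0 * s n) with (Rmax K 0 / eps * (eps * s n)) by (field; lra).
        rewrite (Rmult_comm (eps * s n)). apply Rmult_le_compat_r; [|lra].
        apply Rmult_le_pos; lra. }
      apply Rmult_le_reg_r with (Cmod (t n)); lra.
    (* If [|t n| <= |w k| / 2], then [|w k - t n| >= |w k| / 2]. Otherwise [w_sep] costs
       [|t n| ^ L], and one more factor [|t n| > |w k| / 2] supplies [2 / |w k|]. *)
    + assert (Q : Cmod (d n) <= 2 / Cmod (w k) * (Cmod (c n) * Cmod (t n) ^ (L + 1))).
      { rewrite Ed, Cmod_mult, Cmod_sub_sym. pose proof (Cmod_ge_0 (d n)) as Hd0.
        pose proof (t_pow_pos n L) as HpL.
        rewrite pow_add. simpl (Cmod (t n) ^ 1). rewrite Rmult_1_r.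
        assert (HL1 : 1 <= Cmod (t n) ^ L) by (apply pow_R1_Rle; exact Ht1).
        apply Rmult_le_reg_l with (Cmod (w k)); [lra|].
        replace (Cmod (w k) * (2 / Cmod (w k) * (Cmod (w k - t n) * Cmod (d n) * (Cmod (t n) ^ L * Cmod (t n)))))
          with ((2 * Cmod (w k - t n) * (Cmod (t n) ^ L * Cmod (t n))) * Cmod (d n)) by (field; lra).
        apply Rmult_le_compat_r; [exact Hd0|].
        destruct (Rle_lt_dec (Cmod (t n)) (Cmod (w k) / 2)) as [Hle|Hlt].
        - pose proof (Cmod_sub_ge (w k) (t n)) as T.
          assert (1 <= Cmod (t n) ^ L * Cmod (t n)) by nra. nra.
        - pose proof (w_sep k n Hn) as T.
          assert (T2 : 1 <= Cmod (w k - t n) * Cmod (t n) ^ L).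
          { rewrite <- (Rinv_l (Cmod (t n) ^ L)) by lra. apply Rmult_le_compat_r; lra. }
          nra. }
      specialize (Hc n).
      assert (EJ : Cmod (t n) ^ J = Cmod (t n) ^ (L + 1) * Cmod (t n) ^ J0).
      { rewrite <- pow_add. f_equal. unfold J. lia. }
      rewrite EJ in Hc.
      apply Rle_trans with (B * (2 / Cmod (w k) * (Cmod (c n) * Cmod (t n) ^ (L + 1))) * Cmod (t n) ^ J0).
      { apply Rmult_le_compat_r; [lra|]. apply Rmult_le_compat; try apply Cmod_ge_0; [apply w_x|exact Q]. }
      replace (B * (2 / Cmod (w k) * (Cmod (c n) * Cmod (t n) ^ (L + 1))) * Cmod (t n) ^ J0)
        with (2 * B / Cmod (w k) * (Cmod (c n) * (Cmod (t n) ^ (L + 1) * Cmod (t n) ^ J0))) by (field; lra).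
      apply Rle_trans with (2 * B / Cmod (w k) * (K1 * s n)).
      { apply Rmult_le_compat_l; [|exact Hc]. apply Rdiv_le_0_compat; lra. }
      apply Rmult_le_reg_l with (Cmod (w k)); [lra|].
      replace (Cmod (w k) * (2 * B / Cmod (w k) * (K1 * s n)))
        with ((2 * B * K1 / eps) * (eps * s n)) by (field; lra).
      apply Rmult_le_compat_r; [apply Rmult_le_pos; lra|exact Hw2].
  - exists d. split; [|split; assumption]. intros n. rewrite Ed. ring.
  - intros y Hy. apply zr_plus_scal; [|now apply HdY].
    apply (zr_of_div t (w k) y c d Hd). now apply HdY.
  - intros z Hz Hne. apply zr_plus_scal; [exact Hz|].
    apply (zr_div t (w k) z c d); [now apply not_eq_sym|exact Hd|exact Hz].
Qed.

(** The point [p] is fixed, so nothing like Hurwitz's theorem is needed: being a zero means that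
    [ct] vanishes at [p], or that one coefficient does, and both pass to the limit in the weighted
    norm in which [c i] tends to [h]. *)
Lemma zr_limit (c : nat -> nat -> C) (h : nat -> C) (e : R) (p : C) (i0 : nat) :
  (forall i, adm t (c i)) -> adm t h ->
  (forall i n, Cmod (h n - c i n) * Cmod (t n) ^ J0 <= 2 * (e * (1/2) ^ i) * s n) ->
  (forall i, (i0 <= i)%nat -> zr t (c i) p) -> zr t h p.
Proof.
  intros Ac Ah Hh Hp.
  assert (Hlim : forall q K, 0 <= q -> 0 <= K -> (forall i, (i0 <= i)%nat -> q <= K * (1/2) ^ i) -> q = 0).
  { intros q K Hq HK H. apply NNPP. intros Hne.
    destruct (pow_lt_1_zero (1/2)) with (y := q / (K + 1)) as [N HN].
    - rewrite Rabs_right; lra.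
    - apply Rdiv_lt_0_compat; lra.
    - specialize (HN (N + i0)%nat ltac:(lia)). specialize (H (N + i0)%nat ltac:(lia)).
      rewrite Rabs_right in HN by (apply Rle_ge, pow_le; lra).
      assert (K * (1/2) ^ (N + i0) <= K * (q / (K + 1))) by (apply Rmult_le_compat_l; lra).
      assert (K * (q / (K + 1)) < q); [|lra].
      apply Rmult_lt_reg_r with (K + 1); [lra|].
      replace (K * (q / (K + 1)) * (K + 1)) with (K * q) by (field; lra). nra. }
  assert (He : 0 <= e).
  { pose proof (Hh 0%nat 0%nat) as Q. simpl in Q. pose proof (s_pos 0%nat).
    assert (0 <= Cmod (h 0%nat - c 0%nat 0%nat) * Cmod (t 0%nat) ^ J0).
    { apply Rmult_le_pos; [apply Cmod_ge_0|left; apply t_pow_pos]. } nra. }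
  destruct (off_or_t t p) as [Ho|[m ->]].
  - apply zr_of_ct; auto. apply Cmod_eq_0.
    destruct (uniformly_off t (fun _ => 1%C) p t_ge_1 t_inf) as [q [Hq Hoff]]; [intros n _; apply Ho|].
    set (S0 := Series (fun n => s n / Cmod (t n) ^ (J0 + 1))).
    assert (HS0 : 0 <= S0).
    { apply Series_ge_0; [|exact s_sum]. intros n. apply Rdiv_le_0_compat; [left; apply s_pos|apply t_pow_pos]. }
    apply (Hlim _ (2 * e * / q * S0)).
    + apply Cmod_ge_0.
    + repeat apply Rmult_le_pos; try lra. left. now apply Rinv_0_lt_compat.
    + intros i Hi.
      replace (ct t h p) with (ct t h p + (- (1)) * ct t (c i) p)%C
        by (rewrite (zr_ct t t_ge_1 t_inf (c i) p (Hp i Hi) Ho); ring).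
      rewrite <- ct_plus_scal by auto. unfold ct.
      replace (2 * e * / q * S0 * (1/2) ^ i) with ((2 * (e * (1/2) ^ i) * / q) * S0) by ring.
      unfold S0. rewrite <- Series_scal_l. apply csum_bound; [|now apply ex_series_Rscal].
      intros n. pose proof (t_pow_pos n J0) as Hp0. pose proof (t_ge_1 n) as Ht1.
      specialize (Hoff n ltac:(intros E; apply RtoC_inj in E; lra)).
      assert (Hqt : 0 < q * Cmod (t n)) by (apply Rmult_lt_0_compat; lra).
      rewrite Cmod_div by apply (Csub_neq _ _ (Ho n)).
      replace (h n + - (1) * c i n)%C with (h n - c i n)%C by ring.
      specialize (Hh i n).
      apply Rle_trans with (Cmod (h n - c i n) / (q * Cmod (t n))).
      * apply Rmult_le_compat_l; [apply Cmod_ge_0|]. now apply Rinv_le_contravar.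
      * rewrite pow_add. simpl (Cmod (t n) ^ 1). rewrite Rmult_1_r.
        apply Rmult_le_reg_r with (q * Cmod (t n) * Cmod (t n) ^ J0); [now apply Rmult_lt_0_compat|].
        replace (Cmod (h n - c i n) / (q * Cmod (t n)) * (q * Cmod (t n) * Cmod (t n) ^ J0))
          with (Cmod (h n - c i n) * Cmod (t n) ^ J0) by (field; lra).
        replace (2 * (e * (1 / 2) ^ i) * / q * (s n / (Cmod (t n) ^ J0 * Cmod (t n))) *
                 (q * Cmod (t n) * Cmod (t n) ^ J0))
          with (2 * (e * (1 / 2) ^ i) * s n) by (field; lra).
        exact Hh.
  - apply zr_of_t; auto. apply Cmod_eq_0.
    apply (Hlim _ (2 * e * s m)); [apply Cmod_ge_0| |].
    + repeat apply Rmult_le_pos; try lra. left; apply s_pos.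
    + intros i Hi. specialize (Hh i m). rewrite (zr_t t (c i) m (Hp i Hi)) in Hh.
      replace (h m - 0)%C with (h m) in Hh by ring.
      replace (2 * e * s m * (1/2) ^ i) with (2 * (e * (1/2) ^ i) * s m) by ring.
      eapply Rle_trans; [|exact Hh]. rewrite <- (Rmult_1_r (Cmod (h m))) at 1.
      apply Rmult_le_compat_l; [apply Cmod_ge_0|]. apply pow_R1_Rle, t_ge_1.
Qed.

(** State of the recursion: the current sequence, the index from which zeros are available, the
    radius inside which no zero may be moved any more, and the bound for the next change. *)
Record stage : Type := { stage_coef : nat -> C; stage_from : nat; stage_far : R; stage_eps : R }.

Definition stage_ok (S : stage) : Prop :=
  movable (J0 + L + 1) (stage_from S) (stage_coef S) /\ 0 < stage_eps S.

(** The new [stage_far] exceeds the moduli of [x k] and of the points of [Y k], which are within [B]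
    of [w k]; later moves start beyond it and leave these zeros in place. Halving [stage_eps] makes
    the changes summable. *)
Definition stage_next (S S' : stage) : Prop :=
  stage_ok S' /\ stage_eps S' = stage_eps S * (1/2) /\
  (forall n, Cmod (stage_coef S' n - stage_coef S n) * Cmod (t n) ^ J0 <= stage_eps S * s n) /\
  exists k, stage_far S < Cmod (w k) /\ stage_far S' = Cmod (w k) + B + 1 /\
    zr t (stage_coef S') (x k) /\ (forall y, Y k y -> zr t (stage_coef S') y) /\
    forall z, zr t (stage_coef S) z -> z <> w k -> zr t (stage_coef S') z.

Lemma move_zeros (K : R) (c : nat -> C) (m : nat) :
  decay 0 c -> adm t c -> supported c -> c m <> 0%C ->
  (forall k, exists d, is_div t (w k) c d /\
    Cmod (w k - x k) * Cmod (d (idx k)) <= K * s (idx k) * Cmod (t (idx k)) ^ L /\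
    forall y, Y k y -> zr t d y) ->
  exists h, decay J0 h /\ adm t h /\ supported h /\ h m <> 0%C /\
    forall X, exists k, X < Cmod (w k) /\ zr t h (x k) /\ forall y, Y k y -> zr t h y.
Proof.
  intros Dc Ac Sc Hm Hc.
  assert (M0 : movable 0 0 c).
  { split; [exact Dc|split; [exact Ac|split; [exact Sc|]]]. exists K. intros k _.
    destruct (Hc k) as [d [H1 [H2 H3]]]. exists d. split; [exact H1|split; [|exact H3]].
    simpl. rewrite Rmult_1_r. exact H2. }
  (* An element of the space comes with [decay 0] only; these divisions provide the decay that every
     later move consumes and restores. *)
  destruct (divide_steps (J0 + L + 1) 0 m c M0 Hm) as [k1 [c1 [M1 Hm1]]].
  clear c Dc Ac Sc Hm Hc M0 K.
  (* All changes together are at most [2 * e0] in the weighted norm, which alters the coefficient at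
     [m] by no more than half of [|c1 m|]; so the limit is not zero. *)
  set (e0 := Cmod (c1 m) * Cmod (t m) ^ J0 / (4 * s m)).
  pose proof (Cmod_pos _ Hm1) as Hp1. pose proof (t_pow_pos m J0) as Hp2. pose proof (s_pos m) as Hp3.
  assert (He0 : 0 < e0) by (apply Rdiv_lt_0_compat; [now apply Rmult_lt_0_compat|lra]).
  assert (Hnext : forall S : {S | stage_ok S}, exists S' : {S | stage_ok S}, stage_next (proj1_sig S) (proj1_sig S')).
  { intros [[c k0 X e] [G1 G2]]. simpl in *.
    destruct (move_step k0 c e X G1 G2) as [k [k' [c' [H1 [H2 [H3 [H4 [H5 H6]]]]]]]].
    assert (OK : stage_ok {| stage_coef := c'; stage_from := k'; stage_far := Cmod (w k) + B + 1;
       stage_eps := e * (1/2) |}) by (split; simpl; [exact H2|lra]).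
    exists (exist _ _ OK). simpl. split; [exact OK|]. simpl.
    split; [reflexivity|split; [exact H3|]]. exists k. auto. }
  apply choice in Hnext. destruct Hnext as [next Hnext].
  assert (OK0 : stage_ok {| stage_coef := c1; stage_from := k1; stage_far := 0; stage_eps := e0 |})
    by (split; assumption).
  set (st := fix st i := match i with O => exist _ _ OK0 | S i => next (st i) end).
  set (cs := fun i => stage_coef (proj1_sig (st i))).
  set (X := fun i => stage_far (proj1_sig (st i))).
  assert (Hst : forall i, stage_next (proj1_sig (st i)) (proj1_sig (st (S i)))) by (intros i; apply Hnext).
  assert (Heps : forall i, stage_eps (proj1_sig (st i)) = e0 * (1/2) ^ i).
  { induction i as [|i IH]; [simpl; ring|]. destruct (Hst i) as [_ [E _]]. rewrite E, IH. simpl. ring. }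
  assert (Hcs : forall i n, Cmod (cs (S i) n - cs i n) * Cmod (t n) ^ J0 <= e0 * (1/2) ^ i * s n).
  { intros i n. destruct (Hst i) as [_ [_ [H _]]]. rewrite Heps in H. apply H. }
  assert (Hk : forall i, exists k, X i < Cmod (w k) /\ X (S i) = Cmod (w k) + B + 1 /\
    zr t (cs (S i)) (x k) /\ (forall y, Y k y -> zr t (cs (S i)) y) /\
    forall z, zr t (cs i) z -> z <> w k -> zr t (cs (S i)) z).
  { intros i. destruct (Hst i) as [_ [_ [_ H]]]. exact H. }
  assert (Hlim : forall n, exists l, forall i, Cmod (l - cs i n) <= 2 * (e0 * s n / Cmod (t n) ^ J0 * (1/2) ^ i)).
  { intros n. apply (telescoping_limit (fun i => cs i n)). intros i. specialize (Hcs i n).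
    pose proof (t_pow_pos n J0). apply Rmult_le_reg_r with (Cmod (t n) ^ J0); [lra|].
    replace (e0 * s n / Cmod (t n) ^ J0 * (1 / 2) ^ i * Cmod (t n) ^ J0)
      with (e0 * (1/2) ^ i * s n) by (field; lra). exact Hcs. }
  apply choice in Hlim. destruct Hlim as [h Hh].
  assert (Hh' : forall i n, Cmod (h n - cs i n) * Cmod (t n) ^ J0 <= 2 * (e0 * (1/2) ^ i) * s n).
  { intros i n. specialize (Hh n i). pose proof (t_pow_pos n J0).
    replace (2 * (e0 * (1/2) ^ i) * s n)
      with (2 * (e0 * s n / Cmod (t n) ^ J0 * (1/2) ^ i) * Cmod (t n) ^ J0) by (field; lra).
    apply Rmult_le_compat_r; lra. }
  assert (Acs : forall i, movable (J0 + L + 1) (stage_from (proj1_sig (st i))) (cs i)).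
  { intros i. unfold cs. destruct (proj2_sig (st i)) as [H _]. exact H. }
  assert (Dh : decay J0 h).
  { destruct M1 as [[K1 HK1] _]. exists (K1 + 2 * e0). intros n.
    specialize (Hh' 0%nat n). unfold cs in Hh'. simpl in Hh'. specialize (HK1 n).
    pose proof (Cmod_sub_ge (h n) (c1 n)) as T. pose proof (t_pow_pos n J0).
    assert (Q : Cmod (c1 n) * Cmod (t n) ^ J0 <= K1 * s n).
    { eapply Rle_trans; [|exact HK1]. apply Rmult_le_compat_l; [apply Cmod_ge_0|].
      apply Rle_pow; [apply t_ge_1|lia]. }
    assert ((Cmod (h n) - Cmod (c1 n)) * Cmod (t n) ^ J0 <= Cmod (h n - c1 n) * Cmod (t n) ^ J0)
      by (apply Rmult_le_compat_r; lra).
    lra. }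
  exists h. split; [exact Dh|]. split; [now apply decay_adm|]. split; [|split].
  - intros n Hn. apply NNPP. intros Hnr. apply Hn. apply Cmod_eq_0.
    apply Rle_antisym; [|apply Cmod_ge_0]. apply Rle_plus_epsilon. intros eta Heta.
    set (q := 2 * (e0 * s n / Cmod (t n) ^ J0)).
    assert (Hq : 0 < q).
    { unfold q. apply Rmult_lt_0_compat; [lra|]. apply Rdiv_lt_0_compat; [|apply t_pow_pos].
      apply Rmult_lt_0_compat; [lra|apply s_pos]. }
    destruct (pow_lt_1_zero (1/2)) with (y := eta / q) as [N HN];
      [rewrite Rabs_right; lra|now apply Rdiv_lt_0_compat|].
    specialize (HN N (Nat.le_refl _)). rewrite Rabs_right in HN by (apply Rle_ge, pow_le; lra).
    specialize (Hh n N). assert (E : cs N n = 0%C).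
    { apply NNPP. intros Hne. apply Hnr. destruct (Acs N) as [_ [_ [Hs _]]]. now apply Hs. }
    rewrite E in Hh. replace (h n - 0)%C with (h n) in Hh by ring.
    assert (q * (1/2) ^ N < eta).
    { replace eta with (q * (eta / q)) by (field; lra). now apply Rmult_lt_compat_l. }
    unfold q in *. lra.
  - intros E. specialize (Hh' 0%nat m). rewrite E in Hh'. unfold cs in Hh'. simpl in Hh'.
    replace (0 - c1 m)%C with (- c1 m)%C in Hh' by ring. rewrite Cmod_opp in Hh'.
    assert (Q : 2 * (e0 * 1) * s m = Cmod (c1 m) * Cmod (t m) ^ J0 / 2) by (unfold e0; field; lra).
    rewrite Q in Hh'. assert (0 < Cmod (c1 m) * Cmod (t m) ^ J0) by now apply Rmult_lt_0_compat. lra.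
  - assert (HXmono : forall i, X i + 1 <= X (S i)).
    { intros i. destruct (Hk i) as [k [H1 [H2 _]]]. pose proof B_nonneg. lra. }
    assert (HXge : forall i j, X i <= X (i + j)%nat).
    { intros i j. induction j as [|j IH]; [rewrite Nat.add_0_r; lra|].
      rewrite Nat.add_succ_r. specialize (HXmono (i + j)%nat). lra. }
    assert (HXn : forall i, INR i <= X i).
    { induction i as [|i IH]; [unfold X; simpl; lra|]. rewrite S_INR. specialize (HXmono i). lra. }
    (* A zero inside [X i] is never the one being moved later, since the moved [w k] lies beyond
       [X (i + j) >= X i]. *)
    assert (Hkeep : forall i p, zr t (cs i) p -> Cmod p < X i -> forall j, zr t (cs (i + j)%nat) p).
    { intros i p Hp Hpx. induction j as [|j IH]; [now rewrite Nat.add_0_r|].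
      rewrite Nat.add_succ_r. destruct (Hk (i + j)%nat) as [k [H1 [_ [_ [_ H2]]]]].
      apply H2; [exact IH|]. intros E. specialize (HXge i j). rewrite E in Hpx. lra. }
    intros X0. destruct (INR_unbounded X0) as [i Hi].
    destruct (Hk i) as [k [H1 [H2 [H3 [H4 _]]]]]. exists k. specialize (HXn i).
    split; [lra|].
    assert (G : forall p, zr t (cs (S i)) p -> Cmod (p - w k) <= B -> zr t h p).
    { intros p Hp Hpw. apply (zr_limit cs h e0 p (S i)).
      - intros j. apply Acs.
      - now apply decay_adm.
      - exact Hh'.
      - intros j Hj. replace j with (S i + (j - S i))%nat by lia.
        apply Hkeep; [exact Hp|]. rewrite H2. pose proof (Cmod_sub_ge p (w k)). lra. }
    split.
    + apply G; [exact H3|]. rewrite Cmod_sub_sym. apply w_x.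
    + intros y Hy. apply G; [now apply H4|now apply Y_w].
Qed.

End Moving.

(** * Consequences of the localization property *)

Definition outside (t : nat -> C) (K : nat) (z : C) : Prop :=
  forall n, / Cmod (t n) ^ K <= Cmod (z - t n).

Section Localized.

Variables (t : nat -> C) (s : nat -> R) (regular : nat -> Prop).
Hypothesis t_inj : forall n m, t n = t m -> n = m.
Hypothesis t_ge_2 : forall n, 2 <= Cmod (t n).
Hypothesis t_inf : to_infinity t.
Hypothesis s_pos : forall n, 0 < s n.
Hypothesis s_l2 : ex_series (fun n => (s n / Cmod (t n)) ^ 2).

Variables (rho : nat -> R) (M0 : nat).
Hypothesis rho_ge : forall n, / Cmod (t n) ^ M0 <= rho n.
Hypothesis rho_le_1 : forall n, rho n <= 1.
Hypothesis rho_sep : forall n m, n <> m -> rho n + rho m <= Cmod (t n - t m).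

(** For [s n = sqrt (mu n)] the first condition says that the sequence [a n = c n / s n] from the
    definition of the space is square summable. *)
Definition in_space (c : nat -> C) : Prop :=
  ex_series (fun n => (Cmod (c n) / s n) ^ 2) /\ supported regular c.

Variables (r : nat -> R) (r_max : R).
Hypothesis r_pos : forall n, 0 < r n.
Hypothesis r_le : forall n, r n <= r_max.
Hypothesis r_disj : forall n m, n <> m -> forall z, ~ (Cmod (z - t n) < r n /\ Cmod (z - t m) < r m).
Hypothesis localized : forall c m, in_space c -> c m <> 0%C ->
  finite_set (fun w => zr t c w /\ forall n, r n <= Cmod (w - t n)) /\
  finite_set (fun n => ~ at_most_one (fun w => zr t c w /\ Cmod (w - t n) < r n)).

Lemma t_ge_1 : forall n, 1 <= Cmod (t n).
Proof. intros n. pose proof (t_ge_2 n). lra. Qed.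

Lemma pow_t_pos (n K : nat) : 0 < Cmod (t n) ^ K.
Proof. apply pow_lt. pose proof (t_ge_2 n). lra. Qed.

Lemma inv_pow_mono (n K K' : nat) : (K <= K')%nat -> / Cmod (t n) ^ K' <= / Cmod (t n) ^ K.
Proof.
  intros H. apply Rinv_le_contravar; [apply pow_t_pos|]. apply Rle_pow; [apply t_ge_1|exact H].
Qed.

Lemma inv_pow_S (n K : nat) : / Cmod (t n) ^ (K + 1) <= / Cmod (t n) ^ K / 2.
Proof.
  pose proof (pow_t_pos n K). pose proof (t_ge_2 n).
  rewrite pow_add. simpl (Cmod (t n) ^ 1). rewrite Rmult_1_r.
  replace (/ Cmod (t n) ^ K / 2) with (/ (Cmod (t n) ^ K * 2)) by (field; lra).
  apply Rinv_le_contravar; [apply Rmult_lt_0_compat; lra|]. apply Rmult_le_compat_l; lra.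
Qed.

Lemma inv_pow_pos (n K : nat) : 0 < / Cmod (t n) ^ K.
Proof. apply Rinv_0_lt_compat, pow_t_pos. Qed.

Lemma rho_pos (n : nat) : 0 < rho n.
Proof. pose proof (rho_ge n). pose proof (inv_pow_pos n M0). lra. Qed.

Lemma t_summable : ex_series (fun n => / Cmod (t n) ^ (2 * M0 + 4)).
Proof.
  apply separated_summable; [exact t_ge_2|]. intros n m Hnm.
  pose proof (rho_sep n m Hnm). pose proof (rho_ge n). pose proof (rho_ge m). lra.
Qed.

(** [s n / |t n|] is square summable by hypothesis and [|t n| ^ -(M0 + 2)] by packing, so their
    product is summable. This is where [J0 = M0 + 2] comes from. *)
Lemma s_sum : ex_series (fun n => s n / Cmod (t n) ^ (M0 + 2 + 1)).
Proof.
  apply (ex_series_bound _ (fun n => 1/2 * ((s n / Cmod (t n)) ^ 2 + / Cmod (t n) ^ (2 * M0 + 4)))).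
  - intros n. pose proof (pow_t_pos n (M0 + 2)) as Hp. pose proof (t_ge_2 n). pose proof (s_pos n).
    split; [apply Rdiv_le_0_compat; [lra|apply pow_t_pos]|].
    replace (2 * M0 + 4)%nat with ((M0 + 2) + (M0 + 2))%nat by lia.
    rewrite (pow_add _ (M0 + 2) 1), (pow_add _ (M0 + 2) (M0 + 2)). simpl (Cmod (t n) ^ 1).
    set (p := Cmod (t n) ^ (M0 + 2)) in *. rewrite Rmult_1_r.
    replace (s n / (p * Cmod (t n))) with ((s n / Cmod (t n)) * / p) by (field; lra).
    rewrite Rinv_mult. pose proof (pow2_ge_0 (s n / Cmod (t n) - / p)). nra.
  - apply ex_series_Rscal, ex_series_Rplus; [exact s_l2|exact t_summable].
Qed.

Lemma in_space_bound (c : nat -> C) : in_space c ->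
  exists K, 0 < K /\ forall n, Cmod (c n) <= K * s n.
Proof.
  intros [H _]. set (S0 := Series (fun n => (Cmod (c n) / s n) ^ 2)).
  assert (HS : 0 <= S0) by (apply Series_ge_0; [intros; apply pow2_ge_0|exact H]).
  exists (S0 + 1). split; [lra|]. intros n. pose proof (s_pos n).
  assert (Q : (Cmod (c n) / s n) ^ 2 <= S0).
  { apply (Series_term_le (fun n => (Cmod (c n) / s n) ^ 2)); [intros; apply pow2_ge_0|exact H]. }
  assert (0 <= Cmod (c n) / s n) by (apply Rdiv_le_0_compat; [apply Cmod_ge_0|lra]).
  replace (Cmod (c n)) with (Cmod (c n) / s n * s n) by (field; lra).
  apply Rmult_le_compat_r; [lra|]. nra.
Qed.

Lemma in_space_adm (c : nat -> C) : in_space c -> adm t c.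
Proof.
  intros [H _].
  apply (ex_series_bound _ (fun n => 1/2 * ((Cmod (c n) / s n) ^ 2 + (s n / Cmod (t n)) ^ 2))).
  - intros n. pose proof (t_ge_2 n). pose proof (s_pos n).
    split; [apply Rdiv_le_0_compat; [apply Cmod_ge_0|lra]|].
    replace (Cmod (c n) / Cmod (t n)) with ((Cmod (c n) / s n) * (s n / Cmod (t n))) by (field; lra).
    pose proof (pow2_ge_0 (Cmod (c n) / s n - s n / Cmod (t n))). nra.
  - apply ex_series_Rscal, ex_series_Rplus; [exact H|exact s_l2].
Qed.

(** Here [|h n| / s n] is at most a multiple of [|t n| ^ -(M0 + 2)], whose squares are summable by
    packing; so the limit of infinitely many moves is again in the space. *)
Lemma decay_in_space (h : nat -> C) : decay t s (M0 + 2) h -> supported regular h -> in_space h.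
Proof.
  intros [K HK] Hs. split; [|exact Hs].
  apply (ex_series_bound _ (fun n => (K * K) * / Cmod (t n) ^ (2 * M0 + 4))).
  - intros n. split; [apply pow2_ge_0|]. specialize (HK n). pose proof (s_pos n).
    pose proof (pow_t_pos n (M0 + 2)) as Hp.
    replace (2 * M0 + 4)%nat with ((M0 + 2) + (M0 + 2))%nat by lia. rewrite pow_add.
    set (p := Cmod (t n) ^ (M0 + 2)) in *.
    replace (K * K * / (p * p)) with ((K / p) ^ 2) by (field; lra).
    apply pow_incr. split; [apply Rdiv_le_0_compat; [apply Cmod_ge_0|lra]|].
    apply Rmult_le_reg_r with (s n * p); [apply Rmult_lt_0_compat; lra|].
    replace (Cmod (h n) / s n * (s n * p)) with (Cmod (h n) * p) by (field; lra).
    replace (K / p * (s n * p)) with (K * s n) by (field; lra). exact HK.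
  - apply ex_series_Rscal, t_summable.
Qed.

Lemma in_space_plus_scal (k : C) (c d : nat -> C) : in_space c -> in_space d ->
  in_space (fun n => c n + k * d n)%C.
Proof.
  intros [H1 H2] [H3 H4]. split.
  - apply (ex_series_bound _ (fun n => 2 * (Cmod (c n) / s n) ^ 2 + (2 * Cmod k ^ 2) * (Cmod (d n) / s n) ^ 2)).
    + intros n. split; [apply pow2_ge_0|]. pose proof (s_pos n).
      apply Rle_trans with ((Cmod (c n) / s n + Cmod k * (Cmod (d n) / s n)) ^ 2).
      * apply pow_incr. split; [apply Rdiv_le_0_compat; [apply Cmod_ge_0|lra]|].
        replace (Cmod (c n) / s n + Cmod k * (Cmod (d n) / s n))
          with ((Cmod (c n) + Cmod k * Cmod (d n)) / s n) by (field; lra).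
        apply Rmult_le_compat_r; [left; now apply Rinv_0_lt_compat|].
        eapply Rle_trans; [apply Cmod_triangle|]. rewrite Cmod_mult. lra.
      * pose proof (pow2_ge_0 (Cmod (c n) / s n - Cmod k * (Cmod (d n) / s n))). nra.
    + apply ex_series_Rplus; apply ex_series_Rscal; assumption.
  - intros n Hn. destruct (classic (c n = 0%C)) as [E|E]; [|now apply H2].
    apply H4. intros E2. apply Hn. rewrite E, E2. ring.
Qed.

Lemma other_disc (n m : nat) (z : C) : m <> n -> Cmod (z - t n) <= rho n -> rho m <= Cmod (z - t m).
Proof.
  intros Hmn Hz. pose proof (rho_sep n m (not_eq_sym Hmn)).
  pose proof (Cmod_sub_triangle (t n) z (t m)) as T. rewrite (Cmod_sub_sym (t n) z) in T. lra.
Qed.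

Lemma disc_unique (n m : nat) (z : C) : Cmod (z - t n) < rho n -> Cmod (z - t m) < rho m -> n = m.
Proof.
  intros H1 H2. apply NNPP. intros Hnm. pose proof (other_disc n m z (not_eq_sym Hnm) ltac:(lra)). lra.
Qed.

Lemma zeros_outside_bounded (c : nat -> C) (m : nat) : in_space c -> c m <> 0%C ->
  exists X, forall w, zr t c w -> X <= Cmod w -> exists n, Cmod (w - t n) < r n.
Proof.
  intros Hc Hm. destruct (localized c m Hc Hm) as [H _].
  destruct (finite_C_bound _ H) as [X HX]. exists X. intros w Hw Hwx.
  apply NNPP. intros HN. assert (Cmod w < X); [|lra]. apply HX. split; [exact Hw|].
  intros n. apply Rnot_lt_le. intros Hlt. apply HN. now exists n.
Qed.

(** If this boundary point lay in the open disc [k], a point slightly further inside disc [n] would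
    lie in both discs, against disjointness. It is therefore a target outside all localization
    discs. *)
Lemma boundary_outside (n k : nat) : r k <= Cmod (t n + RtoC (r n) - t k).
Proof.
  pose proof (r_pos n) as Hn.
  assert (E : Cmod (t n + RtoC (r n) - t n) = r n).
  { replace (t n + RtoC (r n) - t n)%C with (RtoC (r n)) by ring. rewrite Cmod_R, Rabs_right; lra. }
  destruct (Nat.eq_dec k n) as [->|Hkn]; [lra|].
  apply Rnot_lt_le. intros Hlt. set (d := r k - Cmod (t n + RtoC (r n) - t k)).
  set (h := Rmin (d / 2) (r n / 2)).
  assert (Hh : 0 < h) by (apply Rmin_glb_lt; unfold d; lra).
  assert (Hh1 : h <= d / 2) by apply Rmin_l. assert (Hh2 : h <= r n / 2) by apply Rmin_r.
  apply (r_disj n k (not_eq_sym Hkn) (t n + RtoC (r n - h))%C). split.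
  - replace (t n + RtoC (r n - h) - t n)%C with (RtoC (r n - h)) by ring.
    rewrite Cmod_R, Rabs_right; lra.
  - replace (t n + RtoC (r n - h) - t k)%C with ((t n + RtoC (r n) - t k) - RtoC h)%C
      by (rewrite RtoC_minus; ring).
    eapply Rle_lt_trans; [apply Cmod_sub_le|]. rewrite Cmod_R, Rabs_right by lra. unfold d in *. lra.
Qed.

(* Infinitely many zeros cannot all be moved to boundary points of the
   localization discs. *)
Lemma no_cheap_move (w : nat -> C) (idx : nat -> nat) (c : nat -> C) (m L : nat) (K : R) :
  to_infinity w -> to_infinity (fun k => t (idx k)) ->
  (forall k n, n <> idx k -> / Cmod (t n) ^ L <= Cmod (w k - t n)) ->
  (forall k, w k = t (idx k) -> regular (idx k)) ->
  in_space c -> c m <> 0%C ->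
  (forall k, exists d, is_div t (w k) c d /\ Cmod (d (idx k)) <= K * s (idx k) * Cmod (t (idx k)) ^ L) ->
  False.
Proof.
  intros Hw Hidx Hsep Hreg Hc Hm Hdiv.
  destruct (zeros_outside_bounded c m Hc Hm) as [X HX]. destruct (Hw X) as [k0 Hk0].
  assert (Hn : forall k, exists n, Cmod (w (k + k0)%nat - t n) < r n).
  { intros k. apply HX; [|apply Hk0; lia]. destruct (Hdiv (k + k0)%nat) as [d [Hd _]]. now exists d. }
  destruct (choice _ Hn) as [nn Hnn].
  set (x := fun k => (t (nn k) + RtoC (r (nn k)))%C).
  assert (Hwx : forall k, Cmod (w (k + k0)%nat - x k) <= 2 * r_max).
  { intros k. unfold x. specialize (Hnn k). pose proof (r_le (nn k)). pose proof (r_pos (nn k)).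
    replace (w (k + k0)%nat - (t (nn k) + RtoC (r (nn k))))%C
      with ((w (k + k0)%nat - t (nn k)) - RtoC (r (nn k)))%C by ring.
    eapply Rle_trans; [apply Cmod_sub_le|]. rewrite Cmod_R, Rabs_right by lra. lra. }
  assert (Hrm : 0 < r_max) by (pose proof (r_pos 0%nat); pose proof (r_le 0%nat); lra).
  destruct (in_space_bound c Hc) as [Kc [HKc Hcb]].
  destruct (move_zeros t s regular t_inj t_ge_1 t_inf s_pos (M0 + 2) s_sum
    (fun k => w (k + k0)%nat) x (fun k => idx (k + k0)%nat) (fun _ _ => False) (2 * r_max) L)
    with (K := 2 * r_max * Rmax K 0) (c := c) (m := m) as [h [H1 [H2 [H3 [H4 H5]]]]].
  - intros Z. destruct (Hw Z) as [N HN]. exists N. intros n HnN. apply HN. lia.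
  - intros Z. destruct (Hidx Z) as [N HN]. exists N. intros n HnN. apply HN. lia.
  - exact Hwx.
  - intros k y [].
  - intros k n Hkn. now apply Hsep.
  - intros k E. left. now apply Hreg.
  - exists Kc. intros n. simpl. rewrite Rmult_1_r. apply Hcb.
  - now apply in_space_adm.
  - apply Hc.
  - exact Hm.
  - intros k. destruct (Hdiv (k + k0)%nat) as [d [Hd1 Hd2]]. exists d.
    split; [exact Hd1|split; [|intros y []]].
    set (i := idx (k + k0)%nat) in *. pose proof (pow_t_pos i L). pose proof (s_pos i).
    replace (2 * r_max * Rmax K 0 * s i * Cmod (t i) ^ L)
      with (2 * r_max * (Rmax K 0 * s i * Cmod (t i) ^ L)) by ring.
    apply Rmult_le_compat; try apply Cmod_ge_0; [apply Hwx|].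
    eapply Rle_trans; [exact Hd2|]. apply Rmult_le_compat_r; [lra|].
    apply Rmult_le_compat_r; [lra|apply Rmax_l].
  - destruct (localized h m (decay_in_space h H1 H3) H4) as [Hf _].
    destruct (finite_C_bound _ Hf) as [Z HZ].
    destruct (H5 (Z + 2 * r_max)) as [k [K1 [K2 _]]].
    assert (Q : Cmod (x k) < Z).
    { apply HZ. split; [exact K2|]. intros n. apply boundary_outside. }
    pose proof (Cmod_sub_ge (w (k + k0)%nat) (x k)). specialize (Hwx k). lra.
Qed.

(** Counterpart of [no_cheap_move] for the second half of localization: [w k] is moved into a
    localization disc that also holds the preserved zero [y k], so infinitely many discs would
    contain two zeros. If [w k] is a node, [y k] is the same node; the quotient vanishes there and
    no question of support arises. *)
Lemma no_cheap_collision (w x y : nat -> C) (idx : nat -> nat) (c : nat -> C) (m L : nat) (B K : R) :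
  to_infinity w -> to_infinity (fun k => t (idx k)) ->
  (forall k, Cmod (w k - x k) <= B) -> (forall k, Cmod (y k - w k) <= B) ->
  (forall k n, n <> idx k -> / Cmod (t n) ^ L <= Cmod (w k - t n)) ->
  (forall k, w k = t (idx k) -> y k = t (idx k)) ->
  in_space c -> c m <> 0%C ->
  (forall k, exists d, is_div t (w k) c d /\
     Cmod (w k - x k) * Cmod (d (idx k)) <= K * s (idx k) * Cmod (t (idx k)) ^ L /\ zr t d (y k)) ->
  (forall k, x k <> y k) ->
  (forall k, exists n, Cmod (x k - t n) < r n /\ Cmod (y k - t n) < r n) ->
  False.
Proof.
  intros Hw Hidx Hwx Hyw Hsep Hreg Hc Hm Hdiv Hxy Hdisc.
  destruct (in_space_bound c Hc) as [Kc [HKc Hcb]].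
  destruct (move_zeros t s regular t_inj t_ge_1 t_inf s_pos (M0 + 2) s_sum
    w x idx (fun k z => z = y k) B L)
    with (K := K) (c := c) (m := m) as [h [H1 [H2 [H3 [H4 H5]]]]].
  - exact Hw.
  - exact Hidx.
  - exact Hwx.
  - intros k z ->. apply Hyw.
  - exact Hsep.
  - intros k E. right. symmetry. now apply Hreg.
  - exists Kc. intros n. simpl. rewrite Rmult_1_r. apply Hcb.
  - now apply in_space_adm.
  - apply Hc.
  - exact Hm.
  - intros k. destruct (Hdiv k) as [d [D1 [D2 D3]]]. exists d.
    split; [exact D1|split; [exact D2|]]. now intros z ->.
  - destruct (localized h m (decay_in_space h H1 H3) H4) as [_ Hf].
    destruct (finite_nat_bound _ Hf) as [N HN].
    assert (HT : exists T, forall n, (n < N)%nat -> Cmod (t n) <= T).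
    { clear. induction N as [|N [T HT]]; [exists 0; intros; lia|].
      exists (Rmax T (Cmod (t N))). intros n Hn. destruct (Nat.eq_dec n N) as [->|Hne]; [apply Rmax_r|].
      eapply Rle_trans; [apply HT; lia|apply Rmax_l]. }
    destruct HT as [T HT]. destruct (H5 (T + r_max + B)) as [k [K1 [K2 K3]]].
    destruct (Hdisc k) as [n [D1 D2]].
    assert (Hn : (n < N)%nat).
    { apply HN. intros Ham. apply (Hxy k). apply Ham; split; auto. }
    specialize (HT n Hn). pose proof (r_le n).
    pose proof (Cmod_sub_ge (y k) (t n)). pose proof (Cmod_sub_ge (w k) (y k)) as Q.
    rewrite Cmod_sub_sym in Q. specialize (Hyw k). lra.
Qed.

(** At such zeros division by [t n - w] loses no more than the factor [|t n| ^ K], so infinitely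
    many of them could be moved at polynomial cost. *)
Lemma zeros_outside_finite (c : nat -> C) (m K : nat) : in_space c -> c m <> 0%C ->
  finite_set (fun w => zr t c w /\ outside t K w).
Proof.
  intros Hc Hm. apply NNPP. intros Hinf.
  assert (Hw : forall k : nat, exists w, (zr t c w /\ outside t K w) /\ INR k < Cmod w).
  { intros k. apply (zeros_unbounded t t_inj t_ge_1 t_inf c m); auto; [now apply in_space_adm|].
    intros w Hw. apply Hw. }
  destruct (choice _ Hw) as [w Hww].
  destruct (in_space_bound c Hc) as [Kc [HKc Hcb]].
  (* No node is close to [w k], so any sequence of nodes tending to infinity may play the part of
     the nearest ones. *)
  apply (no_cheap_move w (fun k => k) c m K Kc); auto.
  - intros X. destruct (INR_unbounded X) as [N HN]. exists N. intros n Hn.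
    destruct (Hww n) as [_ H]. apply le_INR in Hn. lra.
  - intros k n _. apply Hww.
  - intros k E. exfalso. destruct (Hww k) as [[_ H] _]. specialize (H k). rewrite E, Cmod_self in H.
    pose proof (inv_pow_pos k K). lra.
  - intros k. destruct (Hww k) as [[[d Hd] Ho] _]. exists d. split; [exact Hd|].
    specialize (Ho k). specialize (Hcb k). destruct Hd as [E _]. rewrite E, Cmod_mult, Cmod_sub_sym in Hcb.
    pose proof (pow_t_pos k K).
    assert (Q : 1 <= Cmod (w k - t k) * Cmod (t k) ^ K).
    { rewrite <- (Rinv_l (Cmod (t k) ^ K)) by lra. apply Rmult_le_compat_r; lra. }
    apply Rle_trans with (Cmod (d k) * (Cmod (w k - t k) * Cmod (t k) ^ K)).
    + rewrite <- (Rmult_1_r (Cmod (d k))) at 1. apply Rmult_le_compat_l; [apply Cmod_ge_0|exact Q].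
    + replace (Cmod (d k) * (Cmod (w k - t k) * Cmod (t k) ^ K))
        with ((Cmod (w k - t k) * Cmod (d k)) * Cmod (t k) ^ K) by ring.
      apply Rmult_le_compat_r; lra.
Qed.

Lemma in_disc_outside_others (n k K : nat) (z : C) : (M0 <= K)%nat -> k <> n ->
  Cmod (z - t n) <= rho n -> / Cmod (t k) ^ K <= Cmod (z - t k).
Proof.
  intros HK Hkn Hz. pose proof (other_disc n k z Hkn Hz). pose proof (rho_ge k).
  pose proof (inv_pow_mono k M0 K HK). lra.
Qed.

Lemma zeros_not_close_finite (c : nat -> C) (m K : nat) : (M0 <= K)%nat -> in_space c -> c m <> 0%C ->
  finite_set (fun n => exists w, zr t c w /\ Cmod (w - t n) < rho n /\ / Cmod (t n) ^ K <= Cmod (w - t n)).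
Proof.
  intros HK Hc Hm.
  apply (finite_inj_rel (fun w n => Cmod (w - t n) < rho n) (fun w => zr t c w /\ outside t K w)).
  - intros n [w [H1 [H2 H3]]]. exists w. split; [split; [exact H1|]|exact H2].
    intros k. destruct (Nat.eq_dec k n) as [->|Hkn]; [exact H3|].
    apply (in_disc_outside_others n); auto. lra.
  - intros w n n' H1 H2. now apply (disc_unique n n' w).
  - now apply (zeros_outside_finite c m).
Qed.

(** Of two zeros near [t n], the farther one [w] is moved next to the nearer one. The distance is at
    most [3 |w - t n|] when [w] is not the node, so the product with [d n = c n / (t n - w)] is at
    most [3 |c n|], however small [|w - t n|] is. *)
Lemma double_zeros_finite (c : nat -> C) (m : nat) : in_space c -> c m <> 0%C ->
  finite_set (fun n => exists w y d, is_div t w c d /\ zr t d y /\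
    Cmod (w - t n) < rho n /\ Cmod (y - t n) < rho n).
Proof.
  intros Hc Hm. apply NNPP. intros Hinf.
  destruct (zeros_outside_bounded c m Hc Hm) as [X HX].
  assert (Hseq : forall k : nat, exists q : nat * C * C * C, let '(n, w, x, y) := q in
    INR k <= Cmod (t n) /\ Cmod (w - t n) < rho n /\ Cmod (y - t n) < rho n /\
    Cmod (y - t n) <= Cmod (w - t n) /\ Cmod (w - x) <= 3 /\ x <> y /\
    (exists d, is_div t w c d /\ zr t d y /\ Cmod (w - x) * Cmod (d n) <= 3 * Cmod (c n)) /\
    exists i, Cmod (x - t i) < r i /\ Cmod (y - t i) < r i).
  { intros k. destruct (t_inf (Rmax (INR k) (X + 2))) as [N HN].
    destruct (infinite_nat _ Hinf N) as [n [Hn [w0 [y0 [d0 [D1 [D2 [D3 D4]]]]]]]].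
    specialize (HN n Hn).
    pose proof (Rmax_l (INR k) (X + 2)). pose proof (Rmax_r (INR k) (X + 2)).
    (* Either zero may be divided out first, so the pair can be ordered with [w] the farther one;
       [div_swap] also covers [w = y]. *)
    assert (Hwy : exists w y d, is_div t w c d /\ zr t d y /\ Cmod (w - t n) < rho n /\
      Cmod (y - t n) < rho n /\ Cmod (y - t n) <= Cmod (w - t n)).
    { destruct (Rle_lt_dec (Cmod (y0 - t n)) (Cmod (w0 - t n))) as [Hle|Hlt].
      - exists w0, y0, d0. auto.
      - destruct D2 as [e He]. destruct (div_swap t w0 y0 c d0 e D1 He) as [S1 S2].
        exists y0, w0, (fun n => (t n - w0) * e n)%C. repeat split; auto; try apply S1; try lra.
        now exists e. }
    clear w0 y0 d0 D1 D2 D3 D4. destruct Hwy as [w [y [d [D1 [D2 [D3 [D4 D5]]]]]]].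
    assert (Hy : exists i, Cmod (y - t i) < r i).
    { apply HX; [now apply (zr_of_div t w y c d)|]. pose proof (Cmod_sub_ge (t n) y) as Q.
      rewrite Cmod_sub_sym in Q. pose proof (rho_le_1 n). lra. }
    destruct Hy as [i Hi].
    (* The target is [y + eta]: different from [y], in the same localization disc, and shifted by at
       most [|w - t n|] so that the cost is not spoilt. *)
    assert (Heta : exists eta, 0 < eta /\ eta < r i - Cmod (y - t i) /\ eta <= 1 /\
       (w <> t n -> eta <= Cmod (w - t n))).
    { destruct (classic (w = t n)) as [E|E].
      - exists (Rmin ((r i - Cmod (y - t i)) / 2) 1).
        pose proof (Rmin_l ((r i - Cmod (y - t i)) / 2) 1). pose proof (Rmin_r ((r i - Cmod (y - t i)) / 2) 1).
        split; [apply Rmin_glb_lt; lra|]. repeat split; try lra. contradiction.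
      - pose proof (Cmod_sub_pos _ _ E).
        exists (Rmin ((r i - Cmod (y - t i)) / 2) (Cmod (w - t n))). pose proof (rho_le_1 n).
        pose proof (Rmin_l ((r i - Cmod (y - t i)) / 2) (Cmod (w - t n))).
        pose proof (Rmin_r ((r i - Cmod (y - t i)) / 2) (Cmod (w - t n))).
        split; [apply Rmin_glb_lt; lra|]. repeat split; intros; lra. }
    destruct Heta as [eta [E1 [E2 [E3 E4]]]].
    assert (Ex : Cmod (y - (y + RtoC eta)) = eta).
    { replace (y - (y + RtoC eta))%C with (RtoC (- eta)) by (rewrite RtoC_opp; ring).
      rewrite Cmod_R, Rabs_Ropp, Rabs_right; lra. }
    assert (Hwy : Cmod (w - (y + RtoC eta)) <= 2 * Cmod (w - t n) + eta).
    { pose proof (Cmod_sub_triangle w y (y + RtoC eta)).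
      pose proof (Cmod_sub_triangle w (t n) y) as T. rewrite (Cmod_sub_sym (t n) y) in T. lra. }
    exists (n, w, (y + RtoC eta)%C, y). pose proof (rho_le_1 n).
    split; [lra|split; [exact D3|split; [exact D4|split; [exact D5|split; [lra|split]]]]].
    - intros E. rewrite E in Ex. rewrite Cmod_self in Ex. lra.
    - split.
      + exists d. split; [exact D1|split; [exact D2|]].
        destruct D1 as [Ed _]. destruct (classic (w = t n)) as [E|E].
        (* If the farther zero is the node itself, so is the other; then [d n = 0] and the move
           costs nothing at [n]. *)
        * assert (Hyt : y = t n).
          { apply Cmod_sub_eq_0. rewrite E, Cmod_self in D5. pose proof (Cmod_ge_0 (y - t n)). lra. }
          rewrite Hyt in D2. rewrite (zr_t t d n D2), Cmod_0. pose proof (Cmod_ge_0 (c n)). lra.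
        * specialize (E4 E). rewrite Ed, Cmod_mult, (Cmod_sub_sym (t n)).
          rewrite <- Rmult_assoc. apply Rmult_le_compat_r; [apply Cmod_ge_0|lra].
      + exists i. split; [|exact Hi].
        pose proof (Cmod_sub_triangle (y + RtoC eta) y (t i)) as T.
        rewrite (Cmod_sub_sym (y + RtoC eta) y), Ex in T. lra. }
  destruct (choice _ Hseq) as [q Hq]. clear Hseq.
  set (idx := fun k => fst (fst (fst (q k)))). set (w := fun k => snd (fst (fst (q k)))).
  set (x := fun k => snd (fst (q k))). set (y := fun k => snd (q k)).
  assert (Hq' : forall k, INR k <= Cmod (t (idx k)) /\ Cmod (w k - t (idx k)) < rho (idx k) /\
    Cmod (y k - t (idx k)) < rho (idx k) /\
    Cmod (y k - t (idx k)) <= Cmod (w k - t (idx k)) /\ Cmod (w k - x k) <= 3 /\ x k <> y k /\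
    (exists d, is_div t (w k) c d /\ zr t d (y k) /\
       Cmod (w k - x k) * Cmod (d (idx k)) <= 3 * Cmod (c (idx k))) /\
    exists i, Cmod (x k - t i) < r i /\ Cmod (y k - t i) < r i).
  { intros k. specialize (Hq k). unfold idx, w, x, y. destruct (q k) as [[[? ?] ?] ?]. exact Hq. }
  destruct (in_space_bound c Hc) as [Kc [HKc Hcb]].
  apply (no_cheap_collision w x y idx c m M0 3 (3 * Kc)); auto.
  - intros Z. destruct (INR_unbounded (Z + 1)) as [N HN]. exists N. intros k Hk.
    destruct (Hq' k) as [Q1 [Q2 _]]. apply le_INR in Hk. pose proof (rho_le_1 (idx k)).
    pose proof (Cmod_sub_ge (t (idx k)) (w k)) as T. rewrite Cmod_sub_sym in T. lra.
  - intros Z. destruct (INR_unbounded Z) as [N HN]. exists N. intros k Hk.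
    destruct (Hq' k) as [Q1 _]. apply le_INR in Hk. lra.
  - intros k. apply (Hq' k).
  - intros k. destruct (Hq' k) as [_ [Q2 [Q3 _]]]. pose proof (rho_le_1 (idx k)).
    pose proof (Cmod_sub_triangle (y k) (t (idx k)) (w k)) as T.
    rewrite (Cmod_sub_sym (t (idx k)) (w k)) in T. lra.
  - intros k n Hn. destruct (Hq' k) as [_ [Q2 _]].
    apply (in_disc_outside_others (idx k)); auto. lra.
  - intros k E. destruct (Hq' k) as [_ [_ [_ [Q4 _]]]]. rewrite E, Cmod_self in Q4.
    apply Cmod_sub_eq_0. pose proof (Cmod_ge_0 (y k - t (idx k))). lra.
  - intros k. destruct (Hq' k) as [_ [_ [_ [_ [_ [_ [[d [Q1 [Q2 Q3]]] _]]]]]]].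
    exists d. split; [exact Q1|split; [|exact Q2]]. eapply Rle_trans; [exact Q3|].
    specialize (Hcb (idx k)). pose proof (s_pos (idx k)).
    assert (1 <= Cmod (t (idx k)) ^ M0) by (apply pow_R1_Rle, t_ge_1).
    assert (3 * Kc * s (idx k) <= 3 * Kc * s (idx k) * Cmod (t (idx k)) ^ M0).
    { rewrite <- (Rmult_1_r (3 * Kc * s (idx k))) at 1. apply Rmult_le_compat_l; [|lra].
      repeat apply Rmult_le_pos; lra. }
    lra.
  - intros k. apply (Hq' k).
  - intros k. apply (Hq' k).
Qed.

Lemma circle_outside (n K : nat) (z : C) : (M0 <= K)%nat ->
  Cmod (z - t n) = / Cmod (t n) ^ K -> outside t K z.
Proof.
  intros HK Hz k. destruct (Nat.eq_dec k n) as [->|Hkn]; [lra|].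
  apply (in_disc_outside_others n); auto. rewrite Hz.
  pose proof (inv_pow_mono n M0 K HK). pose proof (rho_ge n). lra.
Qed.

(** Let [v] be a zero of [d] near [t n], where [c] has none. The quotient of [d / (z - v)] by [c]
    then has no pole in the disc, and its bound on the circle of radius [|t n| ^ -K] passes to the
    centre, where it compares the coefficient [e n] of the divided sequence with [c n]. So [v] can
    be moved at polynomial cost, which infinitely many zeros cannot. *)
Lemma dominated_attraction (c d : nat -> C) (m' K : nat) (X B : R) : (M0 < K)%nat ->
  in_space c -> in_space d -> d m' <> 0%C -> 0 < B ->
  (forall z, outside t K z -> X <= Cmod z -> Cmod (ct t d z) <= B * Cmod (ct t c z)) ->
  finite_set (fun n => (exists v, zr t d v /\ Cmod (v - t n) < rho n) /\
    ~ exists u, zr t c u /\ Cmod (u - t n) < rho n).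
Proof.
  intros HK Hc Hd Hm' HB Hdom. apply NNPP. intros Hinf.
  pose proof (zeros_not_close_finite d m' (K + 1) ltac:(lia) Hd Hm') as Hfin.
  destruct (finite_nat_bound _ Hfin) as [N0 HN0].
  pose proof (in_space_adm c Hc) as Ac. pose proof (in_space_adm d Hd) as Ad.
  assert (Hseq : forall k : nat, exists q : nat * C, INR k <= Cmod (t (fst q)) /\ zr t d (snd q) /\
    Cmod (snd q - t (fst q)) < rho (fst q) /\ c (fst q) <> 0%C /\
    exists e, is_div t (snd q) d e /\ Cmod (e (fst q)) <= 2 * B * Cmod (t (fst q)) ^ K * Cmod (c (fst q))).
  { intros k. destruct (t_inf (Rmax (INR k) (X + 2))) as [N HN].
    destruct (infinite_nat _ Hinf (N + N0)%nat) as [n [Hn [[v [Hv1 Hv2]] Hu]]].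
    specialize (HN n ltac:(lia)).
    pose proof (Rmax_l (INR k) (X + 2)). pose proof (Rmax_r (INR k) (X + 2)).
    set (sn := / Cmod (t n) ^ K).
    assert (Hsn : 0 < sn) by apply inv_pow_pos.
    assert (Hsn1 : sn < rho n).
    { pose proof (inv_pow_mono n (M0 + 1) K ltac:(lia)). pose proof (inv_pow_S n M0).
      pose proof (rho_ge n). pose proof (inv_pow_pos n M0). unfold sn. lra. }
    (* Past [N0] the zeros are closer to [t n] than [|t n| ^ -(K + 1) <= sn / 2]. Hence
       [|z - v| >= sn / 2] on the circle, and this is the factor 2 in the bound on [e]. *)
    assert (Hv3 : Cmod (v - t n) <= sn / 2).
    { destruct (Rlt_le_dec (Cmod (v - t n)) (/ Cmod (t n) ^ (K + 1))) as [Hlt|Hle].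
      - pose proof (inv_pow_S n K). unfold sn. lra.
      - exfalso. assert (n < N0)%nat; [|lia]. apply HN0. exists v. auto. }
    assert (Hcn : c n <> 0%C).
    { intros E. apply Hu. exists (t n). split; [now apply zr_of_t; auto using t_ge_1|].
      rewrite Cmod_self. apply rho_pos. }
    exists (n, v). simpl. split; [lra|split; [exact Hv1|split; [exact Hv2|split; [exact Hcn|]]]].
    destruct Hv1 as [e He]. exists e. split; [exact He|].
    pose proof (is_div_adm t t_ge_1 v d e He) as Ae.
    assert (Hob : forall z, Cmod (z - t n) <= sn -> off_but t n z).
    { intros z Hz i Hi ->. pose proof (other_disc n i (t i) Hi ltac:(lra)) as Q.
      rewrite Cmod_self in Q. pose proof (rho_pos i). lra. }
    assert (Hnz : forall z, Cmod (z - t n) <= sn -> rct t n c z <> 0%C).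
    { intros z Hz E. apply Hu. exists z. split; [|lra].
      apply (rct_zero t t_inj t_ge_1 t_inf n c z Ac (Hob z Hz)). exact E. }
    assert (CB : Cmod (rct t n e (t n) / rct t n c (t n)) <= 2 * B * Cmod (t n) ^ K).
    { assert (Hsd : forall z, Cmod (z - t n) <= sn -> sdiff (fun z => rct t n e z / rct t n c z)%C z).
      { intros z Hz. apply sdiff_div; [| |now apply Hnz]; apply rct_sdiff; auto using t_ge_1. }
      apply (center_bound (fun z => rct t n e z / rct t n c z)%C (t n) sn); [exact Hsn| | |].
      - intros z Hz. apply Hsd. lra.
      - apply sdiff_cont, Hsd. rewrite Cmod_self. lra.
      - intros x _. set (z := (t n + RtoC sn * cis x)%C).
        assert (Hz : Cmod (z - t n) = sn) by (apply circle_dist; lra).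
        pose proof (circle_outside n K z ltac:(lia) Hz) as Ho.
        assert (Hoff : off t z).
        { intros i E. specialize (Ho i). rewrite E, Cmod_self in Ho. pose proof (inv_pow_pos i K). lra. }
        assert (HzX : X <= Cmod z).
        { pose proof (Cmod_sub_ge (t n) z) as Q. rewrite Cmod_sub_sym in Q. pose proof (rho_le_1 n). lra. }
        specialize (Hdom z Ho HzX). rewrite (ct_div t t_ge_1 t_inf v d e z He Hoff), Cmod_mult in Hdom.
        rewrite Cmod_div by (apply Hnz; lra).
        assert (Hnzz : 0 < Cmod (rct t n c z)) by (apply Cmod_pos, Hnz; lra).
        rewrite !(rct_ct t t_ge_1 t_inf) in * by assumption. rewrite !Cmod_mult in *. rewrite Hz in *.
        assert (Hvz : sn / 2 <= Cmod (z - v)).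
        { pose proof (Cmod_sub_triangle z v (t n)). lra. }
        assert (Hc0 : 0 < Cmod (ct t c z)) by nra.
        apply Rmult_le_reg_r with (sn * Cmod (ct t c z)); [exact Hnzz|].
        replace (sn * Cmod (ct t e z) / (sn * Cmod (ct t c z)) * (sn * Cmod (ct t c z)))
          with (sn * Cmod (ct t e z)) by (field; lra).
        replace (2 * B * Cmod (t n) ^ K * (sn * Cmod (ct t c z))) with (2 * (B * Cmod (ct t c z))).
        + assert (sn / 2 * Cmod (ct t e z) <= Cmod (z - v) * Cmod (ct t e z))
            by (apply Rmult_le_compat_r; [apply Cmod_ge_0|exact Hvz]). lra.
        + unfold sn. field. pose proof (pow_t_pos n K). lra. }
    rewrite !rct_t in CB. rewrite Cmod_div in CB by exact Hcn.
    pose proof (Cmod_pos _ Hcn) as Hp.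
    replace (Cmod (e n)) with (Cmod (e n) / Cmod (c n) * Cmod (c n)) by (field; lra).
    apply Rmult_le_compat_r; lra. }
  destruct (choice _ Hseq) as [q Hq]. clear Hseq.
  destruct (in_space_bound c Hc) as [Kc [HKc Hcb]].
  apply (no_cheap_move (fun k => snd (q k)) (fun k => fst (q k)) d m' K (2 * B * Kc)); auto.
  - intros Z. destruct (INR_unbounded (Z + 1)) as [N HN]. exists N. intros k Hk.
    destruct (Hq k) as [Q1 [_ [Q3 _]]]. apply le_INR in Hk. pose proof (rho_le_1 (fst (q k))).
    pose proof (Cmod_sub_ge (t (fst (q k))) (snd (q k))) as T. rewrite Cmod_sub_sym in T. lra.
  - intros Z. destruct (INR_unbounded Z) as [N HN]. exists N. intros k Hk.
    destruct (Hq k) as [Q1 _]. apply le_INR in Hk. lra.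
  - intros k n Hn. destruct (Hq k) as [_ [_ [Q3 _]]].
    apply (in_disc_outside_others (fst (q k))); auto; [lia|lra].
  (* The zero of [d] may be the node itself; regularity of the node then comes from [c], whose
     coefficient there is nonzero. *)
  - intros k _. apply Hc. apply (Hq k).
  - intros k. destruct (Hq k) as [_ [_ [_ [_ [e [He1 He2]]]]]]. exists e. split; [exact He1|].
    eapply Rle_trans; [exact He2|]. specialize (Hcb (fst (q k))).
    pose proof (pow_t_pos (fst (q k)) K).
    replace (2 * B * Kc * s (fst (q k)) * Cmod (t (fst (q k))) ^ K)
      with (2 * B * Cmod (t (fst (q k))) ^ K * (Kc * s (fst (q k)))) by ring.
    apply Rmult_le_compat_l; [|exact Hcb]. repeat apply Rmult_le_pos; lra.
Qed.

End Localized.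

(** * Liouville's theorem *)

Lemma sdiff_quotient (F : C -> C) (x z : C) : z <> x -> sdiff F z ->
  sdiff (fun z => (F z - F x) / (z - x))%C z.
Proof.
  intros Hz HF. apply sdiff_div; [apply sdiff_minus; [exact HF|apply sdiff_const]| |now apply Csub_neq].
  apply sdiff_minus; [apply sdiff_id|apply sdiff_const].
Qed.

(** The difference quotient at [x], completed by the derivative, is continuous at [x] and at most
    [2 B / R0] on the circle of radius [R0]; [center_bound] carries this to the derivative. *)
Lemma liouville_deriv (E : C -> C) (B : R) (x : C) : (forall z, sdiff E z) ->
  (forall z, Cmod (E z) <= B) -> strict_deriv E x 0%C.
Proof.
  intros HE HB. destruct (HE x) as [l Hl]. replace (RtoC 0) with l; [exact Hl|].
  apply Cmod_eq_0. apply Rle_antisym; [|apply Cmod_ge_0].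
  assert (HB0 : 0 <= B) by (eapply Rle_trans; [apply (Cmod_ge_0 (E 0%C))|apply HB]).
  set (G := fun z => if excluded_middle_informative (z = x) then l else ((E z - E x) / (z - x))%C).
  assert (Gx : G x = l) by (unfold G; destruct (excluded_middle_informative (x = x)); congruence).
  assert (Gz : forall z, z <> x -> G z = ((E z - E x) / (z - x))%C)
    by (intros z Hz; unfold G; destruct (excluded_middle_informative (z = x)); congruence).
  apply Rle_plus_epsilon. intros eps He. rewrite Rplus_0_l.
  set (R0 := 2 * B / eps + 1).
  assert (HR1 : 0 <= 2 * B / eps) by (apply Rdiv_le_0_compat; lra).
  assert (HR : 0 < R0) by (unfold R0; lra).
  rewrite <- Gx. apply (center_bound G x R0); [exact HR| | |].
  - intros z Hz. assert (Hzx : z <> x) by (intros ->; rewrite Cmod_self in Hz; lra).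
    apply (sdiff_ext (fun z => (E z - E x) / (z - x))%C).
    + exists (Cmod (z - x)). split; [lra|]. intros a Ha. symmetry. apply Gz.
      intros ->. rewrite Cmod_sub_sym in Ha. lra.
    + now apply sdiff_quotient.
  - intros e He'. destruct (Hl (e / 2)) as [d [Hd HH]]; [lra|]. exists d. split; [exact Hd|].
    intros a Ha. rewrite Gx. destruct (classic (a = x)) as [->|Hax].
    + rewrite Gx, Cmod_self. exact He'.
    + rewrite Gz by exact Hax. pose proof (Cmod_sub_pos _ _ Hax) as Hp.
      specialize (HH x a ltac:(rewrite Cmod_self; exact Hd) Ha).
      replace ((E a - E x) / (a - x) - l)%C with ((E a - E x - l * (a - x)) / (a - x))%C
        by (field; now apply Csub_neq).
      rewrite Cmod_div by now apply Csub_neq.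
      apply Rmult_lt_reg_r with (Cmod (a - x)); [exact Hp|].
      replace (Cmod (E a - E x - l * (a - x)) / Cmod (a - x) * Cmod (a - x))
        with (Cmod (E a - E x - l * (a - x))) by (field; lra).
      apply Rle_lt_trans with (e / 2 * Cmod (a - x)); [exact HH|]. apply Rmult_lt_compat_r; lra.
  - intros y _. set (z := (x + RtoC R0 * cis y)%C).
    assert (Hz : Cmod (z - x) = R0) by (apply circle_dist; lra).
    assert (Hzx : z <> x) by (intros E1; rewrite E1, Cmod_self in Hz; lra).
    rewrite Gz by exact Hzx. rewrite Cmod_div by now apply Csub_neq. rewrite Hz.
    apply Rmult_le_reg_r with R0; [exact HR|].
    replace (Cmod (E z - E x) / R0 * R0) with (Cmod (E z - E x)) by (field; lra).
    apply Rle_trans with (2 * B).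
    + eapply Rle_trans; [apply Cmod_sub_le|]. pose proof (HB z). pose proof (HB x). lra.
    + unfold R0. replace (eps * (2 * B / eps + 1)) with (2 * B + eps) by (field; lra). lra.
Qed.

Lemma zero_deriv_const (E : C -> C) : (forall z, strict_deriv E z 0%C) -> forall a b, E a = E b.
Proof.
  intros HE a b. symmetry. apply Cmod_sub_eq_0. apply Rle_antisym; [|apply Cmod_ge_0].
  apply Rle_plus_epsilon. intros eta Heta. rewrite Rplus_0_l.
  set (D := Cmod (b - a)). assert (HD : 0 <= D) by apply Cmod_ge_0.
  set (eps := eta / (D + 1)). assert (He : 0 < eps) by (apply Rdiv_lt_0_compat; lra).
  destruct (compact_uniform a D (fun u d => forall v, Cmod (v - u) < d -> Cmod (E v - E u) <= eps * Cmod (v - u)))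
    as [d [Hd HH]].
  - intros z _. destruct (HE z eps He) as [d [Hd K]]. exists (d / 2). split; [lra|].
    intros u Hu v Hv. replace (E v - E u)%C with (E v - E u - 0 * (v - u))%C by ring.
    apply K; [lra|]. pose proof (Cmod_sub_triangle v u z). lra.
  - intros u d d' Hd' Hdd K v Hv. apply K. lra.
  - destruct (INR_unbounded (D / d + 1)) as [N HN].
    assert (H0 : 0 <= D / d) by (apply Rdiv_le_0_compat; lra).
    set (h := / INR N).
    assert (HNh : INR N * h = 1) by (unfold h; field; lra).
    assert (Hh : 0 < h) by (apply Rinv_0_lt_compat; lra).
    set (u := fun k => (a + RtoC (INR k * h) * (b - a))%C).
    assert (Hstep : forall k, Cmod (u (S k) - u k) = h * D).
    { intros k. unfold u. rewrite S_INR.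
      replace (a + RtoC ((INR k + 1) * h) * (b - a) - (a + RtoC (INR k * h) * (b - a)))%C
        with (RtoC h * (b - a))%C.
      - rewrite Cmod_mult, Cmod_R, Rabs_right by lra. reflexivity.
      - rewrite Rmult_plus_distr_r, RtoC_plus, Rmult_1_l. ring. }
    assert (Hsmall : h * D < d).
    { apply Rmult_lt_reg_l with (INR N); [lra|]. rewrite <- Rmult_assoc, HNh.
      replace (1 * D) with (D / d * d) by (field; lra). apply Rmult_lt_compat_r; lra. }
    assert (G : forall k, (k <= N)%nat -> Cmod (E (u k) - E a) <= eps * (INR k * h * D)).
    { induction k as [|k IH]; intros Hk.
      - unfold u. simpl INR. rewrite Rmult_0_l. replace (a + RtoC 0 * (b - a))%C with a by ring.
        rewrite Cmod_self. lra.
      - specialize (IH ltac:(lia)).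
        assert (Hu : Cmod (u k - a) <= D).
        { unfold u. replace (a + RtoC (INR k * h) * (b - a) - a)%C with (RtoC (INR k * h) * (b - a))%C by ring.
          assert (K1 : 0 <= INR k * h) by (apply Rmult_le_pos; [apply pos_INR|lra]).
          assert (K2 : INR k * h <= 1).
          { rewrite <- HNh. apply Rmult_le_compat_r; [lra|]. apply le_INR. lia. }
          rewrite Cmod_mult, Cmod_R, Rabs_right by lra. fold D. nra. }
        specialize (HH (u k) Hu (u (S k)) ltac:(rewrite Hstep; exact Hsmall)).
        rewrite Hstep in HH. pose proof (Cmod_sub_triangle (E (u (S k))) (E (u k)) (E a)).
        rewrite S_INR. lra. }
    specialize (G N (Nat.le_refl N)). unfold u in G at 1. rewrite HNh in G.
    replace (a + RtoC 1 * (b - a))%C with b in G by ring.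
    eapply Rle_trans; [exact G|]. unfold eps.
    rewrite Rmult_1_l. apply Rle_trans with (eta / (D + 1) * (D + 1)).
    + apply Rmult_le_compat_l; [unfold eps in He|]; lra.
    + right. field. lra.
Qed.

Lemma liouville (E : C -> C) (B : R) : (forall z, sdiff E z) ->
  (forall z, Cmod (E z) <= B) -> forall a b, E a = E b.
Proof. intros H1 H2. apply zero_deriv_const. intros z. now apply (liouville_deriv E B). Qed.

(** * A value omitted by the ratio of two Cauchy transforms *)

Section Ratio.

Variable t : nat -> C.
Hypothesis t_inj : forall n m, t n = t m -> n = m.
Hypothesis t_ge_2 : forall n, 2 <= Cmod (t n).
Hypothesis t_inf : to_infinity t.

Let t_ge_1 : forall n, 1 <= Cmod (t n).
Proof. intros n. pose proof (t_ge_2 n). lra. Qed.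

Lemma outside_off (K : nat) (z : C) : outside t K z -> off t z.
Proof.
  intros H n E. specialize (H n). rewrite E, Cmod_self in H.
  pose proof (inv_pow_pos t t_ge_2 n K). lra.
Qed.

Lemma outside_mono (K K' : nat) (z : C) : (K <= K')%nat -> outside t K z -> outside t K' z.
Proof. intros HK H n. specialize (H n). pose proof (inv_pow_mono t t_ge_2 n K K' HK). lra. Qed.

(** As [|t n| >= 2], raising the exponent by one at least halves every disc, which leaves room for a
    neighbourhood of [z]; nodes far from [z] are more than 1 away. *)
Lemma near_outside (K : nat) (z : C) : outside t K z -> near z (outside t (K + 1)).
Proof.
  intros Hz. destruct (t_inf (Cmod z + 2)) as [N HN].
  destruct (bounded_below_finite (fun _ => True) (fun n => / Cmod (t n) ^ K / 2) N) as [k [Hk HkN]].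
  { intros n _. pose proof (inv_pow_pos t t_ge_2 n K). lra. }
  exists (Rmin k 1). split; [apply Rmin_glb_lt; lra|]. intros a Ha n.
  pose proof (Rmin_l k 1). pose proof (Rmin_r k 1).
  pose proof (inv_pow_S t t_ge_2 n K) as HS.
  destruct (le_lt_dec N n) as [Hn|Hn].
  - specialize (HN n Hn). pose proof (Cmod_sub_ge (t n) a) as Q1. rewrite Cmod_sub_sym in Q1.
    pose proof (Cmod_sub_ge a z) as Q2.
    pose proof (inv_pow_mono t t_ge_2 n 0 (K + 1) ltac:(lia)) as Q. simpl in Q. rewrite Rinv_1 in Q. lra.
  - specialize (HkN n Hn I). specialize (Hz n).
    pose proof (Cmod_sub_triangle z a (t n)) as T. rewrite (Cmod_sub_sym z a) in T. lra.
Qed.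

Definition pencil (c d : nat -> C) (a : C) (n : nat) : C := (c n + - a * d n)%C.

(** A substitute for Rouche's theorem. The ratio takes at [z] a value [a1] close to [a]. If a value
    [b] near [a1] were not taken near [z], then [ct d / ct (pencil c d b)] would have no pole in a
    small disc, yet its modulus [1 / |a1 - b|] at the centre would exceed its bound on the
    circle. *)
Lemma ratio_step (c d : nat -> C) (K : nat) (a : C) (q X : R) : adm t c -> adm t d ->
  (forall b, finite_set (fun w => zr t (pencil c d b) w /\ outside t (K + 1) w)) ->
  (exists z, outside t K z /\ X + 1 <= Cmod z /\ Cmod (ct t (pencil c d a) z) < q * Cmod (ct t d z)) ->
  exists a' q', 0 < q' /\ q' <= q / 2 /\ Cmod (a' - a) + q' <= q /\
    forall b, Cmod (b - a') <= q' ->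
      exists z, X <= Cmod z /\ outside t (K + 1) z /\ zr t (pencil c d b) z.
Proof.
  intros Hc Hd Hfin [z [Hzo [HzX Hz]]].
  pose proof (outside_off K z Hzo) as Hoff.
  assert (Hpen : forall b y, off t y -> ct t (pencil c d b) y = (ct t c y - b * ct t d y)%C).
  { intros b y Hy. unfold pencil. rewrite ct_plus_scal by auto. ring. }
  assert (Apen : forall b, adm t (pencil c d b)) by (intros b; now apply adm_plus_scal).
  assert (Hdz : 0 < Cmod (ct t d z)).
  { pose proof (Cmod_ge_0 (ct t (pencil c d a) z)). pose proof (Cmod_ge_0 (ct t d z)).
    destruct (Rle_lt_or_eq_dec _ _ H0) as [Hlt|Heq]; [exact Hlt|]. rewrite <- Heq in Hz. lra. }
  assert (Hdz0 : ct t d z <> 0%C) by now apply Cmod_pos_neq.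
  set (a1 := (ct t c z / ct t d z)%C).
  assert (Ea1 : Cmod (a1 - a) < q).
  { replace (a1 - a)%C with (ct t (pencil c d a) z / ct t d z)%C
      by (rewrite Hpen by exact Hoff; unfold a1; field; exact Hdz0).
    rewrite Cmod_div by exact Hdz0. apply Rmult_lt_reg_r with (Cmod (ct t d z)); [exact Hdz|].
    replace (Cmod (ct t (pencil c d a) z) / Cmod (ct t d z) * Cmod (ct t d z))
      with (Cmod (ct t (pencil c d a) z)) by (field; lra). exact Hz. }
  destruct (near_and _ _ _ (near_outside K z Hzo) (near_ball z 1 Rlt_0_1)) as [d0 [Hd0 Hnear]].
  destruct (Hfin a1) as [l Hl].
  (* The circle avoids the finitely many zeros of [pencil c d a1], so this member of the pencil has
     a positive minimum [m] on it. *)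
  destruct (avoid_list (map (fun w => Cmod (w - z)) l) 0 d0 Hd0) as [eps [Heps Hav]].
  assert (Hin : forall y, Cmod (y - z) <= eps -> outside t (K + 1) y /\ X <= Cmod y).
  { intros y Hy. destruct (Hnear y) as [N1 N2]; [lra|]. split; [exact N1|].
    pose proof (Cmod_sub_ge z y) as Q. rewrite Cmod_sub_sym in Q. lra. }
  assert (Hino : forall y, Cmod (y - z) <= eps -> off t y).
  { intros y Hy. apply (outside_off (K + 1)), Hin, Hy. }
  assert (Hsd : forall e y, adm t e -> Cmod (y - z) <= eps -> sdiff (ct t e) y).
  { intros e y He Hy. apply ct_sdiff; auto. intros n _. now apply Hino. }
  assert (Hcirc : forall x, Cmod (z + RtoC eps * cis x - z) = eps) by (intros; apply circle_dist; lra).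
  destruct (circle_bounded_below (ct t (pencil c d a1)) z eps) as [m [Hm Hmb]]; [lra| |].
  { intros x. set (y := (z + RtoC eps * cis x)%C).
    assert (Hy : Cmod (y - z) = eps) by apply Hcirc.
    split; [apply sdiff_cont, Hsd; [apply Apen|lra]|].
    intros E. apply Hav. rewrite <- Hy. apply (in_map (fun w => Cmod (w - z))). apply Hl.
    split; [apply zr_of_ct; auto; apply Hino; lra|apply Hin; lra]. }
  destruct (circle_bounded (ct t d) z eps) as [Bd [HBd HBdb]]; [lra| |].
  { intros x. apply sdiff_cont, Hsd; [exact Hd|]. rewrite Hcirc. lra. }
  (* The first bound keeps the new disc of parameters inside the old one. By the second, the member
     [b] stays above [3 m / 4] on the circle, so the quotient is at most [4 Bd / (3 m)] at the
     centre, while [1 / |a1 - b|] is at least [4 Bd / m]. *)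
  set (q' := Rmin ((q - Cmod (a1 - a)) / 2) (m / (4 * Bd))).
  assert (Hm4 : 0 < m / (4 * Bd)) by (apply Rdiv_lt_0_compat; lra).
  assert (Hq1 : q' <= (q - Cmod (a1 - a)) / 2) by apply Rmin_l.
  assert (Hq2 : q' <= m / (4 * Bd)) by apply Rmin_r.
  assert (Hq0 : 0 < q') by (apply Rmin_glb_lt; lra).
  pose proof (Cmod_ge_0 (a1 - a)).
  exists a1, q'. split; [exact Hq0|split; [lra|split; [lra|]]]. intros b Hb.
  apply NNPP. intros Hno.
  assert (Hnz : forall y, Cmod (y - z) <= eps -> ct t (pencil c d b) y <> 0%C).
  { intros y Hy E. apply Hno. exists y. destruct (Hin y Hy) as [I1 I2].
    split; [exact I2|split; [exact I1|]]. apply zr_of_ct; auto. }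
  assert (Hzz : Cmod (z - z) <= eps) by (rewrite Cmod_self; lra).
  assert (Ez : ct t (pencil c d b) z = ((a1 - b) * ct t d z)%C).
  { rewrite Hpen by exact Hoff. unfold a1. field. exact Hdz0. }
  assert (Hab : 0 < Cmod (b - a1)).
  { apply Cmod_sub_pos. intros E. apply (Hnz z Hzz). rewrite Ez, E. ring. }
  assert (HqB : q' * Bd <= m / 4).
  { replace (m / 4) with (m / (4 * Bd) * Bd) by (field; lra). apply Rmult_le_compat_r; lra. }
  assert (CB : Cmod (ct t d z / ct t (pencil c d b) z) <= Bd / (3 / 4 * m)).
  { assert (Hq : forall y, Cmod (y - z) <= eps -> sdiff (fun y => ct t d y / ct t (pencil c d b) y)%C y).
    { intros y Hy. apply sdiff_div; [now apply Hsd|now apply Hsd|now apply Hnz]. }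
    apply (center_bound (fun y => ct t d y / ct t (pencil c d b) y)%C z eps); [lra| | |].
    - intros y Hy. apply Hq. lra.
    - apply sdiff_cont, Hq, Hzz.
    - intros x Hx. specialize (Hmb x Hx). specialize (HBdb x Hx).
      set (y := (z + RtoC eps * cis x)%C) in *.
      assert (Hy : Cmod (y - z) <= eps) by (unfold y; rewrite Hcirc; lra).
      pose proof (Hnz y Hy) as Hny. rewrite Cmod_div by exact Hny.
      assert (Hlow : 3 / 4 * m <= Cmod (ct t (pencil c d b) y)).
      { assert (E : ct t (pencil c d a1) y = (ct t (pencil c d b) y + (b - a1) * ct t d y)%C).
        { rewrite !Hpen by now apply Hino. ring. }
        rewrite E in Hmb.
        pose proof (Cmod_triangle (ct t (pencil c d b) y) ((b - a1) * ct t d y)) as T.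
        rewrite Cmod_mult in T.
        assert (Cmod (b - a1) * Cmod (ct t d y) <= q' * Bd)
          by (apply Rmult_le_compat; try apply Cmod_ge_0; assumption). lra. }
      apply Rmult_le_compat; [apply Cmod_ge_0| |exact HBdb|].
      + left. apply Rinv_0_lt_compat. lra.
      + apply Rinv_le_contravar; lra. }
  rewrite Ez in CB. rewrite Cmod_div, Cmod_mult in CB.
  2:{ apply Cmult_neq_0; [|exact Hdz0]. apply Csub_neq. intros E. rewrite E, Cmod_self in Hab. lra. }
  rewrite Cmod_sub_sym in CB.
  replace (Cmod (ct t d z) / (Cmod (b - a1) * Cmod (ct t d z))) with (/ Cmod (b - a1)) in CB by (field; lra).
  assert (HF : 1 <= Bd / (3 / 4 * m) * Cmod (b - a1)).
  { rewrite <- (Rinv_l (Cmod (b - a1))) by lra. apply Rmult_le_compat_r; lra. }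
  assert (HF2 : Bd / (3 / 4 * m) * Cmod (b - a1) <= Bd / (3 / 4 * m) * (m / (4 * Bd))).
  { apply Rmult_le_compat_l; [apply Rdiv_le_0_compat; lra|lra]. }
  replace (Bd / (3 / 4 * m) * (m / (4 * Bd))) with (1 / 3) in HF2 by (field; lra). lra.
Qed.

(* If every value were nearly taken arbitrarily far out, nested discs of
   parameters would single out one whose pencil member has zeros tending to
   infinity. *)
Lemma omitted_value (c d : nat -> C) (K : nat) : adm t c -> adm t d ->
  (forall b, finite_set (fun w => zr t (pencil c d b) w /\ outside t (K + 1) w)) ->
  exists a q X, 0 < q /\ forall z, outside t K z -> X <= Cmod z ->
    q * Cmod (ct t d z) <= Cmod (ct t (pencil c d a) z).
Proof.
  intros Hc Hd Hfin. apply NNPP. intros Hno.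
  assert (Hstep : forall S : C * {q : R | 0 < q} * nat, exists S' : C * {q : R | 0 < q} * nat,
    snd S' = Datatypes.S (snd S) /\
    proj1_sig (snd (fst S')) <= proj1_sig (snd (fst S)) / 2 /\
    Cmod (fst (fst S') - fst (fst S)) + proj1_sig (snd (fst S')) <= proj1_sig (snd (fst S)) /\
    forall b, Cmod (b - fst (fst S')) <= proj1_sig (snd (fst S')) ->
      exists z, INR (snd S) <= Cmod z /\ outside t (K + 1) z /\ zr t (pencil c d b) z).
  { intros [[a [q Hq]] i]. simpl.
    destruct (ratio_step c d K a q (INR i) Hc Hd Hfin) as [a' [q' [H1 [H2 [H3 H4]]]]].
    - apply NNPP. intros Hn. apply Hno. exists a, q, (INR i + 1). split; [exact Hq|].
      intros z Hz HzX. apply Rnot_lt_le. intros Hlt. apply Hn. now exists z.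
    - exists (a', exist _ q' H1, Datatypes.S i). simpl. auto. }
  destruct (choice _ Hstep) as [next Hnext].
  set (st := fix st i := match i with O => (RtoC 0, exist (fun q => 0 < q) 1 Rlt_0_1, O)
                         | Datatypes.S i => next (st i) end).
  set (a := fun i => fst (fst (st i))). set (q := fun i => proj1_sig (snd (fst (st i)))).
  assert (Hi : forall i, snd (st i) = i).
  { induction i as [|i IH]; [reflexivity|]. simpl. destruct (Hnext (st i)) as [E _]. now rewrite E, IH. }
  assert (Hq0 : forall i, 0 < q i) by (intros i; unfold q; apply (proj2_sig (snd (fst (st i))))).
  assert (Hq2 : forall i, q (S i) <= q i / 2) by (intros i; apply (Hnext (st i))).
  assert (Ha : forall i, Cmod (a (S i) - a i) + q (S i) <= q i) by (intros i; apply (Hnext (st i))).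
  assert (Hz : forall i b, Cmod (b - a (S i)) <= q (S i) ->
    exists z, INR i <= Cmod z /\ outside t (K + 1) z /\ zr t (pencil c d b) z).
  { intros i b Hb. destruct (Hnext (st i)) as [_ [_ [_ H]]]. rewrite Hi in H. now apply H. }
  assert (Hqp : forall i, q i <= (1/2) ^ i).
  { induction i as [|i IH]; [unfold q; simpl; lra|]. specialize (Hq2 i). simpl. lra. }
  destruct (telescoping_limit a 1) as [b Hb].
  { intros i. specialize (Ha i). specialize (Hqp i). specialize (Hq0 (S i)). lra. }
  assert (Hnest : forall i j, Cmod (a (i + j)%nat - a i) + q (i + j)%nat <= q i).
  { intros i j. induction j as [|j IH]; [rewrite Nat.add_0_r, Cmod_self; lra|].
    rewrite Nat.add_succ_r. specialize (Ha (i + j)%nat).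
    pose proof (Cmod_sub_triangle (a (S (i + j))) (a (i + j)%nat) (a i)). lra. }
  assert (Hba : forall i, Cmod (b - a i) <= q i).
  { intros i. apply Rle_plus_epsilon. intros eps He.
    destruct (pow_lt_1_zero (1/2)) with (y := eps / 2) as [N HN]; [rewrite Rabs_right; lra|lra|].
    specialize (HN (i + N)%nat ltac:(lia)). rewrite Rabs_right in HN by (apply Rle_ge, pow_le; lra).
    specialize (Hb (i + N)%nat). specialize (Hnest i N). specialize (Hq0 (i + N)%nat).
    pose proof (Cmod_sub_triangle b (a (i + N)%nat) (a i)). lra. }
  destruct (finite_C_bound _ (Hfin b)) as [X HX].
  destruct (INR_unbounded X) as [i Hii].
  destruct (Hz i b (Hba (S i))) as [z [Z1 [Z2 Z3]]].
  assert (Cmod z < X) by (apply HX; split; assumption). lra.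
Qed.

End Ratio.

(** * Bounded ratios of Cauchy transforms have a limit at infinity *)

Lemma ct_sdiff_near (t c : nat -> C) (z : C) :
  (forall n, 1 <= Cmod (t n)) -> to_infinity t -> adm t c ->
  (forall n, c n <> 0%C -> z <> t n) ->
  near z (fun a => sdiff (ct t c) a /\ asum (fun n => c n / (a - t n))%C).
Proof.
  intros H1 Ht Hc Hz. destruct (uniformly_off t c z H1 Ht Hz) as [k [Hk H]].
  exists k. split; [exact Hk|]. intros a Ha.
  assert (Hoff : forall n, c n <> 0%C -> a <> t n).
  { intros n Hn ->. specialize (H n Hn). specialize (H1 n). rewrite Cmod_sub_sym in H. nra. }
  split; [now apply ct_sdiff|now apply ct_asum].
Qed.

Lemma bounded_eventually (f g : nat -> R) (N : nat) (K : R) : (forall n, 0 < g n) ->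
  (forall n, (N <= n)%nat -> f n <= K * g n) -> exists K', 0 < K' /\ forall n, f n <= K' * g n.
Proof.
  intros Hg H.
  assert (G : exists K1, forall n, (n < N)%nat -> f n <= K1 * g n).
  { clear H. induction N as [|N [K1 IH]]; [exists 0; intros; lia|].
    exists (Rmax K1 (f N / g N)). intros n Hn. specialize (Hg n).
    destruct (Nat.eq_dec n N) as [->|Hne].
    - replace (f N) with (f N / g N * g N) at 1 by (field; lra).
      apply Rmult_le_compat_r; [lra|apply Rmax_r].
    - eapply Rle_trans; [apply IH; lia|]. apply Rmult_le_compat_r; [lra|apply Rmax_l]. }
  destruct G as [K1 HK1]. exists (Rmax 1 (Rmax K K1)).
  pose proof (Rmax_l 1 (Rmax K K1)). split; [lra|]. intros n. specialize (Hg n).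
  destruct (le_lt_dec N n) as [Hn|Hn].
  - eapply Rle_trans; [apply H, Hn|]. apply Rmult_le_compat_r; [lra|].
    eapply Rle_trans; [apply Rmax_l|apply Rmax_r].
  - eapply Rle_trans; [apply HK1, Hn|]. apply Rmult_le_compat_r; [lra|].
    eapply Rle_trans; [apply Rmax_r|apply Rmax_r].
Qed.

Section Limit.

Variable t : nat -> C.
Hypothesis t_inj : forall n m, t n = t m -> n = m.
Hypothesis t_ge_2 : forall n, 2 <= Cmod (t n).
Hypothesis t_inf : to_infinity t.

Let t_ge_1 : forall n, 1 <= Cmod (t n).
Proof. intros n. pose proof (t_ge_2 n). lra. Qed.

Variables (rho : nat -> R) (M0 : nat).
Hypothesis rho_ge : forall n, / Cmod (t n) ^ M0 <= rho n.
Hypothesis rho_le_1 : forall n, rho n <= 1.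
Hypothesis rho_sep : forall n m, n <> m -> rho n + rho m <= Cmod (t n - t m).

Let sig (K n : nat) : R := / Cmod (t n) ^ K.

Let sig_pos (K n : nat) : 0 < sig K n.
Proof. apply (inv_pow_pos t t_ge_2). Qed.

Let sig_half (K n : nat) : sig (K + 1) n <= sig K n / 2.
Proof. apply (inv_pow_S t t_ge_2). Qed.

Let sig_mono (K K' n : nat) : (K <= K')%nat -> sig K' n <= sig K n.
Proof. apply (inv_pow_mono t t_ge_2). Qed.

Lemma sig_rho (K n : nat) : (M0 + 2 <= K)%nat -> 4 * sig K n <= rho n.
Proof.
  intros HK. pose proof (sig_mono (M0 + 1 + 1) K n ltac:(lia)).
  pose proof (sig_half (M0 + 1) n). pose proof (sig_half M0 n). pose proof (rho_ge n).
  unfold sig in *. lra.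
Qed.

Lemma ring_outside (K n : nat) (z : C) : (M0 + 2 <= K)%nat ->
  sig K n <= Cmod (z - t n) <= rho n -> outside t K z.
Proof.
  intros HK [H1 H2] k. destruct (Nat.eq_dec k n) as [->|Hkn]; [exact H1|].
  apply (in_disc_outside_others t t_ge_2 rho M0 rho_ge rho_sep n); auto. lia.
Qed.

Lemma disc_off_but (n : nat) (z : C) : Cmod (z - t n) <= rho n -> off_but t n z.
Proof.
  intros Hz i Hi ->. pose proof (other_disc t rho rho_sep n i (t i) Hi Hz) as Q.
  rewrite Cmod_self in Q. pose proof (sig_pos M0 i). pose proof (rho_ge i). unfold sig in *. lra.
Qed.

Lemma punctured_off (z : C) : exists d, 0 < d /\ forall a, 0 < Cmod (a - z) < d -> off t a.
Proof.
  destruct (off_or_t t z) as [Ho|[m ->]].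
  - destruct (near_off t t_ge_1 t_inf z Ho) as [d [Hd H]]. exists d. split; [exact Hd|].
    intros a Ha. apply H. lra.
  - destruct (near_off_but t t_ge_1 t_inf m _ (t_off_but t t_inj m)) as [d [Hd H]].
    exists d. split; [exact Hd|]. intros a Ha. destruct (off_cases t m a); [apply H; lra|assumption|].
    subst a. rewrite Cmod_self in Ha. lra.
Qed.

Lemma exists_off_but (z : C) : exists m, off_but t m z.
Proof.
  destruct (off_or_t t z) as [Ho|[m ->]]; [exists 0%nat; now apply off_off_but|].
  exists m. now apply t_off_but.
Qed.

Variables (e d : nat -> C) (K3 : nat) (X B : R).
(** The residues will be of size [|t n| ^ -K]. Of this exponent [2 M0 + 4] is used for summability,
    and [K3 + 2] is left for estimating the principal parts outside the discs of exponent [K3]. *)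
Let K := (K3 + 2 * M0 + 6)%nat.
Hypothesis K3_ge : (M0 + 2 <= K3)%nat.
Hypothesis e_adm : adm t e.
Hypothesis d_adm : adm t d.
Hypothesis zeros_close : forall w, zr t e w -> exists n, Cmod (w - t n) < / Cmod (t n) ^ (K + 2).
Hypothesis zeros_simple : forall n w e' y, is_div t w e e' -> zr t e' y ->
  Cmod (w - t n) < rho n -> Cmod (y - t n) < rho n -> False.
Hypothesis B_pos : 0 < B.
Hypothesis bounded : forall z, outside t K z -> X <= Cmod z -> Cmod (ct t d z) <= B * Cmod (ct t e z).

Lemma t_summable' : ex_series (fun n => / Cmod (t n) ^ (2 * M0 + 4)).
Proof. now apply (t_summable t t_ge_2 rho). Qed.

(** A zero of [e] near [t n] is unique and simple, so the quotient sequence has no zero in the disc,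
    and [rct d / rct e'] at [p n] is the residue of [ct d / ct e]. The poles at [t n] are removed
    from both transforms because [p n] may be [t n] itself. *)
Lemma ratio_poles : exists (p : nat -> C) (e' : nat -> nat -> C) (res : nat -> C),
  (forall n, Cmod (p n - t n) < sig (K + 2) n) /\
  (forall w n, zr t e w -> Cmod (w - t n) < rho n -> w = p n) /\
  (forall n, zr t e (p n) -> is_div t (p n) e (e' n) /\
     (forall z, Cmod (z - t n) < rho n -> rct t n (e' n) z <> 0%C) /\
     res n = (rct t n d (p n) / rct t n (e' n) (p n))%C) /\
  (forall n, ~ zr t e (p n) -> res n = 0%C).
Proof.
  assert (H : forall n, exists q : C * (nat -> C) * C, let '(p, e', res) := q in
    Cmod (p - t n) < sig (K + 2) n /\
    (forall w, zr t e w -> Cmod (w - t n) < rho n -> w = p) /\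
    (zr t e p -> is_div t p e e' /\ (forall z, Cmod (z - t n) < rho n -> rct t n e' z <> 0%C) /\
      res = (rct t n d p / rct t n e' p)%C) /\
    (~ zr t e p -> res = 0%C)).
  { intros n. destruct (classic (exists w, zr t e w /\ Cmod (w - t n) < rho n)) as [[w [Hw1 Hw2]]|Hno].
    - pose proof Hw1 as [e' He'].
      exists (w, e', (rct t n d w / rct t n e' w)%C).
      split; [|split; [|split]].
      + destruct (zeros_close w Hw1) as [k Hk].
        assert (k = n); [|subst; exact Hk].
        apply (disc_unique t rho rho_sep k n w); [|exact Hw2].
        pose proof (sig_rho (K + 2) k ltac:(unfold K; lia)). pose proof (sig_pos (K + 2) k).
        unfold sig in *. lra.
      + intros y Hy1 Hy2. apply NNPP. intros Hyw.
        apply (zeros_simple n w e' y He'); [|exact Hw2|exact Hy2].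
        now apply (zr_div t w y e e' (not_eq_sym Hyw)).
      + intros _. split; [exact He'|split; [|reflexivity]]. intros z Hz E.
        apply (zeros_simple n w e' z He'); [|exact Hw2|exact Hz].
        apply (rct_zero t t_inj t_ge_1 t_inf n e' z); [now apply (is_div_adm t t_ge_1 w e)| |exact E].
        apply disc_off_but. lra.
      + contradiction.
    (* Without a zero near [t n] these are placeholders: the point [t n] with residue 0. *)
    - exists (t n, e, RtoC 0). split; [rewrite Cmod_self; apply sig_pos|split; [|split; [|reflexivity]]].
      + intros w Hw1 Hw2. exfalso. apply Hno. now exists w.
      + intros Hz. exfalso. apply Hno. exists (t n). split; [exact Hz|].
        rewrite Cmod_self. pose proof (sig_rho K n ltac:(unfold K; lia)). pose proof (sig_pos K n). lra. }
  destruct (choice _ H) as [q Hq].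
  exists (fun n => fst (fst (q n))), (fun n => snd (fst (q n))), (fun n => snd (q n)).
  split; [|split; [|split]].
  - intros n. specialize (Hq n). destruct (q n) as [[p e'] res]. apply Hq.
  - intros w n. specialize (Hq n). destruct (q n) as [[p e'] res]. simpl. apply Hq.
  - intros n. specialize (Hq n). destruct (q n) as [[p e'] res]. simpl. apply Hq.
  - intros n. specialize (Hq n). destruct (q n) as [[p e'] res]. simpl. apply Hq.
Qed.

(* The residues are tiny since the ratio is bounded on small circles around
   its poles; subtracting the principal parts leaves a bounded entire function. *)
Lemma ratio_limit : exists kappa, forall eps, 0 < eps -> exists X', forall z,
  outside t K3 z -> X' <= Cmod z -> Cmod (ct t d z - kappa * ct t e z) <= eps * Cmod (ct t e z).
Proof.
  destruct ratio_poles as [p [e' [res [P1 [P2 [P3 P4]]]]]].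
  assert (Hsig : forall n, sig (K + 2) n <= sig K n / 4).
  { intros n. pose proof (sig_half (K + 1) n). pose proof (sig_half K n).
    replace (K + 1 + 1)%nat with (K + 2)%nat in * by lia. lra. }
  assert (Ae' : forall n, zr t e (p n) -> adm t (e' n)).
  { intros n Hn. apply (is_div_adm t t_ge_1 (p n) e), P3, Hn. }
  assert (Hp_rho : forall n, Cmod (p n - t n) < rho n).
  { intros n. specialize (P1 n). pose proof (sig_rho (K + 2) n ltac:(unfold K; lia)).
    pose proof (sig_pos (K + 2) n). lra. }
  (* [rct d / rct e'] extends [(z - p n) * ct d / ct e], which is at most [2 B * sig K n] on the
     circle of radius [2 * sig K n] around [p n]. For small [n] the circle may reach below [X];
     those indices go into the constant. *)
  assert (Hres : exists Rr, 0 < Rr /\ forall n, Cmod (res n) <= Rr * sig K n).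
  { destruct (t_inf (X + 2)) as [N HN].
    apply (bounded_eventually _ _ N (2 * B)); [apply sig_pos|]. intros n Hn. specialize (HN n Hn).
    destruct (classic (zr t e (p n))) as [Hz|Hz].
    2:{ rewrite (P4 n Hz), Cmod_0. apply Rmult_le_pos; [lra|left; apply sig_pos]. }
    destruct (P3 n Hz) as [D1 [D2 D3]]. rewrite D3. specialize (P1 n). specialize (Hsig n).
    pose proof (sig_pos K n) as Hs. pose proof (sig_rho K n ltac:(unfold K; lia)) as Hr.
    assert (Hin : forall z, Cmod (z - p n) <= 2 * sig K n -> Cmod (z - t n) < rho n).
    { intros z Hzp. pose proof (Cmod_sub_triangle z (p n) (t n)). lra. }
    assert (Hsd : forall z, Cmod (z - p n) <= 2 * sig K n ->
      sdiff (fun z => rct t n d z / rct t n (e' n) z)%C z).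
    { intros z Hzp. specialize (Hin z Hzp).
      apply sdiff_div; [| |now apply D2]; apply rct_sdiff; auto; apply disc_off_but; lra. }
    apply (center_bound (fun z => rct t n d z / rct t n (e' n) z)%C (p n) (2 * sig K n)); [lra| | |].
    - intros z Hzp. apply Hsd. lra.
    - apply sdiff_cont, Hsd. rewrite Cmod_self. lra.
    - intros x _. set (z := (p n + RtoC (2 * sig K n) * cis x)%C).
      assert (Hzp : Cmod (z - p n) = 2 * sig K n) by (apply circle_dist; lra).
      specialize (Hin z ltac:(lra)).
      assert (Hzt : sig K n <= Cmod (z - t n)).
      { pose proof (Cmod_sub_triangle z (t n) (p n)) as T. rewrite (Cmod_sub_sym (t n)) in T. lra. }
      assert (Ho : outside t K z) by (apply (ring_outside K n); [unfold K; lia|lra]).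
      pose proof (outside_off t t_ge_2 K z Ho) as Hoff.
      assert (HzX : X <= Cmod z).
      { pose proof (Cmod_sub_ge (t n) z) as T. rewrite Cmod_sub_sym in T. pose proof (rho_le_1 n). lra. }
      pose proof (bounded z Ho HzX) as Hb. specialize (D2 z Hin).
      rewrite (ct_div t t_ge_1 t_inf (p n) e (e' n) z D1 Hoff), Cmod_mult, Hzp in Hb.
      rewrite Cmod_div by exact D2.
      pose proof (Cmod_pos _ D2) as Hpos.
      rewrite !(rct_ct t t_ge_1 t_inf) in * by auto. rewrite !Cmod_mult in *.
      assert (Hzt0 : 0 < Cmod (z - t n)) by lra.
      assert (He0 : 0 < Cmod (ct t (e' n) z)) by nra.
      apply Rmult_le_reg_r with (Cmod (z - t n) * Cmod (ct t (e' n) z)); [exact Hpos|].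
      replace (Cmod (z - t n) * Cmod (ct t d z) / (Cmod (z - t n) * Cmod (ct t (e' n) z)) *
        (Cmod (z - t n) * Cmod (ct t (e' n) z))) with (Cmod (z - t n) * Cmod (ct t d z)) by (field; lra).
      replace (2 * B * sig K n * (Cmod (z - t n) * Cmod (ct t (e' n) z)))
        with (Cmod (z - t n) * (B * (2 * sig K n * Cmod (ct t (e' n) z)))) by ring.
      apply Rmult_le_compat_l; lra. }
  destruct Hres as [Rr [HRr Hres]].
  assert (Hp1 : forall n, 1 <= Cmod (p n)).
  { intros n. specialize (Hp_rho n). pose proof (rho_le_1 n). pose proof (t_ge_2 n).
    pose proof (Cmod_sub_ge (t n) (p n)) as T. rewrite Cmod_sub_sym in T. lra. }
  assert (Hpinf : to_infinity p).
  { intros Z. destruct (t_inf (Z + 1)) as [N HN]. exists N. intros n Hn. specialize (HN n Hn).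
    specialize (Hp_rho n). pose proof (rho_le_1 n).
    pose proof (Cmod_sub_ge (t n) (p n)) as T. rewrite Cmod_sub_sym in T. lra. }
  assert (HS : ex_series (fun n => Cmod (res n) * Cmod (t n) ^ (K3 + 2))).
  { apply (ex_series_bound _ (fun n => Rr * / Cmod (t n) ^ (2 * M0 + 4))).
    - intros n. pose proof (pow_t_pos t t_ge_2 n (K3 + 2)). pose proof (pow_t_pos t t_ge_2 n (2 * M0 + 4)).
      split; [apply Rmult_le_pos; [apply Cmod_ge_0|lra]|].
      specialize (Hres n). unfold sig in Hres.
      replace K with ((K3 + 2) + (2 * M0 + 4))%nat in Hres by (unfold K; lia).
      rewrite pow_add, Rinv_mult in Hres.
      apply Rle_trans with ((Rr * (/ Cmod (t n) ^ (K3 + 2) * / Cmod (t n) ^ (2 * M0 + 4))) * Cmod (t n) ^ (K3 + 2)).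
      + apply Rmult_le_compat_r; lra.
      + right. field. lra.
    - apply ex_series_Rscal, t_summable'. }
  set (S0 := Series (fun n => Cmod (res n) * Cmod (t n) ^ (K3 + 2))).
  assert (HS0 : 0 <= S0).
  { apply Series_ge_0; [|exact HS]. intros n. apply Rmult_le_pos; [apply Cmod_ge_0|].
    left. apply pow_t_pos, t_ge_2. }
  assert (Ares : adm p res).
  { apply (ex_series_bound _ (fun n => Cmod (res n) * Cmod (t n) ^ (K3 + 2))); [|exact HS].
    intros n. specialize (Hp1 n). split; [apply Rdiv_le_0_compat; [apply Cmod_ge_0|lra]|].
    apply Rmult_le_compat_l; [apply Cmod_ge_0|].
    apply Rle_trans with 1; [rewrite <- Rinv_1; apply Rinv_le_contravar; lra|].
    apply pow_R1_Rle, t_ge_1. }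
  (* If [|t n| <= |z| / 4], then [p n] is at distance at least [|z| / 4] from [z]. Otherwise
     [1 / |z - p n| <= 2 |t n| ^ K3], and the spare powers of [|t n| > |z| / 4] bring in the factor
     [1 / |z|]. *)
  assert (HPb : forall z, outside t K3 z -> 1 <= Cmod z ->
     (forall n, z <> p n) /\ Cmod (ct p res z) <= 8 / Cmod z * S0).
  { intros z Hz Hz1.
    assert (Hzp : forall n, / Cmod (t n) ^ K3 / 2 <= Cmod (z - p n)).
    { intros n. specialize (Hz n). specialize (P1 n). specialize (Hsig n).
      pose proof (sig_mono K3 K n ltac:(unfold K; lia)). pose proof (sig_pos K n). unfold sig in *.
      pose proof (Cmod_sub_triangle z (p n) (t n)). lra. }
    split.
    - intros n E. specialize (Hzp n). rewrite E, Cmod_self in Hzp.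
      pose proof (inv_pow_pos t t_ge_2 n K3). lra.
    - unfold S0. rewrite <- Series_scal_l. apply csum_bound; [|now apply ex_series_Rscal].
      intros n. specialize (Hzp n). pose proof (inv_pow_pos t t_ge_2 n K3) as Hi.
      pose proof (pow_t_pos t t_ge_2 n K3) as Hpw. pose proof (t_ge_2 n) as Ht2.
      assert (Hzp0 : 0 < Cmod (z - p n)) by lra.
      rewrite Cmod_div by (now apply Cmod_pos_neq).
      replace (8 / Cmod z * (Cmod (res n) * Cmod (t n) ^ (K3 + 2)))
        with (Cmod (res n) * (8 / Cmod z * Cmod (t n) ^ (K3 + 2))) by ring.
      apply Rmult_le_compat_l; [apply Cmod_ge_0|].
      apply Rmult_le_reg_r with (Cmod (z - p n)); [exact Hzp0|]. rewrite Rinv_l by lra.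
      apply Rmult_le_reg_l with (Cmod z); [lra|].
      replace (Cmod z * (8 / Cmod z * Cmod (t n) ^ (K3 + 2) * Cmod (z - p n)))
        with (8 * Cmod (t n) ^ (K3 + 2) * Cmod (z - p n)) by (field; lra).
      rewrite pow_add. simpl (Cmod (t n) ^ 2). rewrite Rmult_1_r, Rmult_1_r.
      specialize (Hp_rho n). pose proof (rho_le_1 n).
      assert (Hpw1 : 1 <= Cmod (t n) ^ K3) by (apply pow_R1_Rle, t_ge_1).
      set (u := Cmod (t n)) in *. set (v := u ^ K3) in *.
      assert (Hvu : 1 <= v * (u * u)) by nra.
      destruct (Rle_lt_dec u (Cmod z / 4)) as [Hle|Hlt].
      + assert (Q : Cmod z / 4 <= Cmod (z - p n)).
        { pose proof (Cmod_sub_ge z (p n)). pose proof (Cmod_sub_ge (p n) (t n)). unfold u in *. lra. }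
        nra.
      + assert (Q : 1 <= 2 * v * Cmod (z - p n)).
        { replace 1 with (2 * v * (/ v / 2)) by (field; lra). apply Rmult_le_compat_l; lra. }
        assert (0 <= 2 * v * Cmod (z - p n) - 1) by lra. nra. }
  set (E0 := fun z => (ct t d z / ct t e z - ct p res z)%C).
  assert (Hnz_out : forall z, outside t K3 z -> ct t e z <> 0%C).
  { intros z Hz E. pose proof (outside_off t t_ge_2 K3 z Hz) as Ho.
    destruct (zeros_close z (zr_of_ct t t_ge_1 t_inf e z e_adm Ho E)) as [n Hn]. specialize (Hz n).
    pose proof (sig_mono K3 (K + 2) n ltac:(unfold K; lia)). unfold sig in *. lra. }
  destruct (removable_glue E0) as [E [HE1 HE2]].
  { intros z. destruct (punctured_off z) as [d1 [Hd1 Hpo]].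
    destruct (classic (zr t e z)) as [Hzz|Hzz].
    - destruct (zeros_close z Hzz) as [n Hn].
      assert (Hzr : Cmod (z - t n) < rho n).
      { pose proof (sig_rho (K + 2) n ltac:(unfold K; lia)). pose proof (sig_pos (K + 2) n).
        unfold sig in *. lra. }
      assert (Ez : z = p n) by now apply P2. subst z.
      destruct (P3 n Hzz) as [D1 [D2 D3]]. specialize (Ae' n Hzz).
      assert (Hob : off_but t n (p n)) by (apply disc_off_but; lra).
      (* Subtracting the residue times [e'] from [d] creates a zero at [p n]; dividing it out leaves
         the regular part of [ct d / ct e] at the pole. *)
      set (b := fun k => (d k + - res n * e' n k)%C).
      assert (Ab : adm t b) by now apply adm_plus_scal.
      assert (Hbz : zr t b (p n)).
      { apply (rct_zero t t_inj t_ge_1 t_inf n b (p n) Ab Hob). unfold b.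
        rewrite (rct_plus_scal t t_ge_1 t_inf) by assumption. rewrite D3. field. now apply D2. }
      destruct Hbz as [b' Hb']. pose proof (is_div_adm t t_ge_1 (p n) b b' Hb') as Ab'.
      set (res' := zero_at n res).
      assert (Ares' : adm p res') by now apply (adm_zero_at p Hp1).
      assert (Hoff' : forall k, res' k <> 0%C -> p n <> p k).
      { intros k Hk E. assert (k <> n) by (intros ->; unfold res' in Hk; now rewrite zero_at_eq in Hk).
        apply H. apply (disc_unique t rho rho_sep k n (p n)); [rewrite E|]; apply Hp_rho. }
      exists (fun a => rct t n b' a / rct t n (e' n) a - ct p res' a)%C.
      pose proof (ct_sdiff_near p res' (p n) Hp1 Hpinf Ares' Hoff') as N1.
      pose proof (near_off_but t t_ge_1 t_inf n (p n) Hob) as N2.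
      assert (Hball : 0 < rho n - Cmod (p n - t n)) by lra.
      pose proof (near_ball (p n) _ Hball) as N3.
      pose proof (near_and _ _ _ N1 (near_and _ _ _ N2 N3)) as N4.
      assert (Hin : forall a, Cmod (a - p n) < rho n - Cmod (p n - t n) -> Cmod (a - t n) < rho n).
      { intros a Ha. pose proof (Cmod_sub_triangle a (p n) (t n)). lra. }
      split.
      + revert N4. apply near_imp. intros a [[S1 S2] [S3 S4]].
        apply sdiff_minus; [|exact S1].
        apply sdiff_div; [| |apply D2, Hin, S4]; apply rct_sdiff; auto.
      + destruct N4 as [d2 [Hd2 N4]]. exists (Rmin d1 d2). split; [now apply Rmin_glb_lt|].
        intros a [Ha0 Ha]. pose proof (Rmin_l d1 d2). pose proof (Rmin_r d1 d2).
        destruct (N4 a ltac:(lra)) as [[S1 S2] [S3 S4]].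
        assert (Ho : off t a) by (apply Hpo; lra).
        assert (Hap : (a - p n)%C <> 0%C) by (now apply Cmod_pos_neq).
        assert (Hat : (a - t n)%C <> 0%C) by (apply Csub_neq, Ho).
        assert (Hr0 : rct t n (e' n) a <> 0%C) by (apply D2, Hin, S4).
        assert (Q1 : rct t n d a = ((a - p n) * rct t n b' a + res n * rct t n (e' n) a)%C).
        { rewrite <- (rct_div t t_ge_1 t_inf n (p n) b b' a Ab Hb' S3). unfold b.
          rewrite (rct_plus_scal t t_ge_1 t_inf) by assumption. ring. }
        rewrite (rct_ct t t_ge_1 t_inf n d a d_adm Ho) in Q1.
        assert (Q2 : ct t e a = ((a - p n) * ct t (e' n) a)%C) by (now apply (ct_div t t_ge_1 t_inf)).
        rewrite (rct_ct t t_ge_1 t_inf n (e' n) a Ae' Ho) in *.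
        assert (He'0 : ct t (e' n) a <> 0%C).
        { intros E. apply Hr0. rewrite E. ring. }
        assert (Hsplit : ct p res a = (res n / (a - p n) + ct p res' a)%C).
        { unfold ct.
          assert (EZ : forall k, zero_at n (fun k => res k / (a - p k))%C k = (res' k / (a - p k))%C).
          { intros k. unfold res', zero_at. destruct (Nat.eq_dec k n); [now rewrite Cdiv_0_l|reflexivity]. }
          rewrite (csum_split n (fun k => res k / (a - p k))%C).
          - now rewrite (csum_ext _ _ EZ).
          - apply (asum_change n). apply (asum_ext (fun k => res' k / (a - p k))%C); [|exact S2].
            intros k. now rewrite EZ. }
        unfold E0. rewrite Hsplit, Q2.
        replace (ct t d a) with (((a - p n) * rct t n b' a + res n * ((a - t n) * ct t (e' n) a)) / (a - t n))%C
          by (rewrite <- Q1; field; exact Hat).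
        field. auto.
    (* Where [e] has no zero, multiplying numerator and denominator by [z - t m] handles nodes and
       other points at once. *)
    - destruct (exists_off_but z) as [m Hm].
      assert (Hr : rct t m e z <> 0%C).
      { intros E. apply Hzz. now apply (rct_zero t t_inj t_ge_1 t_inf m e z e_adm Hm). }
      exists (fun a => rct t m d a / rct t m e a - ct p res a)%C.
      assert (Hoff' : forall k, res k <> 0%C -> z <> p k).
      { intros k Hk ->. apply Hk. now apply P4. }
      pose proof (ct_sdiff_near p res z Hp1 Hpinf Ares Hoff') as N1.
      pose proof (near_off_but t t_ge_1 t_inf m z Hm) as N2.
      assert (Cr : ccont (rct t m e) z) by (apply sdiff_cont, rct_sdiff; auto).
      pose proof (ccont_neq0 _ _ Cr Hr) as N3. pose proof (Cmod_pos _ Hr) as Hrp.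
      pose proof (near_and _ _ _ N1 (near_and _ _ _ N2 N3)) as N4.
      split.
      + revert N4. apply near_imp. intros a [[S1 S2] [S3 S4]].
        apply sdiff_minus; [|exact S1].
        apply sdiff_div; [| |apply Cmod_pos_neq; lra]; apply rct_sdiff; auto.
      + destruct N4 as [d2 [Hd2 N4]]. exists (Rmin d1 d2). split; [now apply Rmin_glb_lt|].
        intros a [Ha0 Ha]. pose proof (Rmin_l d1 d2). pose proof (Rmin_r d1 d2).
        destruct (N4 a ltac:(lra)) as [[S1 S2] [S3 S4]].
        assert (Ho : off t a) by (apply Hpo; lra).
        assert (Hat : (a - t m)%C <> 0%C) by (apply Csub_neq, Ho).
        assert (Hr0 : rct t m e a <> 0%C) by (apply Cmod_pos_neq; lra).
        unfold E0. rewrite !(rct_ct t t_ge_1 t_inf) in * by assumption.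
        field. split; [|exact Hat]. intros E. apply Hr0. rewrite E. ring. }
  set (X1 := Rmax X 1). assert (HX1 : X <= X1) by apply Rmax_l. assert (HX2 : 1 <= X1) by apply Rmax_r.
  assert (HEo : forall z, outside t K3 z -> X1 <= Cmod z -> E z = E0 z).
  { intros z Hz HzX. apply HE2. destruct (HPb z Hz ltac:(lra)) as [Hzp _].
    pose proof (outside_off t t_ge_2 K3 z Hz) as Ho.
    apply sdiff_cont. unfold E0. apply sdiff_minus.
    - apply sdiff_div; [| |now apply Hnz_out]; apply ct_sdiff; auto.
    - apply ct_sdiff; auto. }
  set (BE := B + 8 * S0). assert (HBE : 0 <= BE) by (unfold BE; lra).
  assert (HEb1 : forall z, outside t K3 z -> X1 <= Cmod z -> Cmod (E z) <= BE).
  { intros z Hz HzX. rewrite HEo by assumption. unfold E0.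
    eapply Rle_trans; [apply Cmod_sub_le|]. apply Rplus_le_compat.
    - pose proof (Hnz_out z Hz) as Hnz. rewrite Cmod_div by exact Hnz. pose proof (Cmod_pos _ Hnz).
      apply Rmult_le_reg_r with (Cmod (ct t e z)); [assumption|].
      replace (Cmod (ct t d z) / Cmod (ct t e z) * Cmod (ct t e z)) with (Cmod (ct t d z)) by (field; lra).
      apply bounded; [|lra]. apply (outside_mono t t_ge_2 K3); [unfold K; lia|exact Hz].
    - destruct (HPb z Hz ltac:(lra)) as [_ Q]. eapply Rle_trans; [exact Q|].
      apply Rmult_le_compat_r; [exact HS0|]. apply Rmult_le_reg_r with (Cmod z); [lra|].
      replace (8 / Cmod z * Cmod z) with 8 by (field; lra). lra. }
  (* Around a point within [sig K3 n] of [t n], the circle of radius [2 * sig K3 n] stays at a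
     distance between [sig K3 n] and [3 * sig K3 n <= rho n] from [t n], hence outside all discs of
     exponent [K3]. *)
  assert (HEb2 : forall z, X1 + 2 <= Cmod z -> Cmod (E z) <= BE).
  { intros z HzX. destruct (classic (outside t K3 z)) as [Hz|Hz]; [apply HEb1; [exact Hz|lra]|].
    apply not_all_ex_not in Hz. destruct Hz as [n Hn]. apply Rnot_le_lt in Hn.
    change (/ Cmod (t n) ^ K3) with (sig K3 n) in Hn.
    pose proof (sig_pos K3 n) as Hs. pose proof (sig_rho K3 n K3_ge) as Hr.
    apply (center_bound E z (2 * sig K3 n)); [lra|intros; apply HE1|apply sdiff_cont, HE1|].
    intros x _. set (y := (z + RtoC (2 * sig K3 n) * cis x)%C).
    assert (Hy : Cmod (y - z) = 2 * sig K3 n) by (apply circle_dist; lra).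
    pose proof (rho_le_1 n).
    apply HEb1.
    - apply (ring_outside K3 n y K3_ge).
      pose proof (Cmod_sub_triangle y z (t n)). pose proof (Cmod_sub_triangle y (t n) z) as T.
      rewrite (Cmod_sub_sym (t n) z) in T. lra.
    - pose proof (Cmod_sub_ge z y) as T. rewrite Cmod_sub_sym in T. lra. }
  assert (HEb : forall z, Cmod (E z) <= BE).
  { intros z. set (R0 := Cmod z + X1 + 2). pose proof (Cmod_ge_0 z).
    apply (center_bound E z R0); [unfold R0; lra|intros; apply HE1|apply sdiff_cont, HE1|].
    intros x _. set (y := (z + RtoC R0 * cis x)%C).
    assert (Hy : Cmod (y - z) = R0) by (apply circle_dist; unfold R0; lra).
    apply HEb2. pose proof (Cmod_sub_le y z). unfold R0 in *. lra. }
  (* [E] is constant and its value is the limit; the remainder of the ratio is [ct p res], of order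
     [1 / |z|]. *)
  exists (E 0%C). intros eps Heps. exists (Rmax X1 (8 * S0 / eps)). intros z Hz HzX.
  pose proof (Rmax_l X1 (8 * S0 / eps)). pose proof (Rmax_r X1 (8 * S0 / eps)).
  rewrite (liouville E BE HE1 HEb 0%C z), HEo by (assumption || lra).
  pose proof (Hnz_out z Hz) as Hnz. unfold E0.
  replace (ct t d z - (ct t d z / ct t e z - ct p res z) * ct t e z)%C
    with (ct p res z * ct t e z)%C by (field; exact Hnz).
  rewrite Cmod_mult. apply Rmult_le_compat_r; [apply Cmod_ge_0|].
  destruct (HPb z Hz ltac:(lra)) as [_ Q]. eapply Rle_trans; [exact Q|].
  apply Rmult_le_reg_l with (Cmod z); [lra|].
  replace (Cmod z * (8 / Cmod z * S0)) with (8 * S0 / eps * eps) by (field; lra).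
  apply Rmult_le_compat_r; lra.
Qed.

End Limit.

(** * Complex derivatives *)

(** Unlike in [strict_deriv], one of the two points is fixed; this is all that [entire] provides. *)
Definition cder (f : C -> C) (z l : C) : Prop :=
  forall eps, 0 < eps -> exists delta, 0 < delta /\
    forall a, Cmod (a - z) < delta -> Cmod (f a - f z - l * (a - z)) <= eps * Cmod (a - z).

Lemma is_derive_cder (f : C -> C) (z l : C) :
  is_derive (K := C_AbsRing) (V := C_NormedModule) f z l <-> cder f z l.
Proof.
  split.
  - intros [_ H] eps He.
    assert (Hz : @is_filter_lim (AbsRing_UniformSpace C_AbsRing)
      (@locally (AbsRing_UniformSpace C_AbsRing) z) z) by (intros P HP; exact HP).
    destruct (H z Hz (mkposreal eps He)) as [d Hd]. exists d. split; [apply cond_pos|].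
    intros a Ha. specialize (Hd a Ha). simpl in Hd.
    assert (E : (f a - f z - l * (a - z))%C = minus (minus (f a) (f z)) (scal (minus a z) l)).
    { unfold minus, plus, opp, scal; simpl. unfold mult; simpl. ring. }
    rewrite E. exact Hd.
  - intros H. split; [apply is_linear_scal_l|]. intros y Hy.
    apply (is_filter_lim_locally_unique (K := C_AbsRing) (V := AbsRing_NormedModule C_AbsRing)) in Hy. subst y.
    intros [eps He]. destruct (H eps He) as [d [Hd K]]. exists (mkposreal d Hd). intros a Ha.
    specialize (K a Ha). simpl.
    assert (E : (f a - f z - l * (a - z))%C = minus (minus (f a) (f z)) (scal (minus a z) l)).
    { unfold minus, plus, opp, scal; simpl. unfold mult; simpl. ring. }
    rewrite E in K. exact K.
Qed.

Lemma cder_ccont (f : C -> C) (z l : C) : cder f z l -> ccont f z.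
Proof.
  intros H eps He. destruct (H 1 Rlt_0_1) as [d [Hd K]]. pose proof (Cmod_ge_0 l).
  exists (Rmin d (eps / (Cmod l + 2))). split; [apply Rmin_glb_lt; [exact Hd|apply Rdiv_lt_0_compat; lra]|].
  intros a Ha. pose proof (Rmin_l d (eps / (Cmod l + 2))). pose proof (Rmin_r d (eps / (Cmod l + 2))).
  specialize (K a ltac:(lra)).
  replace (f a - f z)%C with ((f a - f z - l * (a - z)) + l * (a - z))%C by ring.
  eapply Rle_lt_trans; [apply Cmod_triangle|]. rewrite Cmod_mult.
  apply Rle_lt_trans with ((Cmod l + 1) * Cmod (a - z)); [lra|].
  apply Rle_lt_trans with ((Cmod l + 1) * (eps / (Cmod l + 2))); [apply Rmult_le_compat_l; lra|].
  apply Rmult_lt_reg_r with (Cmod l + 2); [lra|].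
  replace ((Cmod l + 1) * (eps / (Cmod l + 2)) * (Cmod l + 2)) with ((Cmod l + 1) * eps) by (field; lra).
  nra.
Qed.

Lemma sdiff_cder (f : C -> C) (z : C) : sdiff f z -> exists l, cder f z l.
Proof.
  intros [l H]. exists l. intros eps He. destruct (H eps He) as [d [Hd K]]. exists d. split; [exact Hd|].
  intros a Ha. apply K; [rewrite Cmod_self; exact Hd|exact Ha].
Qed.

Lemma cder_ext (f g : C -> C) (z l : C) : near z (fun a => f a = g a) -> cder f z l -> cder g z l.
Proof.
  intros Hn H eps He. pose proof (near_here _ _ Hn) as Ez. destruct Hn as [e [He' E]].
  destruct (H eps He) as [d [Hd K]]. exists (Rmin d e). split; [now apply Rmin_glb_lt|].
  intros a Ha. pose proof (Rmin_l d e). pose proof (Rmin_r d e).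
  rewrite <- Ez, <- E by lra. apply K. lra.
Qed.

Lemma cder_mult (f g : C -> C) (z l m : C) :
  cder f z l -> cder g z m -> cder (fun a => f a * g a)%C z (l * g z + f z * m)%C.
Proof.
  intros Hf Hg. pose proof (cder_ccont g z m Hg) as Cg. intros eps He.
  pose proof (Cmod_ge_0 l). pose proof (Cmod_ge_0 (f z)). pose proof (Cmod_ge_0 (g z)).
  set (B := Cmod l + Cmod (f z) + Cmod (g z) + 1). assert (HB : 0 < B) by (unfold B; lra).
  set (h := Rmin 1 (eps / (3 * B))).
  assert (Hh : 0 < h) by (apply Rmin_glb_lt; [lra|apply Rdiv_lt_0_compat; lra]).
  assert (Hh1 : h <= 1) by apply Rmin_l.
  assert (Hh2 : 3 * (h * B) <= eps).
  { replace eps with (3 * (eps / (3 * B) * B)) by (field; lra).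
    apply Rmult_le_compat_l; [lra|]. apply Rmult_le_compat_r; [lra|apply Rmin_r]. }
  destruct (Hf h Hh) as [d1 [Hd1 K1]]. destruct (Hg h Hh) as [d2 [Hd2 K2]].
  destruct (Cg h Hh) as [d3 [Hd3 K3]].
  exists (Rmin d1 (Rmin d2 d3)). split; [repeat apply Rmin_glb_lt; assumption|]. intros a Ha.
  pose proof (Rmin_l d1 (Rmin d2 d3)). pose proof (Rmin_r d1 (Rmin d2 d3)).
  pose proof (Rmin_l d2 d3). pose proof (Rmin_r d2 d3).
  specialize (K1 a ltac:(lra)). specialize (K2 a ltac:(lra)). specialize (K3 a ltac:(lra)).
  replace (f a * g a - f z * g z - (l * g z + f z * m) * (a - z))%C
    with ((f a - f z - l * (a - z)) * g a + f z * (g a - g z - m * (a - z)) + l * (a - z) * (g a - g z))%C by ring.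
  set (u := Cmod (a - z)) in *. assert (Hu : 0 <= u) by apply Cmod_ge_0.
  eapply Rle_trans; [apply Cmod_triangle|]. eapply Rle_trans; [apply Rplus_le_compat_r, Cmod_triangle|].
  rewrite !Cmod_mult. fold u.
  assert (Hga : Cmod (g a) <= B) by (pose proof (Cmod_sub_ge (g a) (g z)); unfold B; lra).
  assert (T1 : Cmod (f a - f z - l * (a - z)) * Cmod (g a) <= h * u * B)
    by (apply Rmult_le_compat; try apply Cmod_ge_0; assumption).
  assert (T2 : Cmod (f z) * Cmod (g a - g z - m * (a - z)) <= B * (h * u))
    by (apply Rmult_le_compat; try apply Cmod_ge_0; [unfold B; lra|assumption]).
  assert (T3 : Cmod l * u * Cmod (g a - g z) <= B * u * h).
  { apply Rmult_le_compat; [apply Rmult_le_pos; lra|apply Cmod_ge_0| |lra].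
    apply Rmult_le_compat_r; [exact Hu|unfold B; lra]. }
  assert (T4 : 3 * (h * B) * u <= eps * u) by (apply Rmult_le_compat_r; assumption).
  lra.
Qed.

(** * From entire functions to coefficients and back *)

Section Interface.

Variables (t : nat -> C) (A : C -> C) (mu : nat -> R).
Hypothesis data : CdB_data t A mu.
Hypothesis t_ge_2 : forall n, 2 <= Cmod (t n).

Lemma CdB_to_infinity : to_infinity t.
Proof.
  intros X. pose proof (CdB_infty t A mu data) as H. apply is_lim_seq_spec in H.
  destruct (H X) as [N HN]. exists N. intros n Hn. left. now apply HN.
Qed.

Let t_inj := CdB_inj t A mu data.

Let t_ge_1 : forall n, 1 <= Cmod (t n).
Proof. intros n. pose proof (t_ge_2 n). lra. Qed.

Definition weight (n : nat) : R := sqrt (mu n).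

Lemma weight_pos (n : nat) : 0 < weight n.
Proof. apply sqrt_lt_R0, (CdB_mu_pos t A mu data). Qed.

Lemma weight_l2 : ex_series (fun n => (weight n / Cmod (t n)) ^ 2).
Proof.
  apply (ex_series_bound _ (fun n => 2 * (mu n / (Cmod (t n) ^ 2 + 1)))).
  - intros n. split; [apply pow2_ge_0|]. pose proof (t_ge_2 n).
    pose proof (CdB_mu_pos t A mu data n).
    unfold Rdiv at 1. rewrite Rpow_mult_distr. unfold weight. rewrite pow2_sqrt by lra.
    rewrite pow_inv. assert (4 <= Cmod (t n) ^ 2) by nra.
    apply Rmult_le_reg_r with (Cmod (t n) ^ 2 * (Cmod (t n) ^ 2 + 1)); [nra|].
    replace (mu n * / Cmod (t n) ^ 2 * (Cmod (t n) ^ 2 * (Cmod (t n) ^ 2 + 1)))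
      with (mu n * (Cmod (t n) ^ 2 + 1)) by (field; lra).
    replace (2 * (mu n / (Cmod (t n) ^ 2 + 1)) * (Cmod (t n) ^ 2 * (Cmod (t n) ^ 2 + 1)))
      with (mu n * (2 * Cmod (t n) ^ 2)) by (field; lra).
    apply Rmult_le_compat_l; lra.
  - apply ex_series_Rscal, (CdB_mu_sum t A mu data).
Qed.

Lemma A_off (z : C) : off t z -> A z <> 0%C.
Proof.
  intros Hz E. apply (CdB_zeros t A mu data) in E. destruct E as [n E]. now apply (Hz n).
Qed.

Lemma A_t (n : nat) : A (t n) = 0%C.
Proof. apply (CdB_zeros t A mu data). now exists n. Qed.

Lemma A'_t (n : nat) : C_derive A (t n) <> 0%C.
Proof. apply (CdB_simple t A mu data). apply A_t. Qed.

Lemma A_cder (z : C) : cder A z (C_derive A z).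
Proof.
  apply is_derive_cder, C_derive_correct; [exact z|]. apply (CdB_entire t A mu data).
Qed.

Lemma not_range_off (z : C) : ~ range t z <-> off t z.
Proof.
  split.
  - intros H n E. apply H. now exists n.
  - intros H [n E]. now apply (H n).
Qed.

Definition A_quot (n : nat) (z : C) : C :=
  if excluded_middle_informative (z = t n) then C_derive A (t n) else (A z / (z - t n))%C.

Lemma A_quot_t (n : nat) : A_quot n (t n) = C_derive A (t n).
Proof. unfold A_quot. destruct (excluded_middle_informative (t n = t n)); congruence. Qed.

Lemma A_quot_neq (n : nat) (z : C) : z <> t n -> A_quot n z = (A z / (z - t n))%C.
Proof. intros H. unfold A_quot. destruct (excluded_middle_informative (z = t n)); congruence. Qed.

Lemma A_quot_cont (n : nat) : ccont (A_quot n) (t n).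
Proof.
  intros eps He. destruct (A_cder (t n) (eps / 2)) as [d [Hd K]]; [lra|]. exists d. split; [exact Hd|].
  intros a Ha. rewrite A_quot_t. destruct (classic (a = t n)) as [->|Hne].
  - rewrite A_quot_t, Cmod_self. exact He.
  - rewrite A_quot_neq by exact Hne. specialize (K a Ha). rewrite A_t in K.
    pose proof (Cmod_sub_pos _ _ Hne) as Hp.
    replace (A a / (a - t n) - C_derive A (t n))%C
      with ((A a - 0 - C_derive A (t n) * (a - t n)) / (a - t n))%C by (field; now apply Csub_neq).
    rewrite Cmod_div by now apply Csub_neq.
    apply Rmult_lt_reg_r with (Cmod (a - t n)); [exact Hp|].
    replace (Cmod (A a - 0 - C_derive A (t n) * (a - t n)) / Cmod (a - t n) * Cmod (a - t n))
      with (Cmod (A a - 0 - C_derive A (t n) * (a - t n))) by (field; lra).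
    apply Rle_lt_trans with (eps / 2 * Cmod (a - t n)); [exact K|]. apply Rmult_lt_compat_r; lra.
Qed.

(* [A] is only assumed complex differentiable, so that differentiability of
   [A z / (z - t n)] at [t n] is a condition; it is implied by the existence of
   an element of the space that does not vanish at [t n]. *)
Definition smooth_at (n : nat) : Prop := exists l, cder (A_quot n) (t n) l.

Definition coefficients (f : C -> C) (c : nat -> C) : Prop :=
  in_space weight smooth_at c /\ (forall w, zeros f w <-> zr t c w) /\
  (Defs.nonzero f -> exists m, c m <> 0%C).

Lemma coefficients_exist (f : C -> C) : CdB_space t A mu f -> exists c, coefficients f c.
Proof.
  intros [Hent [a [Ha Hf]]]. pose proof CdB_to_infinity as t_inf.
  set (c := fun n => (a n * RtoC (sqrt (mu n)))%C). exists c.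
  assert (Hl2 : ex_series (fun n => (Cmod (c n) / weight n) ^ 2)).
  { apply (ex_series_ext (fun n => Cmod (a n) ^ 2)); [|exact Ha]. intros n.
    unfold c. rewrite Cmod_mult, Cmod_R, Rabs_right by (apply Rle_ge, sqrt_pos).
    fold (weight n). pose proof (weight_pos n). f_equal. field. lra. }
  assert (Ac : adm t c).
  { apply (in_space_adm t weight (fun _ => True) t_ge_2 weight_pos weight_l2).
    split; [exact Hl2|intros n _; exact I]. }
  assert (Hoff : forall z, off t z -> f z = (A z * ct t c z)%C).
  { intros z Hz. destruct (Hf z (proj2 (not_range_off z) Hz)) as [s [Hs Es]].
    rewrite Es. f_equal. symmetry. apply is_series_C_unique, Hs. }
  assert (Cf : forall z, exists l, cder f z l).
  { intros z. destruct (Hent z) as [l Hl]. exists l. now apply is_derive_cder. }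
  assert (Hpunct : forall m, exists d, 0 < d /\
     forall a, 0 < Cmod (a - t m) < d -> f a = (A_quot m a * rct t m c a)%C).
  { intros m. destruct (punctured_off t t_inj t_ge_2 t_inf (t m)) as [d [Hd Ho]].
    exists d. split; [exact Hd|]. intros z Hz. specialize (Ho z Hz).
    rewrite (Hoff z Ho), A_quot_neq by apply Ho. rewrite (rct_ct t t_ge_1 t_inf) by assumption.
    field. apply Csub_neq, Ho. }
  assert (Srct : forall m, sdiff (rct t m c) (t m)).
  { intros m. apply rct_sdiff; auto. now apply t_off_but. }
  (* The product formula holds only off the nodes. Near [t m] it reads [f = A_quot m * rct t m c],
     and the value at [t m] follows because all three functions are continuous there. *)
  assert (Ht : forall m, f (t m) = (C_derive A (t m) * c m)%C).
  { intros m. destruct (Hpunct m) as [d [Hd Hp]]. destruct (Cf (t m)) as [l Hl].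
    rewrite <- A_quot_t, <- (rct_t t m c).
    apply (punctured_limit_unique f (fun a => A_quot m a * rct t m c a)%C (t m) d Hd); [|  |exact Hp].
    - now apply (cder_ccont f (t m) l).
    - intros eps He.
      pose proof (sdiff_cont _ _ (Srct m)) as C1. pose proof (A_quot_cont m) as C2.
      set (u := A_quot m (t m)) in *. set (v := rct t m c (t m)) in *.
      pose proof (Cmod_ge_0 u). pose proof (Cmod_ge_0 v).
      set (h := Rmin 1 (eps / (Cmod u + Cmod v + 2))).
      assert (Hh : 0 < h) by (apply Rmin_glb_lt; [lra|apply Rdiv_lt_0_compat; lra]).
      assert (Hh1 : h <= 1) by apply Rmin_l.
      assert (Hh2 : h * (Cmod u + Cmod v + 2) <= eps).
      { replace eps with (eps / (Cmod u + Cmod v + 2) * (Cmod u + Cmod v + 2)) by (field; lra).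
        apply Rmult_le_compat_r; [lra|apply Rmin_r]. }
      destruct (near_and _ _ _ (ccont_near _ _ h C1 Hh) (ccont_near _ _ h C2 Hh)) as [e [He' K]].
      exists e. split; [exact He'|]. intros z Hz. destruct (K z Hz) as [K1 K2]. fold u in K2. fold v in K1.
      replace (A_quot m z * rct t m c z - u * v)%C
        with ((A_quot m z - u) * (rct t m c z - v) + (A_quot m z - u) * v + u * (rct t m c z - v))%C by ring.
      eapply Rle_lt_trans; [apply Cmod_triangle|].
      eapply Rle_lt_trans; [apply Rplus_le_compat_r, Cmod_triangle|]. rewrite !Cmod_mult.
      set (p := Cmod (A_quot m z - u)) in *. set (q := Cmod (rct t m c z - v)) in *.
      assert (0 <= p) by apply Cmod_ge_0. assert (0 <= q) by apply Cmod_ge_0.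
      assert (p * q <= h * 1) by (apply Rmult_le_compat; lra).
      assert (p * Cmod v <= h * Cmod v) by (apply Rmult_le_compat_r; lra).
      assert (Cmod u * q <= Cmod u * h) by (apply Rmult_le_compat_l; lra). lra. }
  split; [split; [exact Hl2|]|split].
  (* Where [c m <> 0], [A_quot m] is the quotient of the entire function [f] by [rct t m c], which
     does not vanish near [t m], and so it is differentiable. *)
  - intros m Hm. destruct (Cf (t m)) as [l Hl].
    assert (Hrm : rct t m c (t m) <> 0%C) by (rewrite rct_t; exact Hm).
    destruct (sdiff_cder _ _ (sdiff_inv _ _ (Srct m) Hrm)) as [l' Hl'].
    eexists. eapply cder_ext; [|exact (cder_mult _ _ _ _ _ Hl Hl')].
    destruct (Hpunct m) as [d [Hd Hp]].
    pose proof (ccont_neq0 _ _ (sdiff_cont _ _ (Srct m)) Hrm) as [e [He N]].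
    exists (Rmin d e). split; [now apply Rmin_glb_lt|]. intros z Hz.
    pose proof (Rmin_l d e). pose proof (Rmin_r d e). simpl.
    destruct (classic (z = t m)) as [->|Hne].
    + rewrite Ht, rct_t, A_quot_t. field. exact Hm.
    + pose proof (Cmod_sub_pos _ _ Hne). rewrite (Hp z) by lra. specialize (N z ltac:(lra)).
      field. apply Cmod_pos_neq. pose proof (Cmod_pos _ Hrm). lra.
  - intros w. unfold zeros. destruct (off_or_t t w) as [Ho|[m ->]].
    + rewrite (Hoff w Ho). split.
      * intros E. apply Cmult_integral in E. destruct E as [E|E]; [now apply A_off in E|].
        now apply zr_of_ct.
      * intros Hz. rewrite (zr_ct t t_ge_1 t_inf c w Hz Ho). ring.
    + rewrite Ht. split.
      * intros E. apply Cmult_integral in E. destruct E as [E|E]; [now apply A'_t in E|].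
        now apply zr_of_t.
      * intros Hz. rewrite (zr_t t c m Hz). ring.
  - intros [z Hz]. apply NNPP. intros HN. apply Hz.
    assert (Hc0 : forall n, c n = 0%C) by (intros n; apply NNPP; intros Hn; apply HN; now exists n).
    destruct (off_or_t t z) as [Ho|[m ->]].
    + rewrite (Hoff z Ho). unfold ct. rewrite csum_zero; [ring|]. intros n. rewrite Hc0. apply Cdiv_0_l.
    + rewrite Ht, Hc0. ring.
Qed.

(** At a node the value is the limit of [A * ct t c]: the simple zero of [A] cancels the pole and
    leaves [A'] times the coefficient. *)
Definition of_coefficients (c : nat -> C) (z : C) : C :=
  match excluded_middle_informative (exists n, z = t n) with
  | left H => (C_derive A z * c (proj1_sig (constructive_indefinite_description _ H)))%C
  | right _ => (A z * ct t c z)%C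
  end.

Lemma of_coefficients_off (c : nat -> C) (z : C) : off t z -> of_coefficients c z = (A z * ct t c z)%C.
Proof.
  intros Hz. unfold of_coefficients. destruct (excluded_middle_informative (exists n, z = t n)) as [[n E]|_]; [|reflexivity].
  exfalso. now apply (Hz n).
Qed.

Lemma of_coefficients_t (c : nat -> C) (m : nat) :
  of_coefficients c (t m) = (C_derive A (t m) * c m)%C.
Proof.
  unfold of_coefficients. destruct (excluded_middle_informative (exists n, t m = t n)) as [H|H].
  - destruct (constructive_indefinite_description _ H) as [k Hk]. simpl.
    now rewrite <- (t_inj m k Hk).
  - exfalso. apply H. now exists m.
Qed.

Lemma of_coefficients_space (c : nat -> C) (m : nat) : in_space weight smooth_at c -> c m <> 0%C ->
  CdB_space t A mu (of_coefficients c) /\ Defs.nonzero (of_coefficients c) /\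
  forall w, zr t c w -> zeros (of_coefficients c) w.
Proof.
  intros Hc Hm. pose proof CdB_to_infinity as t_inf.
  assert (Ac : adm t c) by (apply (in_space_adm t weight smooth_at t_ge_2 weight_pos weight_l2 c Hc)).
  split; [split|split].
  - intros z. assert (G : exists l, cder (of_coefficients c) z l).
    { destruct (off_or_t t z) as [Ho|[k ->]].
      - destruct (sdiff_cder (ct t c) z) as [l Hl]; [apply ct_sdiff; auto|].
        eexists. eapply cder_ext; [|exact (cder_mult _ _ _ _ _ (A_cder z) Hl)].
        generalize (near_off t t_ge_1 t_inf z Ho). apply near_imp. intros a Ha.
        symmetry. now apply of_coefficients_off.
      - destruct (punctured_off t t_inj t_ge_2 t_inf (t k)) as [d [Hd Hp]].
        (* If [c k = 0], the transform has no pole at [t k] and differentiability of [A] suffices.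
           Otherwise that of [A_quot k] is required, which is what the support condition [smooth_at]
           provides. *)
        destruct (classic (c k = 0%C)) as [Hk|Hk].
        + destruct (sdiff_cder (ct t (zero_at k c)) (t k)) as [l Hl].
          { apply ct_sdiff; auto using adm_zero_at. apply zero_at_off. now apply t_off_but. }
          eexists. eapply cder_ext; [|exact (cder_mult _ _ _ _ _ (A_cder (t k)) Hl)].
          exists d. split; [exact Hd|]. intros a Ha. simpl.
          destruct (classic (a = t k)) as [->|Hne].
          * rewrite of_coefficients_t, Hk, A_t. ring.
          * pose proof (Cmod_sub_pos _ _ Hne). specialize (Hp a ltac:(lra)).
            rewrite of_coefficients_off by exact Hp. f_equal. apply csum_ext. intros n.
            unfold zero_at. destruct (Nat.eq_dec n k) as [->|]; [now rewrite Hk|reflexivity].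
        + destruct (proj2 Hc k Hk) as [l1 Hl1].
          destruct (sdiff_cder (rct t k c) (t k)) as [l Hl].
          { apply rct_sdiff; auto. now apply t_off_but. }
          eexists. eapply cder_ext; [|exact (cder_mult _ _ _ _ _ Hl1 Hl)].
          exists d. split; [exact Hd|]. intros a Ha. simpl.
          destruct (classic (a = t k)) as [->|Hne].
          * now rewrite of_coefficients_t, A_quot_t, rct_t.
          * pose proof (Cmod_sub_pos _ _ Hne). specialize (Hp a ltac:(lra)).
            rewrite of_coefficients_off, A_quot_neq, (rct_ct t t_ge_1 t_inf) by assumption.
            field. now apply Csub_neq. }
    destruct G as [l Hl]. exists l. now apply is_derive_cder.
  - exists (fun n => c n / RtoC (weight n))%C.
    assert (Hw : forall n, RtoC (weight n) <> 0%C).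
    { intros n E. apply RtoC_inj in E. pose proof (weight_pos n). lra. }
    split.
    + apply (ex_series_ext (fun n => (Cmod (c n) / weight n) ^ 2)); [|apply Hc].
      intros n. rewrite Cmod_div by apply Hw. rewrite Cmod_R, Rabs_right; [reflexivity|].
      apply Rle_ge. left. apply weight_pos.
    + intros z Hz. apply not_range_off in Hz. exists (ct t c z). split; [|now apply of_coefficients_off].
      apply (is_series_ext (fun n => c n / (z - t n))%C).
      * intros n. fold (weight n). unfold Cdiv at 2 3. rewrite <- (Cmult_assoc (c n)), Cinv_l by apply Hw.
        unfold Cdiv. now rewrite Cmult_1_r.
      * apply is_series_csum. now apply ct_asum.
  - exists (t m). rewrite of_coefficients_t. apply Cmult_neq_0; [apply A'_t|exact Hm].
  - intros w Hw. unfold zeros. destruct (off_or_t t w) as [Ho|[k ->]].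
    + rewrite of_coefficients_off, (zr_ct t t_ge_1 t_inf c w Hw Ho) by exact Ho. ring.
    + rewrite of_coefficients_t, (zr_t t c k Hw). ring.
Qed.

Lemma localized_coefficients : localization_property t A mu ->
  exists r r_max, (forall n, 0 < r n) /\ (forall n, r n <= r_max) /\
    (forall n m, n <> m -> forall z, ~ (Cmod (z - t n) < r n /\ Cmod (z - t m) < r m)) /\
    forall c m, in_space weight smooth_at c -> c m <> 0%C ->
      finite_set (fun w => zr t c w /\ forall n, r n <= Cmod (w - t n)) /\
      finite_set (fun n => ~ at_most_one (fun w => zr t c w /\ Cmod (w - t n) < r n)).
Proof.
  intros [r [Hr [Hlim [Hdisj Hloc]]]].
  assert (Hmax : exists r_max, forall n, r n <= r_max).
  { apply is_lim_seq_spec in Hlim. destruct (Hlim (mkposreal 1 Rlt_0_1)) as [N HN]. simpl in HN.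
    destruct (bounded_eventually r (fun _ => 1) N 1) as [K [_ HK]]; [intros; lra| |].
    - intros n Hn. specialize (HN n Hn). apply Rabs_def2 in HN. lra.
    - exists K. intros n. specialize (HK n). lra. }
  destruct Hmax as [r_max Hmax]. exists r, r_max.
  split; [exact Hr|split; [exact Hmax|split; [exact Hdisj|]]]. intros c m Hc Hm.
  destruct (of_coefficients_space c m Hc Hm) as [Hf [Hnz Hz]].
  destruct (Hloc _ Hf Hnz) as [L1 L2]. split.
  - revert L1. apply finite_sub. intros w [Hw Ho]. split; [now apply Hz|].
    intros [n Hn]. exact (Rlt_not_le _ _ Hn (Ho n)).
  - revert L2. apply finite_sub. intros n Hn Ham. apply Hn. intros x y [Hx1 Hx2] [Hy1 Hy2].
    apply Ham; split; auto.
Qed.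

End Interface.

(** Otherwise the point dividing the segment in the ratio [p : q] would lie in both discs. *)
Lemma disjoint_discs_separated (a b : C) (p q : R) : 0 < p -> 0 < q ->
  (forall z, ~ (Cmod (z - a) < p /\ Cmod (z - b) < q)) -> p + q <= Cmod (a - b).
Proof.
  intros Hp Hq H. apply Rnot_lt_le. intros Hlt. set (l := p / (p + q)).
  apply (H (a + RtoC l * (b - a))%C).
  assert (Hl : l * (p + q) = p) by (unfold l; field; lra).
  assert (Hl0 : 0 < l) by (apply Rdiv_lt_0_compat; lra).
  assert (Hl1 : 0 < 1 - l).
  { assert (E : (1 - l) * (p + q) = q) by (rewrite Rmult_minus_distr_r, Hl; ring).
    apply Rmult_lt_reg_r with (p + q); lra. }
  split.
  - replace (a + RtoC l * (b - a) - a)%C with (RtoC (- l) * (a - b))%C by (rewrite RtoC_opp; ring).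
    rewrite Cmod_mult, Cmod_R, Rabs_Ropp, Rabs_right by lra.
    apply Rlt_le_trans with (l * (p + q)); [apply Rmult_lt_compat_l; assumption|lra].
  - replace (a + RtoC l * (b - a) - b)%C with (RtoC (1 - l) * (a - b))%C by (rewrite RtoC_minus; ring).
    rewrite Cmod_mult, Cmod_R, Rabs_right by lra.
    replace q with ((1 - l) * (p + q)) by (rewrite Rmult_minus_distr_r, Hl; ring).
    apply Rmult_lt_compat_l; assumption.
Qed.

(** * Comparison of attraction sets *)

Lemma zr_ext (t c c' : nat -> C) (w : C) : (forall n, c n = c' n) -> zr t c w -> zr t c' w.
Proof. intros E [d [H1 H2]]. exists d. split; [|exact H2]. intros n. now rewrite <- E. Qed.

(** Repeated [div_swap] brings the division by [w] to the front, so a double zero of the end of a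
    chain is one of its start, even if [w] occurs in [ws]. *)
Lemma chain_double (t : nat -> C) (ws : list C) (c d d' : nat -> C) (w y : C) :
  chain t c ws d -> is_div t w d d' -> zr t d' y -> exists c', is_div t w c c' /\ zr t c' y.
Proof.
  revert c. induction ws as [|v ws IH]; intros c Hch Hd Hy.
  - simpl in Hch. subst. now exists d'.
  - destruct Hch as [c1 [H1 H2]]. destruct (IH c1 H2 Hd Hy) as [c2 [H3 H4]].
    destruct (div_swap t v w c c1 c2 H1 H3) as [S1 S2].
    eexists. split; [exact S1|]. exact (zr_of_div t v y _ c2 S2 H4).
Qed.

Lemma list_C_bound (l : list C) : exists W, 0 < W /\ forall z, In z l -> Cmod z <= W.
Proof.
  induction l as [|x l [W [HW IH]]]; [exists 1; split; [lra|intros z []]|].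
  exists (Rmax W (Cmod x)). pose proof (Rmax_l W (Cmod x)). pose proof (Rmax_r W (Cmod x)).
  split; [lra|]. intros z [<-|Hz]; [lra|]. specialize (IH z Hz). lra.
Qed.

(** Beyond three times a bound [W] for all the roots, every linear factor lies between [2/3 |z|] and
    [4/3 |z|]. *)
Lemma zero_poly_compare (ws vs : list C) : length ws = length vs ->
  exists Y, forall z, Y <= Cmod z ->
    Cmod (zero_poly ws z) <= 2 ^ length vs * Cmod (zero_poly vs z) /\ 0 < Cmod (zero_poly vs z).
Proof.
  intros E. destruct (list_C_bound (ws ++ vs)) as [W [HW HWb]]. exists (3 * W). intros z Hz.
  assert (H1 : Cmod (zero_poly ws z) <= (4/3 * Cmod z) ^ length ws).
  { apply zero_poly_le. intros w Hw. specialize (HWb w (in_or_app _ _ _ (or_introl Hw))).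
    pose proof (Cmod_sub_le z w). lra. }
  assert (H2 : (2/3 * Cmod z) ^ length vs <= Cmod (zero_poly vs z)).
  { apply zero_poly_ge; [lra|]. intros w Hw. specialize (HWb w (in_or_app _ _ _ (or_intror Hw))).
    pose proof (Cmod_sub_ge z w). lra. }
  assert (H3 : 0 < (2/3 * Cmod z) ^ length vs) by (apply pow_lt; lra).
  split; [|lra]. eapply Rle_trans; [exact H1|]. rewrite E.
  replace (4/3 * Cmod z) with (2 * (2/3 * Cmod z)) by field. rewrite Rpow_mult_distr.
  apply Rmult_le_compat_l; [apply pow_le; lra|exact H2].
Qed.

Section Comparison.

Variables (t : nat -> C) (s : nat -> R) (regular : nat -> Prop).
Hypothesis t_inj : forall n m, t n = t m -> n = m.
Hypothesis t_ge_2 : forall n, 2 <= Cmod (t n).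
Hypothesis t_inf : to_infinity t.
Hypothesis s_pos : forall n, 0 < s n.
Hypothesis s_l2 : ex_series (fun n => (s n / Cmod (t n)) ^ 2).
Variables (rho : nat -> R) (M0 : nat).
Hypothesis rho_ge : forall n, / Cmod (t n) ^ M0 <= rho n.
Hypothesis rho_le_1 : forall n, rho n <= 1.
Hypothesis rho_sep : forall n m, n <> m -> rho n + rho m <= Cmod (t n - t m).
Variables (r : nat -> R) (r_max : R).
Hypothesis r_pos : forall n, 0 < r n.
Hypothesis r_le : forall n, r n <= r_max.
Hypothesis r_disj : forall n m, n <> m -> forall z, ~ (Cmod (z - t n) < r n /\ Cmod (z - t m) < r m).
Hypothesis localized : forall c m, in_space s regular c -> c m <> 0%C ->
  finite_set (fun w => zr t c w /\ forall n, r n <= Cmod (w - t n)) /\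
  finite_set (fun n => ~ at_most_one (fun w => zr t c w /\ Cmod (w - t n) < r n)).

Definition attracts (c : nat -> C) (n : nat) : Prop := exists z, zr t c z /\ Cmod (z - t n) < rho n.

Let t_ge_1' : forall n, 1 <= Cmod (t n).
Proof. intros n. pose proof (t_ge_2 n). lra. Qed.

Lemma attraction_comparable (c d : nat -> C) (mc md : nat) :
  in_space s regular c -> in_space s regular d -> c mc <> 0%C -> d md <> 0%C ->
  finite_set (fun n => attracts d n /\ ~ attracts c n) \/
  finite_set (fun n => attracts c n /\ ~ attracts d n).
Proof.
  intros Hc Hd Hmc Hmd.
  assert (Ac : adm t c) by (now apply (in_space_adm t s regular)).
  assert (Ad : adm t d) by (now apply (in_space_adm t s regular)).
  destruct (classic (forall b, exists m, pencil c d b m <> 0%C)) as [Hpen|Hpen].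
  (* Degenerate pencil: [c = b d], so every zero of [d] is a zero of [c]. *)
  2:{ left. apply not_all_ex_not in Hpen. destruct Hpen as [b Hb]. exists nil.
      intros n [[z [Hz1 Hz2]] Hn]. exfalso. apply Hn. exists z. split; [|exact Hz2].
      apply (zr_ext t (fun n => d n + (b - 1) * d n)%C); [|now apply zr_plus_scal].
      intros k. assert (E : pencil c d b k = 0%C) by (apply NNPP; intros Hk; apply Hb; now exists k).
      unfold pencil in E. replace (c k) with ((c k + - b * d k) + b * d k)%C by ring. rewrite E. ring. }
  (* In the remaining case [d] has infinitely many zeros, enough to supply the list [vs] of any
     prescribed length. *)
  destruct (classic (finite_set (attracts d))) as [Hfin|Hinf].
  { left. revert Hfin. apply finite_sub. tauto. }
  set (K3 := (M0 + 2)%nat). set (K := (K3 + 2 * M0 + 6)%nat).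
  assert (Hspace : forall b, in_space s regular (pencil c d b)) by (intros b; now apply in_space_plus_scal).
  destruct (omitted_value t t_inj t_ge_2 t_inf c d K Ac Ad) as [a [q [X [Hq Hom]]]].
  { intros b. destruct (Hpen b) as [m Hm].
    now apply (zeros_outside_finite t s regular t_inj t_ge_2 t_inf s_pos s_l2 rho M0 rho_ge rho_sep
      r r_max r_pos r_le r_disj localized (pencil c d b) m). }
  set (e0 := pencil c d a) in *. destruct (Hpen a) as [m0 Hm0]. fold e0 in Hm0.
  assert (He0 : in_space s regular e0) by apply Hspace.
  assert (Ae0 : adm t e0) by (now apply (in_space_adm t s regular)).
  pose proof (zeros_outside_finite t s regular t_inj t_ge_2 t_inf s_pos s_l2 rho M0 rho_ge rho_sep
      r r_max r_pos r_le r_disj localized e0 m0 (K + 2) He0 Hm0) as F1.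
  pose proof (double_zeros_finite t s regular t_inj t_ge_2 t_inf s_pos s_l2 rho M0 rho_ge rho_le_1 rho_sep
      r r_max r_le localized e0 m0 He0 Hm0) as F2.
  destruct (finite_C_bound _ F1) as [B1 HB1].
  assert (HB2 : exists T, forall n, (exists w y e', is_div t w e0 e' /\ zr t e' y /\
    Cmod (w - t n) < rho n /\ Cmod (y - t n) < rho n) -> Cmod (t n) < T).
  { destruct F2 as [l Hl]. destruct (list_C_bound (map t l)) as [W [HW HWb]].
    exists (W + 1). intros n Hn. apply Hl in Hn. specialize (HWb (t n) (in_map t l n Hn)). lra. }
  destruct HB2 as [T HT].
  (* Beyond this radius every zero of [e0] is within [|t n| ^ -(K + 2)] of some node, and no disc of
     radius [rho n] around a node holds a double zero or a pair. All zeros inside are divided out of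
     [e0]. *)
  destruct (clear_disc t t_inj t_ge_1' t_inf e0 m0 (Rmax B1 (T + 1)) Ae0 Hm0)
    as [ws [e [Hch [Hws Hez]]]].
  pose proof (Rmax_l B1 (T + 1)) as HX1. pose proof (Rmax_r B1 (T + 1)) as HX2.
  assert (Ae : adm t e) by (now apply (chain_adm t t_ge_1' ws e0)).
  assert (Hzinf : ~ finite_set (zr t d)).
  { intros Hf. apply Hinf. revert Hf. apply (finite_inj_rel (fun w n => Cmod (w - t n) < rho n)).
    - intros n [z [Hz1 Hz2]]. now exists z.
    - intros w n n' H1 H2. now apply (disc_unique t rho rho_sep n n' w). }
  (* As many zeros are divided out of [d] as out of [e0]; the two polynomials have the same degree,
     so far out the ratio changes only by bounded factors. *)
  destruct (infinite_list _ Hzinf (length ws)) as [vs [Hvs1 [Hvs2 Hvs3]]].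
  destruct (chain_of_zeros t vs d Hvs1 Hvs3) as [d1 Hch1].
  assert (Ad1 : adm t d1) by (now apply (chain_adm t t_ge_1' vs d)).
  destruct (zero_poly_compare ws vs (eq_sym Hvs2)) as [Y1 HY1].
  destruct (zero_poly_compare vs ws Hvs2) as [Y2 HY2].
  set (J2 := 2 ^ length ws). assert (HJ2 : 0 < J2) by (apply pow_lt; lra).
  assert (Hfe : forall z, off t z -> ct t e0 z = (zero_poly ws z * ct t e z)%C)
    by (intros z Hz; now apply (chain_ct t t_ge_1' t_inf)).
  assert (Hfd : forall z, off t z -> ct t d z = (zero_poly vs z * ct t d1 z)%C)
    by (intros z Hz; now apply (chain_ct t t_ge_1' t_inf)).
  destruct (ratio_limit t t_inj t_ge_2 t_inf rho M0 rho_ge rho_le_1 rho_sep e d1 K3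
     (Rmax X Y1) (J2 / q)) as [kappa Hkappa].
  - unfold K3. lia.
  - exact Ae.
  - exact Ad1.
  - intros w Hw. apply NNPP. intros HN. specialize (Hez w Hw).
    assert (Cmod w < B1); [|lra]. apply HB1. split; [now apply (chain_zr t ws e0 e)|].
    intros n. apply Rnot_lt_le. intros Hlt. apply HN. exists n. exact Hlt.
  - intros n w e' y D1 D2 D3 D4. assert (Hw : zr t e w) by now exists e'. specialize (Hez w Hw).
    destruct (chain_double t ws e0 e e' w y Hch D1 D2) as [c' [C1 C2]].
    assert (Cmod (t n) < T) by (apply HT; exists w, y, c'; auto).
    pose proof (rho_le_1 n). pose proof (Cmod_sub_ge w (t n)). lra.
  - now apply Rdiv_lt_0_compat.
  - intros z Hz HzX. pose proof (Rmax_l X Y1). pose proof (Rmax_r X Y1).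
    pose proof (outside_off t t_ge_2 _ z Hz) as Ho.
    specialize (Hom z Hz ltac:(lra)). rewrite (Hfe z Ho), (Hfd z Ho), !Cmod_mult in Hom.
    destruct (HY1 z ltac:(lra)) as [Q1 Q2]. rewrite Hvs2 in Q1. fold J2 in Q1.
    pose proof (Cmod_ge_0 (ct t e z)).
    apply Rmult_le_reg_l with (q * Cmod (zero_poly vs z)); [now apply Rmult_lt_0_compat|].
    replace (q * Cmod (zero_poly vs z) * (J2 / q * Cmod (ct t e z)))
      with (J2 * Cmod (zero_poly vs z) * Cmod (ct t e z)) by (field; lra).
    apply Rle_trans with (Cmod (zero_poly ws z) * Cmod (ct t e z)); [lra|].
    apply Rmult_le_compat_r; assumption.
  - assert (Hce : forall z, off t z -> ct t c z = (ct t e0 z + a * ct t d z)%C).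
    { intros z Hz. unfold e0, pencil. rewrite (ct_plus_scal t t_ge_1' t_inf) by assumption. ring. }
    assert (HK3 : (M0 < K3)%nat) by (unfold K3; lia).
    pose proof (Cmod_ge_0 a) as Ha0.
    destruct (classic (kappa = 0%C)) as [Hk0|Hk0].
    (* This [eps] gives [|ct d| <= |ct e0| / (2 (1 + |a|))], and then [c = e0 + a d] yields
       [|ct d| <= |ct c|]. *)
    + left. set (eps := / (J2 * (2 * (1 + Cmod a)))).
      assert (Heps : 0 < eps) by (apply Rinv_0_lt_compat; apply Rmult_lt_0_compat; lra).
      destruct (Hkappa eps Heps) as [X' HX'].
      apply (dominated_attraction t s regular t_inj t_ge_2 t_inf s_pos s_l2 rho M0 rho_ge rho_le_1 rho_sep
        r r_max r_pos r_le r_disj localized c d md K3 (Rmax X' Y2) 1 HK3 Hc Hd Hmd Rlt_0_1).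
      intros z Hz HzX. pose proof (Rmax_l X' Y2). pose proof (Rmax_r X' Y2).
      pose proof (outside_off t t_ge_2 _ z Hz) as Ho.
      specialize (HX' z Hz ltac:(lra)). rewrite Hk0 in HX'.
      replace (ct t d1 z - 0 * ct t e z)%C with (ct t d1 z) in HX' by ring.
      destruct (HY2 z ltac:(lra)) as [Q1 Q2]. fold J2 in Q1.
      assert (Hde : (2 * (1 + Cmod a)) * Cmod (ct t d z) <= Cmod (ct t e0 z)).
      { rewrite (Hfd z Ho), (Hfe z Ho), !Cmod_mult.
        apply Rle_trans with ((2 * (1 + Cmod a)) * ((J2 * Cmod (zero_poly ws z)) * (eps * Cmod (ct t e z)))).
        - apply Rmult_le_compat_l; [lra|]. apply Rmult_le_compat; try apply Cmod_ge_0; assumption.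
        - right. unfold eps. field. lra. }
      rewrite (Hce z Ho). pose proof (Cmod_sub_ge (ct t e0 z) (- (a * ct t d z))) as Q.
      replace (ct t e0 z - - (a * ct t d z))%C with (ct t e0 z + a * ct t d z)%C in Q by ring.
      rewrite Cmod_opp, Cmod_mult in Q. pose proof (Cmod_ge_0 (ct t d z)). nra.
    (* Far out and outside the discs, [|ct e|] is at most [2 / |kappa|] times [|ct d1|]; so [e0],
       and with it [c = e0 + a d], is bounded by a multiple of [d]. *)
    + right. pose proof (Cmod_pos _ Hk0) as Hkp.
      destruct (Hkappa (Cmod kappa / 2) ltac:(lra)) as [X' HX'].
      assert (HB : 0 < J2 * (2 / Cmod kappa) + Cmod a).
      { assert (0 < J2 * (2 / Cmod kappa)); [|lra].
        apply Rmult_lt_0_compat; [lra|apply Rdiv_lt_0_compat; lra]. }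
      apply (dominated_attraction t s regular t_inj t_ge_2 t_inf s_pos s_l2 rho M0 rho_ge rho_le_1 rho_sep
        r r_max r_pos r_le r_disj localized d c mc K3 (Rmax X' Y1) _ HK3 Hd Hc Hmc HB).
      intros z Hz HzX. pose proof (Rmax_l X' Y1). pose proof (Rmax_r X' Y1).
      pose proof (outside_off t t_ge_2 _ z Hz) as Ho.
      specialize (HX' z Hz ltac:(lra)). destruct (HY1 z ltac:(lra)) as [Q1 Q2].
      rewrite Hvs2 in Q1. fold J2 in Q1.
      assert (H1 : Cmod kappa / 2 * Cmod (ct t e z) <= Cmod (ct t d1 z)).
      { pose proof (Cmod_sub_ge (kappa * ct t e z) (ct t d1 z)) as Q.
        rewrite Cmod_sub_sym, Cmod_mult in Q. lra. }
      assert (H2 : Cmod (ct t e0 z) <= J2 * (2 / Cmod kappa) * Cmod (ct t d z)).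
      { rewrite (Hfd z Ho), (Hfe z Ho), !Cmod_mult.
        apply Rle_trans with ((J2 * Cmod (zero_poly vs z)) * (2 / Cmod kappa * Cmod (ct t d1 z))); [|right; ring].
        apply Rmult_le_compat; try apply Cmod_ge_0; [exact Q1|].
        apply Rmult_le_reg_l with (Cmod kappa / 2); [lra|].
        replace (Cmod kappa / 2 * (2 / Cmod kappa * Cmod (ct t d1 z))) with (Cmod (ct t d1 z)) by (field; lra).
        exact H1. }
      rewrite (Hce z Ho). eapply Rle_trans; [apply Cmod_triangle|]. rewrite Cmod_mult. lra.
Qed.

End Comparison.

Theorem theorem1p3 :
  forall (t : nat -> C) (A : C -> C) (mu : nat -> R),
    CdB_data t A mu ->
    power_separated t ->
    (forall n, 2 <= Cmod (t n)) ->
    finite_order A ->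
    localization_property t A mu ->
    forall M : R, 0 < M -> pairwise_disjoint (power_disc t M) ->
    forall S1 S2 : C -> Prop,
      attraction_set t A mu M S1 ->
      attraction_set t A mu M S2 ->
      finite_set (setminus S1 S2) \/ finite_set (setminus S2 S1).
Proof.
  intros t A mu data _ t_ge_2 _ Hloc M HM Hdisj S1 S2 HS1 HS2.
  destruct (localized_coefficients t A mu data t_ge_2 Hloc) as [r [r_max [R1 [R2 [R3 R4]]]]].
  set (rho := fun n => Rpower (Cmod (t n)) (- M)).
  (* An integer exponent above [M] bounds the radii of the discs from below by integer powers, as
     the coefficient arguments require. *)
  destruct (INR_unbounded M) as [M0 HM0].
  assert (Hrho1 : forall n, / Cmod (t n) ^ M0 <= rho n).
  { intros n. pose proof (t_ge_2 n). unfold rho. rewrite <- Rpower_pow by lra.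
    rewrite <- Rpower_Ropp. apply Rle_Rpower; lra. }
  assert (Hrho2 : forall n, rho n <= 1).
  { intros n. pose proof (t_ge_2 n). unfold rho. rewrite <- (Rpower_O (Cmod (t n))) by lra.
    apply Rle_Rpower; lra. }
  assert (Hrho0 : forall n, 0 < rho n) by (intros n; apply exp_pos).
  assert (Hrho3 : forall n m, n <> m -> rho n + rho m <= Cmod (t n - t m)).
  { intros n m Hnm. apply disjoint_discs_separated; auto. intros z. exact (Hdisj n m Hnm z). }
  destruct HS1 as [_ [f1 [F1 [N1 [D1 D1']]]]]. destruct HS2 as [_ [f2 [F2 [N2 [D2 D2']]]]].
  destruct (coefficients_exist t A mu data t_ge_2 f1 F1) as [c [C1 [C2 C3]]].
  destruct (coefficients_exist t A mu data t_ge_2 f2 F2) as [d [E1 [E2 E3]]].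
  destruct (C3 N1) as [mc Hmc]. destruct (E3 N2) as [md Hmd].
  assert (Hsub : forall (S S' : C -> Prop) f f' g g',
    (forall w, zeros f w <-> zr t g w) -> (forall w, zeros f' w <-> zr t g' w) ->
    finite_set (setminus S (attracted t M f)) -> finite_set (setminus (attracted t M f') S') ->
    finite_set (fun n => attracts t rho g n /\ ~ attracts t rho g' n) -> finite_set (setminus S S')).
  { intros S S' f f' g g' Z Z' H1 H2 H3.
    apply (finite_sub _ (fun z => setminus S (attracted t M f) z \/
      (setminus (attracted t M f') S' z \/
       exists n, (attracts t rho g n /\ ~ attracts t rho g' n) /\ z = t n))).
    - intros z [Hz1 Hz2]. destruct (classic (attracted t M f z)) as [Ha|Ha]; [|left; split; assumption].
      right. destruct (classic (attracted t M f' z)) as [Hb|Hb]; [left; split; assumption|right].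
      destruct Ha as [n [-> [w [Hw1 Hw2]]]]. exists n. split; [|reflexivity]. split.
      + exists w. split; [now apply Z|exact Hw2].
      + intros [y [Hy1 Hy2]]. apply Hb. exists n. split; [reflexivity|]. exists y.
        split; [now apply Z'|exact Hy2].
    - apply finite_or; [exact H1|]. apply finite_or; [exact H2|].
      revert H3. apply finite_image with (f := t). auto. }
  destruct (attraction_comparable t (weight mu) (smooth_at t A) (CdB_inj t A mu data) t_ge_2
    (CdB_to_infinity t A mu data) (weight_pos t A mu data) (weight_l2 t A mu data t_ge_2)
    rho M0 Hrho1 Hrho2 Hrho3 r r_max R1 R2 R3 R4 c d mc md C1 E1 Hmc Hmd) as [H|H].
  - right. now apply (Hsub S2 S1 f2 f1 d c).
  - left. now apply (Hsub S1 S2 f1 f2 c d).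
Qed.
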